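(* Let $M^3\subset\mathbb{C}^2$ be a local real analytic hypersurface passing through the origin, $0\in M^3$, which belongs to the General Class $\mathsf{I}$, i.e. such that for any local vector field generator $\mathcal{L}$ of $T^{1,0}M$, the three fields $$\Big\{\mathcal{L},\ \overline{\mathcal{L}},\ [\mathcal{L},\overline{\mathcal{L}}]\Big\}$$ constitute a frame for $\mathbb{C}\otimes_{\mathbb{R}}TM$. Then $M$ may always be represented near the origin, in suitable local holomorphic coordinates $(z,w)\in\mathbb{C}^2$ (centered at the origin) with $w=u+\sqrt{-1}\,v$, by a real analytic equation of the form $$v=z\overline{z}+z\overline{z}\,\mathrm{O}_1(z,\overline{z})+z\overline{z}\,\mathrm{O}_1(u).$$
   Context: $T^{1,0}M$ denotes the bundle $T^{1,0}\mathbb{C}^2|_M\cap(\mathbb{C}\otimes_{\mathbb{R}}TM)$, here of complex rank $1$; $\overline{\mathcal{L}}$ is the conjugate field and $[\cdot,\cdot]$ the Lie bracket. ''Frame'' means a basis of the fiber at every point of the (local) manifold $M$. Remainder notation: $\mathrm{O}_k(t_1,\dots,t_N)$ denotes an unspecified convergent power series (with complex coefficients) in $t_1,\dots,t_N$ all of whose monomials have total degree $\geqslant k$. By convention $z\overline{z}\,\mathrm{O}_1(u)$ is shorthand for $z\overline{z}\,u\,\mathrm{O}_0(z,\overline{z},u)$. The right-hand side of the graphing equation is a real-valued convergent power series in $(z,\overline{z},u)$. *)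

(* Defs.v *)
From HB Require Import structures.
From mathcomp Require Import all_boot all_order all_algebra.
From mathcomp Require Import complex.
From mathcomp Require Import all_classical all_reals all_analysis.

Set Implicit Arguments.
Unset Strict Implicit.
Unset Printing Implicit Defensive.

Import Order.TTheory GRing.Theory Num.Theory.
Import numFieldNormedType.Exports.

Local Open Scope classical_set_scope.
Local Open Scope ring_scope.
Local Open Scope complex_scope.

(* R[i]^o is the field R[i] seen as a normed (hence topological) space over
   itself; the norm on C^2 is the maximum of the two moduli. *)
Notation C2 R := ((R[i])^o * (R[i])^o)%type.

Section PowerSeries.
Variables (R : realType) (n : nat).

Definition mindex := {ffun 'I_n -> nat}.

Definition mdegree (a : mindex) : nat := (\sum_i a i)%N.

Definition monomial (t : n.-tuple R[i]) (a : mindex) : R[i] :=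
  \prod_i tnth t i ^+ a i.

Definition converges_on (c : mindex -> R[i]) (r : R) : Prop :=
  0 < r /\
  (\esum_(a in [set: mindex]) (complex.Re `|c a| * r ^+ mdegree a)%:E < +oo)%E.

Definition homogeneous_part (c : mindex -> R[i]) (d : nat)
    (t : n.-tuple R[i]) : R[i] :=
  \sum_(b : {ffun 'I_n -> 'I_d.+1} | (\sum_i b i)%N == d)
    c [ffun i => b i : nat] * monomial t [ffun i => b i : nat].

(* The sum is taken by increasing total degree; the order is immaterial
   wherever the series converges absolutely. *)
Definition psum (c : mindex -> R[i]) (t : n.-tuple R[i]) : R[i] :=
  lim ((fun N : nat =>
    \sum_(d < N) homogeneous_part c d t : (R[i])^o) @ \oo).

(* The germ defined by c is an O_k of its variables. *)
Definition bigO_order (k : nat) (c : mindex -> R[i]) : Prop :=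
  forall a, (mdegree a < k)%N -> c a = 0.

End PowerSeries.

Section CRGeometry.
Variable R : realType.
Implicit Types (p q : C2 R) (U V M : set (C2 R)).

(* The real basis of C^2 dual to the coordinates (x, y, u, v), where
   z = x + i y and w = u + i v. *)
Definition real_basis (k : 'I_4) : C2 R :=
  tnth [tuple (1, 0) : C2 R; ('i%C, 0) : C2 R;
               (0, 1) : C2 R; (0, 'i%C) : C2 R] k.

Definition real_translate p (h : 4.-tuple R) : C2 R :=
  p + \sum_k (tnth h k)%:C *: real_basis k.

Definition real_analytic_at (f : C2 R -> R[i]) p : Prop :=
  exists (c : mindex 4 -> R[i]) (r : R), converges_on c r /\
    forall h : 4.-tuple R, (forall k, `|tnth h k| < r) ->
      f (real_translate p h) = psum c (map_tuple (real_complex R) h).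

Definition holomorphic_at (f : C2 R -> R[i]) p : Prop :=
  exists (c : mindex 2 -> R[i]) (r : R), converges_on c r /\
    forall h : C2 R, `|h| < r%:C ->
      f (p + h) = psum c [tuple (h.1 : R[i]); (h.2 : R[i])].

(* (z, w) = Phi p are holomorphic coordinates on the open set U, centered at
   the origin. *)
Definition holomorphic_coordinates U (Phi : C2 R -> C2 R) : Prop :=
  exists (V : set (C2 R)) (Psi : C2 R -> C2 R),
    [/\ open U, U 0, Phi 0 = 0 & open V] /\
    [/\ forall p, U p -> V (Phi p) /\ Psi (Phi p) = p,
        forall q, V q -> U (Psi q) /\ Phi (Psi q) = q,
        forall p, U p -> holomorphic_at (fun q => (Phi q).1) p /\
                         holomorphic_at (fun q => (Phi q).2) p
      & forall p, V p -> holomorphic_at (fun q => (Psi q).1) p /\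
                         holomorphic_at (fun q => (Psi q).2) p].

(* A vector of C (x)_R T_p C^2 is the row of its complex coefficients in the
   basis d/dx, d/dy, d/du, d/dv. *)

Definition partial (k : 'I_4) (f : C2 R -> R) p : R :=
  derive1 (fun t : R => f (p + t%:C *: real_basis k)) 0.

Definition cpartial (k : 'I_4) (f : C2 R -> R[i]) p : R[i] :=
  partial k (fun q => complex.Re (f q)) p
  +i* partial k (fun q => complex.Im (f q)) p.

Definition conj_vec (X : 'rV[R[i]]_4) : 'rV[R[i]]_4 := map_mx (@conjc R) X.

Definition lie_bracket (X Y : C2 R -> 'rV[R[i]]_4) p : 'rV[R[i]]_4 :=
  \row_j \sum_k (X p 0 k * cpartial k (fun q => Y q 0 j) p
                 - Y p 0 k * cpartial k (fun q => X q 0 j) p).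

Definition d_z : 'rV[R[i]]_4 := 2^-1 *: \row_k tnth [tuple 1; - 'i%C; 0; 0] k.
Definition d_w : 'rV[R[i]]_4 := 2^-1 *: \row_k tnth [tuple 0; 0; 1; - 'i%C] k.

(* T^{1,0} C^2 has the same coefficients at every point. *)
Definition T10C2 : {vspace 'rV[R[i]]_4} := <<[:: d_z; d_w]>>%VS.

Definition gradient (rho : C2 R -> R) p : 'rV[R]_4 := \row_k partial k rho p.

(* M is a real analytic hypersurface in U with defining function rho; nothing
   is said of M outside U. *)
Definition defining_function M U (rho : C2 R -> R) : Prop :=
  [/\ open U,
      forall p, U p -> real_analytic_at (fun q => (rho q)%:C) p,
      forall p, U p -> (M p <-> rho p = 0)
    & forall p, U p -> M p -> gradient rho p != 0].

(* The real tangent space T_p M = ker (d rho)_p, meaningful for p in M. *)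
Definition tangent (rho : C2 R -> R) p : {vspace 'rV[R]_4} :=
  lker (linfun (mulmxr (gradient rho p)^T : 'rV[R]_4 -> 'rV[R]_1)).

Definition complexify (E : {vspace 'rV[R]_4}) : {vspace 'rV[R[i]]_4} :=
  <<[seq map_mx (real_complex R) X | X <- vbasis E]>>%VS.

Definition CTM (rho : C2 R -> R) p : {vspace 'rV[R[i]]_4} :=
  complexify (tangent rho p).

Definition T10M (rho : C2 R -> R) p : {vspace 'rV[R[i]]_4} :=
  (T10C2 :&: CTM rho p)%VS.

(* A local section of T^{1,0}M is given by a real analytic field L on an open
   set V of C^2 which restricts to it on M; on M, brackets of fields tangent
   to M do not depend on the choice of such extensions. *)
Definition T10_generator M (rho : C2 R -> R) V
    (L : C2 R -> 'rV[R[i]]_4) : Prop :=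
  (forall p, V p -> forall j, real_analytic_at (fun q => L q 0 j) p) /\
  (forall p, V p -> M p -> basis_of (T10M rho p) [:: L p]).

Definition general_class_I M U (rho : C2 R -> R) : Prop :=
  forall V (L : C2 R -> 'rV[R[i]]_4), open V -> V `<=` U ->
    T10_generator M rho V L ->
    forall p, V p -> M p ->
      basis_of (CTM rho p)
        [:: L p; conj_vec (L p);
            lie_bracket L (fun q => conj_vec (L q)) p].

End CRGeometry.

(* Main.v *)
Require Import Defs.
From HB Require Import structures.
From mathcomp Require Import all_boot all_order all_algebra.
From mathcomp Require Import complex.
From mathcomp Require Import all_classical all_reals all_analysis.
From mathcomp Require Import finmap ring lra.

Set Implicit Arguments.
Unset Strict Implicit.
Unset Printing Implicit Defensive.

Import Order.TTheory GRing.Theory Num.Theory.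
Import numFieldNormedType.Exports.

Local Open Scope classical_set_scope.
Local Open Scope ring_scope.
Local Open Scope complex_scope.

(** A real analytic hypersurface of class I is, after a linear change of
    coordinates, the zero set of a real power series
      P(z, y, w, o) = (w - o) / 2i - z y + c z^2 + c' y^2 + ...
    at y = z^*, o = w^*: membership in class I means that the Levi form does not
    vanish at 0, which allows the coefficient of z y to be normalised to - 1
    ([levi_neq0], [levi_coordinates]).  It remains to remove from the graphing
    function all terms that are pure in z or pure in its conjugate.

    Allow y and o to vary independently of z and w.  The equation
    P(0, 0, s + i v, s - i v) = 0 defines a curve of M, which extends to complex
    s ([transverse_curve]).  The Segre varieties of its points, P(z, 0, w, o) = 0
    with o on the conjugate curve at parameter W, foliate a neighbourhood of the
    origin ([segre_foliation]).  The new coordinates are z and the parameter W of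
    the leaf; both W as a function of (z, w) and w as a function of (z, W) come
    from the implicit function theorem, and its uniqueness clause makes them
    mutually inverse.  By construction the new equation vanishes identically for
    y = 0, W = o, and by reality for z = 0, W = o; hence so does the graphing
    function phi(z, y, u) for z = 0 or y = 0 ([normal_graph]), it is divisible by
    z y ([graph_divisible]), and the quotient takes the value 1 at the origin
    because the change of coordinates does not alter the mixed second order
    coefficient ([graph_leading]).  Expanding the quotient as
    1 + A(z, y) + u B(z, y, u) gives the stated form.

    Everything is done with power series that converge absolutely on a polydisc.
    [analytic] records a bound for the sum of the moduli of the terms; such
    bounds are compatible with countable sums ([analytic_sum]), hence with
    products and substitution ([analytic_comp]), and with differences
    ([analytic_lip]), so that the implicit function theorem is a contraction
    argument ([implicit_function]).  Statements are about functions rather than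
    coefficients: divisibility by a variable is read off from any series that
    represents the function ([analytic_split]).  Re-expansion at another point is a
    substitution as well ([germ_comp_at]). *)

(** * Moduli as elements of the real field *)

Section Modulus.
Variable R : realType.
Implicit Types x y : R[i].

Definition nm x : R := complex.Re `|x|.

Lemma nmE x : `|x| = (nm x)%:C.
Proof. by rewrite /nm RRe_real // normr_real. Qed.

Lemma nm_ge0 x : 0 <= nm x.
Proof. by rewrite -lecR -nmE normr_ge0. Qed.

Lemma nmD x y : nm (x + y) <= nm x + nm y.
Proof. by rewrite -lecR rmorphD /= -!nmE ler_normD. Qed.

Lemma nmN x : nm (- x) = nm x.
Proof. by rewrite /nm normrN. Qed.

Lemma nmB x y : nm (x - y) <= nm x + nm y.
Proof. by rewrite -(nmN y) nmD. Qed.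

Lemma nm_distC x y : nm (x - y) = nm (y - x).
Proof. by rewrite -nmN opprB. Qed.

Lemma nmM x y : nm (x * y) = nm x * nm y.
Proof. by apply: complexI; rewrite rmorphM /= -!nmE normrM. Qed.

Lemma nmX x n : nm (x ^+ n) = nm x ^+ n.
Proof. by apply: complexI; rewrite rmorphXn /= -!nmE normrX. Qed.

Lemma nm0 : nm 0 = 0.
Proof. by rewrite /nm normr0. Qed.

Lemma nm1 : nm 1 = 1.
Proof. by rewrite /nm normr1. Qed.

Lemma nm_eq0 x : (nm x == 0) = (x == 0).
Proof. by rewrite -[RHS]normr_eq0 nmE (inj_eq (@complexI R) _ 0). Qed.

Lemma nm_gt0 x : (0 < nm x) = (x != 0).
Proof. by rewrite lt_def nm_ge0 andbT nm_eq0. Qed.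

Lemma nmV x : nm x^-1 = (nm x)^-1.
Proof. by apply: complexI; rewrite fmorphV /= -!nmE normfV. Qed.

Lemma nm_conj x : nm x^*%C = nm x.
Proof. by rewrite /nm normcJ. Qed.

Lemma nm_real (a : R) : nm a%:C = `|a|.
Proof. by rewrite /nm normc_def /= expr0n addr0 sqrtr_sqr. Qed.

Lemma nm_i : nm 'i%C = 1.
Proof. by rewrite /nm normc_def /= expr0n add0r expr1n sqrtr1. Qed.

Lemma Re_le_nm x : `|complex.Re x| <= nm x.
Proof. by rewrite -lecR -nmE normc_ge_Re. Qed.

Lemma Im_le_nm x : `|complex.Im x| <= nm x.
Proof.
rewrite -(nm_conj x) -(mulr1 (nm _)) -nm_i -nmM.
apply: le_trans (Re_le_nm _).
by case: x => a b /=; simpc; rewrite /= ?mulr1 ?normrN.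
Qed.

Lemma nm_sum (I : Type) (s : seq I) (P : pred I) (F : I -> R[i]) :
  nm (\sum_(i <- s | P i) F i) <= \sum_(i <- s | P i) nm (F i).
Proof.
elim/big_rec2 : _ => [|i y z _ h]; first by rewrite nm0.
by apply: le_trans (nmD _ _) _; rewrite lerD2l.
Qed.

Lemma nm_ltC x (r : R) : (`|x| < r%:C) = (nm x < r).
Proof. by rewrite nmE ltcR. Qed.

Lemma nm_small_eq x y : (forall e, 0 < e -> nm (x - y) <= e) -> x = y.
Proof.
move=> h; apply/eqP; rewrite -subr_eq0 -nm_eq0 eq_le nm_ge0 andbT.
by apply/ler_addgt0Pr => e e0; rewrite add0r h.
Qed.

End Modulus.

(** * Unordered sums of complex families *)

Section Summation.
Variable R : realType.
Local Notation K := R[i].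

(** No order of summation is chosen: index sets are
    multi-indices, or products of them, and sums over them are exchanged. *)
Definition has_sum (I : choiceType) (F : I -> K) (s : K) : Prop :=
  forall e : R, 0 < e -> exists J : {fset I}, forall J' : {fset I},
    (J `<=` J')%fset -> nm (\sum_(i <- J') F i - s) <= e.

Definition abs_bounded (I : choiceType) (F : I -> K) (C : R) : Prop :=
  forall J : {fset I}, \sum_(i <- J) nm (F i) <= C.

Lemma big_fset_sub (V : zmodType) (I : choiceType) (A B : {fset I}) (F : I -> V) :
  (A `<=` B)%fset ->
  \sum_(i <- B) F i = \sum_(i <- A) F i + \sum_(i <- (B `\` A)%fset) F i.
Proof.
move=> AB; rewrite (big_fsetID _ (mem A)) /=; congr (_ + _).
  by apply: eq_fbig => // i; rewrite !inE /= andbC andb_idr // => /(fsubsetP AB).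
by apply: eq_fbig => // i; rewrite !inE /= andbC.
Qed.

Lemma has_sum_unique (I : choiceType) (F : I -> K) s t :
  has_sum F s -> has_sum F t -> s = t.
Proof.
move=> hs ht; apply: nm_small_eq => e e0.
have e2 : 0 < e / 2 by rewrite divr_gt0.
have [J hJ] := hs _ e2; have [J' hJ'] := ht _ e2.
have h1 := hJ (J `|` J')%fset (fsubsetUl _ _).
have h2 := hJ' (J `|` J')%fset (fsubsetUr _ _).
set S := \sum_(i <- _) _ in h1 h2.
have -> : s - t = (S - t) - (S - s) by ring.
by apply: le_trans (nmB _ _) _; rewrite [leRHS]splitr lerD.
Qed.

Lemma has_sumD (I : choiceType) (F G : I -> K) s t :
  has_sum F s -> has_sum G t -> has_sum (fun i => F i + G i) (s + t).
Proof.
move=> hs ht e e0.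
have e2 : 0 < e / 2 by rewrite divr_gt0.
have [J hJ] := hs _ e2; have [J' hJ'] := ht _ e2.
exists (J `|` J')%fset => L; rewrite fsubUset => /andP[JL J'L].
rewrite big_split /=.
set S := \sum_(i <- _) F i; set T := \sum_(i <- _) G i.
have -> : S + T - (s + t) = (S - s) + (T - t) by ring.
by apply: le_trans (nmD _ _) _; rewrite [leRHS]splitr lerD // ?hJ ?hJ'.
Qed.

Lemma has_sumZ (I : choiceType) (F : I -> K) s k :
  has_sum F s -> has_sum (fun i => k * F i) (k * s).
Proof.
move=> hs e e0.
have k0 : 0 < nm k + 1 by rewrite ltr_wpDl ?nm_ge0.
have [J hJ] := hs (e / (nm k + 1)) (divr_gt0 e0 k0).
exists J => L JL; rewrite -mulr_sumr -mulrBr nmM.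
apply: le_trans (ler_wpM2l (nm_ge0 _) (hJ _ JL)) _.
rewrite mulrCA ler_piMr ?(ltW e0) // ler_pdivrMr // mul1r lerDl ler01 //.
Qed.

Lemma has_sum_fin (I : choiceType) (F : I -> K) (J : {fset I}) :
  (forall i, i \notin J -> F i = 0) -> has_sum F (\sum_(i <- J) F i).
Proof.
move=> F0 e e0; exists J => L JL; rewrite (big_fset_sub _ JL).
have -> : \sum_(i <- (L `\` J)%fset) F i = 0.
  by rewrite big_seq big1 // => i; rewrite inE => /andP[/F0].
by rewrite addr0 subrr nm0 ltW.
Qed.

Lemma has_sum_conj (I : choiceType) (F : I -> K) s :
  has_sum F s -> has_sum (fun i => (F i)^*%C) s^*%C.
Proof.
move=> hs e e0; have [J hJ] := hs e e0; exists J => L JL.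
by rewrite -rmorph_sum -rmorphB nm_conj hJ.
Qed.

Lemma has_sum_bound (I : choiceType) (F : I -> K) s C :
  abs_bounded F C -> has_sum F s -> nm s <= C.
Proof.
move=> FC hs; apply/ler_addgt0Pr => e e0.
have [J hJ] := hs e e0; have := hJ J (fsubset_refl _).
set S := \sum_(i <- _) _ => h.
have -> : s = S - (S - s) by ring.
apply: le_trans (nmB _ _) _; apply: lerD => //.
exact: le_trans (nm_sum _ _ _) (FC J).
Qed.

(** Finite index sets pull back along an injection, which lets a family be
    summed on the domain when it is supported on the image. *)
Lemma sum_preimage (V : zmodType) (I J : choiceType) (phi : I -> J) (F : J -> V)
    (B : {fset J}) :
  injective phi -> (forall j, F j != 0 -> exists i, j = phi i) ->
  exists A : {fset I}, (forall i, (i \in A) = (phi i \in B)) /\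
    \sum_(i <- A) F (phi i) = \sum_(j <- B) F j.
Proof.
move=> phiI Fphi.
pose psi j := if pselect (exists i, j = phi i) is left h then Some (projT1 (cid h)) else None.
have psiK i : psi (phi i) = Some i.
  rewrite /psi; case: pselect => [h|[]]; last by exists i.
  by case: (cid h) => i' /= /phiI ->.
have psiP j i : psi j = Some i -> j = phi i.
  by rewrite /psi; case: pselect => // h [<-]; case: (cid h).
pose A := [fset i in pmap psi B]%fset.
have memA i : (i \in A) = (phi i \in B).
  rewrite !inE /= mem_pmap; apply/mapP/idP => [[j jB /esym/psiP <-//]|iB].
  by exists (phi i); rewrite ?psiK.
exists A; split => //.
transitivity (\sum_(j <- (phi @` A)%fset) F j).
  by rewrite [RHS]big_imfset //= => ? ? _ _; apply: phiI.
apply: big_fset_incl.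
  by apply/fsubsetP => _ /imfsetP[i iA' ->]; rewrite -memA.
move=> j jB jn; apply/eqP/negP => /negP/Fphi [i ji].
by move: jn; rewrite ji in_imfset //= memA -ji jB.
Qed.

Lemma has_sum_inj (I J : choiceType) (phi : I -> J) (F : J -> K) s :
  injective phi -> (forall j, F j != 0 -> exists i, j = phi i) ->
  has_sum (F \o phi) s -> has_sum F s.
Proof.
move=> phiI Fphi hs e e0; have [A hA] := hs e e0.
exists (phi @` A)%fset => B AB.
have [A' [memA' <-]] := sum_preimage B phiI Fphi.
apply: hA; apply/fsubsetP => i iA; rewrite memA'; apply: (fsubsetP AB).
by rewrite in_imfset.
Qed.

(** The real case, by a supremum: finite sums of a nonnegative bounded family
    increase to their supremum. *)
Lemma has_sum_nneg (I : choiceType) (F : I -> R) C :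
  (forall i, 0 <= F i) -> (forall J : {fset I}, \sum_(i <- J) F i <= C) ->
  exists s, has_sum (fun i => (F i)%:C) s.
Proof.
move=> F0 FC.
pose S := [set \sum_(i <- J) F i | J in [set: {fset I}]].
have hS : has_sup S.
  split; first by exists (\sum_(i <- fset0) F i), fset0.
  by exists C => _ [J _ <-].
exists (sup S)%:C => e e0.
have [_ [J _ <-] hJ] := sup_adherent e0 hS.
exists J => L JL; rewrite -rmorph_sum -rmorphB nm_real /=.
have h1 : \sum_(i <- L) F i <= sup S by apply: ub_le_sup; [exact: hS.2|exists L].
have h2 : \sum_(i <- J) F i <= \sum_(i <- L) F i.
  by rewrite (big_fset_sub _ JL) lerDl sumr_ge0.
by rewrite ler_norml; apply/andP; split; lra.
Qed.

(** Real and imaginary parts are at most the modulus, so each of them is the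
    modulus minus a nonnegative bounded family. *)
Lemma has_sum_exists (I : choiceType) (F : I -> K) C :
  abs_bounded F C -> exists s, has_sum F s.
Proof.
move=> FC.
have real_case (g : K -> R) : (forall x, `|g x| <= nm x) ->
    exists s, has_sum (fun i => (g (F i))%:C) s.
  move=> hg.
  have [s1 h1] : exists s, has_sum (fun i => (nm (F i))%:C) s.
    by apply: (has_sum_nneg (C := C)) => // i; exact: nm_ge0.
  have [s2 h2] : exists s, has_sum (fun i => (nm (F i) - g (F i))%:C) s.
    apply: (has_sum_nneg (C := C + C)) => [i|J].
      by rewrite subr_ge0 (le_trans (ler_norm _)).
    apply: le_trans (lerD (FC J) (FC J)); rewrite -big_split /=.
    apply: ler_sum => i _; rewrite lerD2l.
    by apply: le_trans (hg (F i)); rewrite -normrN ler_norm.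
  exists (s1 + (- 1) * s2).
  have -> : (fun i => (g (F i))%:C) =
      (fun i => (nm (F i))%:C + (- 1) * (nm (F i) - g (F i))%:C) :> (I -> K).
    by apply/funext => i; rewrite rmorphB /=; ring.
  by apply: has_sumD => //; apply: has_sumZ.
have [s1 h1] := real_case (@complex.Re R) (@Re_le_nm R).
have [s2 h2] := real_case (@complex.Im R) (@Im_le_nm R).
exists (s1 + 'i%C * s2).
have -> : F = (fun i => (complex.Re (F i))%:C + 'i%C * (complex.Im (F i))%:C).
  by apply/funext => i; rewrite -complexE.
by apply: has_sumD => //; apply: has_sumZ.
Qed.

Lemma has_sum_sum (I J : choiceType) (B : {fset J}) (F : I -> J -> K) (d : J -> K) :
  (forall j, j \in B -> has_sum (F^~ j) (d j)) ->
  has_sum (fun i => \sum_(j <- B) F i j) (\sum_(j <- B) d j).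
Proof.
move=> h.
suff H (s : seq J) : {subset s <= B} ->
    has_sum (fun i => \sum_(j <- s) F i j) (\sum_(j <- s) d j) by exact: H.
elim: s => [|j s IH] sB.
  under eq_fun do rewrite big_nil.
  rewrite big_nil => e e0; exists fset0 => J' _.
  by rewrite big1 // subrr nm0 ltW.
under eq_fun do rewrite big_cons.
rewrite big_cons; apply: has_sumD; first by apply/h/sB; rewrite inE eqxx.
by apply: IH => k ks; apply: sB; rewrite inE ks orbT.
Qed.

(** Fubini: both iterated sums are within e of the sum over a finite rectangle
    that almost exhausts the absolute values. *)
Lemma has_sum_swap (I J : choiceType) (F : I -> J -> K) (g : I -> K) (d : J -> K)
    s C :
  (forall (A : {fset I}) (B : {fset J}),
     \sum_(i <- A) \sum_(j <- B) nm (F i j) <= C) ->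
  (forall i, has_sum (F i) (g i)) -> (forall j, has_sum (F^~ j) (d j)) ->
  has_sum g s -> has_sum d s.
Proof.
move=> FC hg hd hs.
pose D (A : {fset I}) (B : {fset J}) := \sum_(i <- A) \sum_(j <- B) nm (F i j).
pose E (A : {fset I}) (B : {fset J}) := \sum_(i <- A) \sum_(j <- B) F i j.
have DE A0 A B0 B : (A0 `<=` A)%fset -> (B0 `<=` B)%fset ->
    nm (E A B - E A0 B0) <= D A B - D A0 B0.
  move=> hA hB.
  have split (V : zmodType) (G : I -> J -> V) :
      \sum_(i <- A) \sum_(j <- B) G i j - \sum_(i <- A0) \sum_(j <- B0) G i j =
      \sum_(i <- (A `\` A0)%fset) \sum_(j <- B) G i j +
      \sum_(i <- A0) \sum_(j <- (B `\` B0)%fset) G i j.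
    rewrite (big_fset_sub _ hA).
    under [X in X + _ - _]eq_bigr do rewrite (big_fset_sub _ hB).
    by rewrite big_split /= -!addrA addrC -!addrA addrC -!addrA addKr addrC.
  rewrite /E /D !split; apply: le_trans (nmD _ _) _.
  by apply: lerD; apply: le_trans (nm_sum _ _ _) _; apply: ler_sum => i _;
     apply: nm_sum.
pose S := [set D AB.1 AB.2 | AB in [set: {fset I} * {fset J}]].
have hS : has_sup S.
  split; first by exists (D fset0 fset0), (fset0, fset0).
  by exists C => _ [[A B] _ <-]; exact: FC.
have close e : 0 < e -> exists A0 B0, forall A B, (A0 `<=` A)%fset ->
    (B0 `<=` B)%fset -> nm (E A B - E A0 B0) <= e.
  move=> e0; have [_ [[A0 B0] _ <-] /= h] := sup_adherent e0 hS.
  exists A0, B0 => A B hA hB; apply: le_trans (DE _ _ _ _ hA hB) _.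
  have : D A B <= sup S by apply: ub_le_sup; [exact: hS.2|exists (A, B)].
  by move: h; lra.
move=> e e0; have e4 : 0 < e / 4 by rewrite divr_gt0.
have [A0 [B0 h0]] := close _ e4.
have hrow A : (A0 `<=` A)%fset -> nm (\sum_(i <- A) g i - E A0 B0) <= e / 4.
  move=> hA; apply/ler_addgt0Pr => e' e'0.
  have [B hB] := has_sum_sum (fun j (_ : j \in A) => hg j) e'0.
  have hB1 := hB (B `|` B0)%fset (fsubsetUl _ _).
  have hB2 := h0 A (B `|` B0)%fset hA (fsubsetUr _ _).
  move: hB1; rewrite exchange_big /= -/(E _ _) => hB1.
  have -> : \sum_(i <- A) g i - E A0 B0 =
    (E A (B `|` B0)%fset - E A0 B0) - (E A (B `|` B0)%fset - \sum_(i <- A) g i) by ring.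
  by apply: le_trans (nmB _ _) _; apply: lerD.
have hcol B : (B0 `<=` B)%fset -> nm (\sum_(j <- B) d j - E A0 B0) <= e / 4.
  move=> hB; apply/ler_addgt0Pr => e' e'0.
  have [A hA] := has_sum_sum (fun j (_ : j \in B) => hd j) e'0.
  have hA1 := hA (A `|` A0)%fset (fsubsetUl _ _).
  have hA2 := h0 (A `|` A0)%fset B (fsubsetUr _ _) hB.
  move: hA1; rewrite -/(E _ _) => hA1.
  have -> : \sum_(i <- B) d i - E A0 B0 =
    (E (A `|` A0)%fset B - E A0 B0) - (E (A `|` A0)%fset B - \sum_(i <- B) d i) by ring.
  by apply: le_trans (nmB _ _) _; apply: lerD.
have hsE : nm (s - E A0 B0) <= e / 2.
  have [A hA] := hs _ e4.
  have h1 := hA (A `|` A0)%fset (fsubsetUl _ _).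
  have h2 := hrow (A `|` A0)%fset (fsubsetUr _ _).
  set T := \sum_(i <- _) g i in h1 h2.
  have -> : s - E A0 B0 = (T - E A0 B0) - (T - s) by ring.
  by apply: le_trans (nmB _ _) _; lra.
exists B0 => B hB; have h1 := hcol _ hB.
have -> : \sum_(j <- B) d j - s = (\sum_(j <- B) d j - E A0 B0) - (s - E A0 B0) by ring.
by apply: le_trans (nmB _ _) _; lra.
Qed.

End Summation.

(** * Power series on closed polydiscs *)

Section Analytic.
Variable R : realType.
Local Notation K := R[i].

Definition mzero n : mindex n := [ffun=> 0%N].
Definition incr n (i : 'I_n) (a : mindex n) : mindex n :=
  [ffun j => (a j + (j == i))%N].

Lemma mdegree0 n : mdegree (mzero n) = 0%N.
Proof. by rewrite /mdegree big1 // => i _; rewrite ffunE. Qed.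

Lemma mdegree_incr n (i : 'I_n) a : mdegree (incr i a) = (mdegree a).+1.
Proof.
rewrite /mdegree; under eq_bigr do rewrite ffunE.
rewrite big_split /= (bigD1 i) //= [X in (_ + X)%N](bigD1 i) //= eqxx.
rewrite [X in (_ + (_ + X))%N]big1 ?addn0 ?addn1 // -?(bigD1 i) // => j.
by move=> /negbTE ->.
Qed.

Lemma mdegree_eq0 n (a : mindex n) : mdegree a = 0%N -> a = mzero n.
Proof.
move=> h; apply/ffunP => i; rewrite ffunE; apply/eqP.
by rewrite -leqn0 -h /mdegree (bigD1 i) //= leq_addr.
Qed.

Lemma monomial0 n (t : n.-tuple K) : monomial t (mzero n) = 1.
Proof. by rewrite /monomial big1 // => i _; rewrite ffunE expr0. Qed.

Lemma monomial_incr n (t : n.-tuple K) i a :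
  monomial t (incr i a) = tnth t i * monomial t a.
Proof.
rewrite /monomial; under eq_bigr do rewrite ffunE exprD.
rewrite big_split /= mulrC; congr (_ * _).
rewrite (bigD1 i) //= eqxx expr1 big1 ?mulr1 // => j /negbTE ->.
by rewrite expr0.
Qed.

Lemma incr_inj n (i : 'I_n) : injective (incr i).
Proof.
move=> a b h; apply/ffunP => j.
by have := congr1 (fun c : mindex n => c j) h; rewrite !ffunE => /addIn.
Qed.

Lemma incr_surj n (i : 'I_n) (a : mindex n) : a i != 0%N -> exists b, a = incr i b.
Proof.
move=> ai; exists [ffun j => (a j - (j == i))%N]; apply/ffunP => j.
rewrite !ffunE; case: eqP => [->|_]; last by rewrite subn0 addn0.
by rewrite subnK // lt0n.
Qed.

Lemma mindex_ind n (P : mindex n -> Prop) :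
  P (mzero n) -> (forall i a, P a -> P (incr i a)) -> forall a, P a.
Proof.
move=> P0 PS a; move: {2}(mdegree a) (erefl (mdegree a)) => d.
elim: d a => [|d IH] a h; first by rewrite (mdegree_eq0 h).
have [i ai] : exists i, a i != 0%N.
  apply: contrapT => /forallNP H; move: h; rewrite /mdegree big1 // => i _.
  by apply/eqP/negP => /negP; exact: H.
have [b ab] := incr_surj ai; rewrite ab; apply/PS/IH.
by move: h; rewrite ab mdegree_incr => -[].
Qed.

Definition box n (r : R) (t : n.-tuple K) := forall i, nm (tnth t i) <= r.

Lemma nm_monomial n r (t : n.-tuple K) a :
  box r t -> nm (monomial t a) <= r ^+ mdegree a.
Proof.
move=> tr; elim/mindex_ind: a => [|i a IH].
  by rewrite monomial0 nm1 mdegree0 expr0.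
rewrite monomial_incr nmM mdegree_incr exprS.
by apply: ler_pM => //; apply: nm_ge0.
Qed.

(** On the closed polydisc of radius r, f is the sum of a power series without
    terms of degree below k, whose l1 norm of weight r is at most C. Series with
    a finite weighted norm form a Banach algebra, which is what makes
    composition and fixed points elementary. *)
Definition analytic n (k : nat) (r C : R) (f : n.-tuple K -> K) : Prop :=
  0 < r /\ exists c : mindex n -> K,
  [/\ forall a, (mdegree a < k)%N -> c a = 0,
      forall J : {fset mindex n}, \sum_(a <- J) nm (c a) * r ^+ mdegree a <= C
    & forall t, box r t -> has_sum (fun a => c a * monomial t a) (f t)].

Lemma coef_abs_bounded n (c : mindex n -> K) r C (t : n.-tuple K) :
  (forall J : {fset mindex n}, \sum_(a <- J) nm (c a) * r ^+ mdegree a <= C) ->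
  box r t -> abs_bounded (fun a => c a * monomial t a) C.
Proof.
move=> cC tr J; apply: le_trans (cC J); apply: ler_sum => a _.
by rewrite nmM ler_wpM2l ?nm_ge0 // nm_monomial.
Qed.

Lemma analytic_gt0 n k r C (f : n.-tuple K -> K) : analytic k r C f -> 0 < r.
Proof. by case. Qed.

Lemma analytic_ge0 n k r C (f : n.-tuple K -> K) : analytic k r C f -> 0 <= C.
Proof. by case=> _ [c [_ /(_ fset0) + _]]; rewrite big_seq_fset0. Qed.

Lemma analytic_ext n k r C (f g : n.-tuple K -> K) :
  (forall t, box r t -> f t = g t) -> analytic k r C f -> analytic k r C g.
Proof.
by move=> fg [r0 [c [c1 c2 c3]]]; split => //; exists c; split => // t tr;
   rewrite -fg //; apply: c3.
Qed.

Lemma analytic_le n k r C C' (f : n.-tuple K -> K) :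
  C <= C' -> analytic k r C f -> analytic k r C' f.
Proof.
by move=> CC [r0 [c [c1 c2 c3]]]; split => //; exists c; split => // J;
   apply: le_trans CC.
Qed.

Lemma analytic_lek n k k' r C (f : n.-tuple K -> K) :
  (k' <= k)%N -> analytic k r C f -> analytic k' r C f.
Proof.
move=> kk [r0 [c [c1 c2 c3]]]; split => //; exists c; split => // a ak.
by apply: c1; apply: leq_trans kk.
Qed.

Lemma analytic_shrink n k r r' C (f : n.-tuple K -> K) :
  0 < r' -> r' <= r -> analytic k r C f -> analytic k r' (C * (r' / r) ^+ k) f.
Proof.
move=> r'0 rr [r0 [c [c1 c2 c3]]]; split => //; exists c; split => // [J|t tr'].
  apply: le_trans (ler_wpM2r _ (c2 J)); last by rewrite exprn_ge0 ?divr_ge0 ?ltW.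
  rewrite mulr_suml; apply: ler_sum => a _.
  have [/c1 ->|ka] := ltnP (mdegree a) k; first by rewrite nm0 !mul0r.
  rewrite -mulrA; apply: ler_wpM2l; first exact: nm_ge0.
  have -> : r' ^+ mdegree a = r ^+ mdegree a * (r' / r) ^+ mdegree a.
    by rewrite -exprMn mulrC divfK ?gt_eqF.
  rewrite ler_wpM2l ?exprn_ge0 ?(ltW r0) // ler_wiXn2l //.
    by rewrite divr_ge0 ?ltW.
  by rewrite ler_pdivrMr // mul1r.
by apply: c3 => i; apply: le_trans (tr' i) rr.
Qed.

Lemma analytic_ler n k r r' C (f : n.-tuple K -> K) :
  0 < r' -> r' <= r -> analytic k r C f -> analytic k r' C f.
Proof.
move=> r'0 rr h; have C0 := analytic_ge0 h; have r0 := analytic_gt0 h.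
apply: analytic_le (analytic_shrink r'0 rr h).
have h1 : r' / r <= 1 by rewrite ler_pdivrMr // mul1r.
by rewrite ler_piMr // exprn_ile1 // divr_ge0 // ltW.
Qed.

Lemma analytic_bound n k r C (f : n.-tuple K -> K) t :
  analytic k r C f -> box r t -> nm (f t) <= C.
Proof.
case=> r0 [c [c1 c2 c3]] tr; apply: has_sum_bound (c3 _ tr).
exact: coef_abs_bounded.
Qed.

(** Turns a sum of moduli into a linear expression, which can be exchanged with
    an infinite sum. *)
Lemma phase (x : K) : exists2 y, y * x = (nm x)%:C & nm y <= 1.
Proof.
have [->|x0] := eqVneq x 0.
  by exists 0; rewrite ?nm0 ?mulr0 ?ler01.
exists (`|x| / x); first by rewrite divfK // nmE.
rewrite nmM nmV nmE nm_real ger0_norm ?nm_ge0 // divff ?nm_eq0 //.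
Qed.

(** The coefficients are summed index by index, and Fubini identifies the sum of
    the resulting series. Products and substitutions are instances. *)
Lemma analytic_sum n k r C (I : choiceType) (Ci : I -> R)
    (F : I -> n.-tuple K -> K) (g : n.-tuple K -> K) :
  0 < r -> (forall i, analytic k r (Ci i) (F i)) ->
  (forall A : {fset I}, \sum_(i <- A) Ci i <= C) ->
  (forall t, box r t -> has_sum (F^~ t) (g t)) ->
  analytic k r C g.
Proof.
move=> r0 hF hC hg.
have [c hc] := choice (fun i => (hF i).2).
have cb i a : nm (c i a) * r ^+ mdegree a <= Ci i.
  have [_ /(_ [fset a]%fset) + _] := hc i.
  by rewrite big_seq_fset1.
have dE a : exists s, has_sum (c^~ a) s.
  apply: (has_sum_exists (C := C / r ^+ mdegree a)) => A.
  rewrite ler_pdivlMr ?exprn_gt0 // mulr_suml; apply: le_trans (hC A).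
  exact: ler_sum.
have [d hd] := choice dE.
have double (A : {fset I}) (B : {fset mindex n}) :
    \sum_(i <- A) \sum_(a <- B) nm (c i a) * r ^+ mdegree a <= C.
  by apply: le_trans (hC A); apply: ler_sum => i _; have [_ + _] := hc i; apply.
split=> //; exists d; split.
- move=> a ak; apply: has_sum_unique (hd a) _.
  rewrite (_ : c^~ a = fun=> 0); last first.
    by apply/funext => i; have [-> //] := hc i.
  have := @has_sum_fin R I (fun=> 0) fset0 (fun _ _ => erefl).
  by rewrite big_seq_fset0.
- move=> B; have [y hy] := choice (fun a => let: ex_intro2 y p q := phase (d a) in
    ex_intro (fun y => y * d a = (nm (d a))%:C /\ nm y <= 1) y (conj p q)).
  have H : has_sum (fun i => \sum_(a <- B) (y a * (r ^+ mdegree a)%:C) * c i a)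
      (\sum_(a <- B) (y a * (r ^+ mdegree a)%:C) * d a).
    by apply: has_sum_sum => a _; apply: has_sumZ.
  have E : \sum_(a <- B) (y a * (r ^+ mdegree a)%:C) * d a =
      (\sum_(a <- B) nm (d a) * r ^+ mdegree a)%:C.
    rewrite rmorph_sum; apply: eq_bigr => a _.
    by rewrite mulrAC (hy a).1 -rmorphM.
  rewrite E in H; apply: le_trans (ler_norm _) _; rewrite -nm_real.
  apply: has_sum_bound H => A; apply: le_trans (double A B).
  apply: ler_sum => i _; apply: le_trans (nm_sum _ _ _) _; apply: ler_sum => a _.
  rewrite !nmM nm_real ger0_norm ?exprn_ge0 ?(ltW r0) // mulrC.
  rewrite ler_wpM2l ?nm_ge0 // ler_piMl ?exprn_ge0 ?(ltW r0) //.
  by have [] := hy a.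
- move=> t tr.
  apply: (@has_sum_swap R I _ (fun i a => c i a * monomial t a) (F^~ t) _ _ C).
  + move=> A B; apply: le_trans (double A B).
    apply: ler_sum => i _; apply: ler_sum => a _.
    by rewrite nmM ler_wpM2l ?nm_ge0 // nm_monomial.
  + by move=> i; have [_ _] := hc i; apply.
  + move=> a; rewrite mulrC.
    under eq_fun do rewrite mulrC.
    exact: has_sumZ.
  + exact: hg.
Qed.

Lemma analyticZ n k r C (f : n.-tuple K -> K) x :
  analytic k r C f -> analytic k r (nm x * C) (fun t => x * f t).
Proof.
case=> r0 [c [c1 c2 c3]]; split => //; exists (fun a => x * c a).
split=> [a /c1 ->|J|t tr]; first by rewrite mulr0.
  under eq_bigr do rewrite nmM -mulrA.
  by rewrite -mulr_sumr ler_wpM2l ?nm_ge0.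
by under eq_fun do rewrite -mulrA; apply: has_sumZ; apply: c3.
Qed.

Lemma analyticD n k r C C' (f g : n.-tuple K -> K) :
  analytic k r C f -> analytic k r C' g -> analytic k r (C + C') (fun t => f t + g t).
Proof.
case=> r0 [c [c1 c2 c3]] [_ [d [d1 d2 d3]]]; split => //.
exists (fun a => c a + d a).
split=> [a ak|J|t tr]; first by rewrite c1 ?d1 // addr0.
  apply: le_trans (lerD (c2 J) (d2 J)); rewrite -big_split /=.
  apply: ler_sum => a _; rewrite -mulrDl ler_wpM2r ?nmD //.
  by rewrite exprn_ge0 ?ltW.
by under eq_fun do rewrite mulrDl; apply: has_sumD; [apply: c3|apply: d3].
Qed.

Lemma analytic_cst n r (x : K) : 0 < r -> analytic 0 r (nm x) (fun _ : n.-tuple K => x).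
Proof.
move=> r0; split => //; exists (fun a => if a == mzero n then x else 0).
have out (a : mindex n) : a \notin [fset mzero n]%fset -> (a == mzero n) = false.
  by rewrite inE => /negbTE.
split=> // [J|t tr].
  have rest (A : {fset mindex n}) : mzero n \notin A ->
      \sum_(a <- A) nm (if a == mzero n then x else 0) * r ^+ mdegree a = 0.
    move=> h; rewrite big_seq big1 // => a aA.
    by rewrite (_ : (a == _) = false) ?nm0 ?mul0r //; apply: contraNF h => /eqP <-.
  have [zJ|zJ] := boolP (mzero n \in J); last by rewrite rest // nm_ge0.
  rewrite (big_fsetD1 (mzero n)) //= eqxx rest ?mdegree0 ?expr0 ?mulr1 ?addr0 //.
  by rewrite !inE eqxx.
have := @has_sum_fin R _ (fun a => (if a == mzero n then x else 0) * monomial t a) [fset mzero n]%fset.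
rewrite big_seq_fset1 eqxx monomial0 mulr1; apply=> a /out ->.
by rewrite mul0r.
Qed.

Lemma analytic0 n k r : 0 < r -> analytic k r 0 (fun _ : n.-tuple K => 0).
Proof.
move=> r0; split => //; exists (fun=> 0); split => // [J|t tr].
  by rewrite big1 // => a _; rewrite nm0 mul0r.
have := @has_sum_fin R (mindex n) (fun a => 0 * monomial t a) fset0.
by rewrite big_seq_fset0; apply=> a _; rewrite mul0r.
Qed.

Lemma analytic_mulX n k r C (f : n.-tuple K -> K) i :
  analytic k r C f -> analytic k.+1 r (r * C) (fun t => tnth t i * f t).
Proof.
case=> r0 [c [c1 c2 c3]]; split => //.
have [d hd] : exists d, forall a, d (incr i a) = c a /\ (forall b : mindex n, b i = 0%N -> d b = 0).
  pose D (a : mindex n) : mindex n := [ffun j => (a j - (j == i))%N].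
  exists (fun a : mindex n => if a i == 0%N then 0 else c (D a)) => a.
  split; last by move=> b ->.
  rewrite ffunE eqxx addn1 /=; congr c; apply/ffunP => j.
  by rewrite !ffunE addnK.
have d0 a : d a != 0 -> exists b, a = incr i b.
  move=> da; apply: incr_surj; apply: contraNneq da => ai.
  by apply/eqP; apply: (hd (mzero n)).2.
exists d; split=> [a ak|J|t tr].
- apply/eqP/negP => /negP da; have [b ab] := d0 _ da.
  by move: da; rewrite ab (hd b).1 c1 ?eqxx // -ltnS -(mdegree_incr i) -ab.
- have [|A [_ <-]] := @sum_preimage _ _ _ _ (fun a => nm (d a) * r ^+ mdegree a) J (@incr_inj n i).
    by move=> a h; apply: d0; apply: contraNneq h => ->; rewrite nm0 mul0r.
  under eq_bigr do rewrite mdegree_incr exprS (hd _).1 mulrCA.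
  by rewrite -mulr_sumr ler_wpM2l // ltW.
- apply: (has_sum_inj (@incr_inj n i)).
    by move=> a h; apply: d0; apply: contraNneq h => ->; rewrite mul0r.
  rewrite (_ : _ \o _ = fun a => tnth t i * (c a * monomial t a)).
    by apply: has_sumZ; apply: c3.
  by apply/funext => a /=; rewrite (hd a).1 monomial_incr mulrCA.
Qed.

Lemma analytic_X n r (i : 'I_n) : 0 < r -> analytic 1 r r (fun t => tnth t i).
Proof.
move=> r0; have := analytic_mulX i (@analytic_cst n r 1 r0).
by rewrite nm1 mulr1; apply: analytic_ext => t _; rewrite mulr1.
Qed.

(** The product is the sum over a of the series c a * t^a * g t, and
    multiplication by a monomial only shifts coefficients. *)
Lemma analyticM n k k' r C C' (f g : n.-tuple K -> K) :
  analytic k r C f -> analytic k' r C' g ->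
  analytic (k + k') r (C * C') (fun t => f t * g t).
Proof.
move=> [r0 [c [c1 c2 c3]]] hg.
have C0 := analytic_ge0 hg.
have mono a : analytic (mdegree a + k') r (r ^+ mdegree a * C')
    (fun t => monomial t a * g t).
  elim/mindex_ind: a => [|i a IH].
    rewrite mdegree0 expr0 mul1r; apply: analytic_ext hg => t _.
    by rewrite monomial0 mul1r.
  rewrite mdegree_incr exprS -mulrA addSn.
  apply: analytic_ext (analytic_mulX i IH) => t _.
  by rewrite monomial_incr mulrA.
apply: (@analytic_sum n _ r _ _ (fun a => nm (c a) * (r ^+ mdegree a * C'))
   (fun a t => c a * (monomial t a * g t))) => //.
- move=> a; have [ak|ka] := ltnP (mdegree a) k.
    rewrite c1 // nm0 mul0r; apply: analytic_ext (analytic0 _ _ r0) => t _.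
    by rewrite mul0r.
  by apply: analyticZ; apply: analytic_lek (mono a); rewrite leq_add2r.
- move=> A; under eq_bigr do rewrite mulrA.
  by rewrite -mulr_suml ler_wpM2r.
- move=> t tr; rewrite mulrC; under eq_fun do rewrite mulrA mulrC.
  by apply: has_sumZ; apply: c3.
Qed.

Lemma analytic_monomial n m (x : 'I_n -> m.-tuple K -> K) j r M a :
  0 < r -> (forall i, analytic j r M (x i)) ->
  analytic (mdegree a * j) r (M ^+ mdegree a)
    (fun t => monomial (mktuple (x^~ t)) a).
Proof.
move=> r0 hx; elim/mindex_ind: a => [|i a IH].
  rewrite mdegree0 expr0 mul0n -(nm1 R).
  by apply: analytic_ext (analytic_cst _ _ r0) => t _; rewrite monomial0.
rewrite mdegree_incr exprS mulSn.
apply: analytic_ext (analyticM (hx i) IH) => t _.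
by rewrite monomial_incr tnth_mktuple.
Qed.

(** The composite is the sum over a of c a * x^a, with x^a of norm at most
    M^|a|. *)
Lemma analytic_comp n m (f : n.-tuple K -> K) (x : 'I_n -> m.-tuple K -> K)
    k j r R0 M C :
  0 < r -> M <= R0 -> analytic k R0 C f -> (forall i, analytic j r M (x i)) ->
  analytic (k * j) r C (fun t => f (mktuple (x^~ t))).
Proof.
move=> r0 MR [R00 [c [c1 c2 c3]]] hx.
have M0 : (0 < n)%N -> 0 <= M.
  by case: n {f c c1 c2 c3} x hx => // n x hx _; apply: analytic_ge0 (hx ord0).
have MX (a : mindex n) : M ^+ mdegree a <= R0 ^+ mdegree a.
  have [n0|n0] := posnP n; last by rewrite lerXn2r // nnegrE ?M0 ?ltW.
  have -> : mdegree a = 0%N.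
    by rewrite /mdegree big1 // => i; have := ltn_ord i; rewrite [X in (_ < X)%N]n0.
  by rewrite !expr0.
apply: (@analytic_sum m _ r _ _ (fun a => nm (c a) * M ^+ mdegree a)
   (fun a t => c a * monomial (mktuple (x^~ t)) a)) => //.
- move=> a; have [ak|ka] := ltnP (mdegree a) k.
    rewrite c1 // nm0 mul0r; apply: analytic_ext (analytic0 _ _ r0) => t _.
    by rewrite mul0r.
  apply: analyticZ; apply: analytic_lek (analytic_monomial a r0 hx).
  by rewrite leq_mul2r ka orbT.
- move=> A; apply: le_trans (c2 A); apply: ler_sum => a _.
  by rewrite ler_wpM2l ?nm_ge0.
- move=> t tr; apply: c3 => i; rewrite tnth_mktuple.
  by apply: le_trans MR; apply: analytic_bound (hx i) tr.
Qed.

End Analytic.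

Section AnalyticCalculus.
Variable R : realType.
Local Notation K := R[i].

(** By the identity xX - yY = x (X - Y) + (x - y) Y, one factor at a time. *)
Lemma analytic_monomial_lip n m (x y : 'I_n -> m.-tuple K -> K) r M d a :
  0 < r -> 0 <= M -> 0 <= d ->
  (forall i, analytic 0 r M (x i)) -> (forall i, analytic 0 r M (y i)) ->
  (forall i, analytic 0 r d (fun t => x i t - y i t)) ->
  analytic 0 r ((mdegree a)%:R * M ^+ (mdegree a).-1 * d)
    (fun t => monomial (mktuple (x^~ t)) a - monomial (mktuple (y^~ t)) a).
Proof.
move=> r0 M0 d0 hx hy hd; elim/mindex_ind: a => [|i a IH].
  rewrite mdegree0 mul0r mul0r; apply: analytic_ext (analytic0 _ _ r0) => t _.
  by rewrite !monomial0 subrr.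
rewrite mdegree_incr /=.
have my : analytic 0 r (M ^+ mdegree a) (fun t => monomial (mktuple (y^~ t)) a).
  by rewrite -(muln0 (mdegree a)); apply: analytic_monomial.
apply: analytic_le; last first.
  apply: analytic_ext (analyticD (analyticM (hx i) IH) (analyticM (hd i) my)) => t _.
  by rewrite !monomial_incr !tnth_mktuple; ring.
rewrite -natr1 mulrDl mul1r mulrDl [d * _]mulrC lerD2r.
case: (mdegree a) => [|k] /=; first by rewrite !mul0r mulr0.
by rewrite exprS !mulrA [M * _]mulrC.
Qed.

(** Lipschitz estimate for substitution, in weighted norm: order k at the
    origin gains the factor M to the k - 1. *)
Lemma analytic_lip n m (f : n.-tuple K -> K) (x y : 'I_n -> m.-tuple K -> K)
    k R0 C r M d :
  0 < r -> 0 <= M -> 0 <= d -> (0 < k)%N -> M <= R0 / 2 -> analytic k R0 C f ->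
  (forall i, analytic 0 r M (x i)) -> (forall i, analytic 0 r M (y i)) ->
  (forall i, analytic 0 r d (fun t => x i t - y i t)) ->
  analytic 0 r (C * ((2 / R0) ^+ k * M ^+ k.-1 * d))
    (fun t => f (mktuple (x^~ t)) - f (mktuple (y^~ t))).
Proof.
move=> r0 M0 d0 k0 MR [R00 [c [c1 c2 c3]]] hx hy hd.
pose E := (2 / R0) ^+ k * M ^+ k.-1 * d.
have E0 : 0 <= E by rewrite !mulr_ge0 ?exprn_ge0 ?divr_ge0 ?(ltW R00).
have in_box z (t : m.-tuple K) : (forall i, analytic 0 r M (z i)) -> box r t ->
    box R0 (mktuple (z^~ t) : n.-tuple K).
  move=> hz tr i; rewrite tnth_mktuple; apply: (@le_trans _ _ M).
    exact: analytic_bound (hz i) tr.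
  by apply: le_trans MR _; move: R00; lra.
apply: (@analytic_sum _ m _ r _ _ (fun a => nm (c a) * R0 ^+ mdegree a * E)
   (fun a t => c a * (monomial (mktuple (x^~ t)) a - monomial (mktuple (y^~ t)) a))) => //.
- move=> a; have [ak|ka] := ltnP (mdegree a) k.
    rewrite c1 // nm0 !mul0r; apply: analytic_ext (analytic0 _ _ r0) => t _.
    by rewrite mul0r.
  rewrite -mulrA; apply: analyticZ.
  apply: analytic_le (analytic_monomial_lip a r0 M0 d0 hx hy hd).
  rewrite /E !mulrA; apply: ler_wpM2r => //.
  set j := mdegree a in ka *.
  have -> : M ^+ j.-1 = M ^+ (j - k) * M ^+ k.-1.
    rewrite -exprD; congr (_ ^+ _).
    by case: k k0 ka {c1 E E0} => // k _; case: j => // j kj; rewrite /= subSS subnK.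
  rewrite mulrA; apply: ler_wpM2r; first by rewrite exprn_ge0.
  (* The factor j is at most 2 ^ j, which halving the radius compensates. *)
  have hM : M ^+ (j - k) <= (R0 / 2) ^+ (j - k).
    by rewrite lerXn2r // nnegrE // divr_ge0 // ltW.
  apply: (@le_trans _ _ ((2 ^ j)%N%:R * (R0 / 2) ^+ (j - k))).
    apply: ler_pM => //; first by rewrite exprn_ge0.
    by rewrite ler_nat ltnW // ltn_expl.
  have -> : R0 ^+ j * (2 / R0) ^+ k = (2 ^ j)%N%:R * (R0 / 2) ^+ (j - k).
    rewrite natrX -[in LHS](subnK ka) -[in X in _ = X * _](subnK ka) !exprD !exprMn.
    rewrite !exprVn; field.
    by rewrite !expf_neq0 // gt_eqF.
  by [].
- by move=> A; rewrite -mulr_suml ler_wpM2r.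
- move=> t tr.
  have := has_sumD (c3 _ (in_box _ _ hx tr)) (has_sumZ (- 1) (c3 _ (in_box _ _ hy tr))).
  rewrite mulN1r; congr has_sum; apply/funext => a; ring.
Qed.

Lemma analytic_conj n k r C (f : n.-tuple K -> K) :
  analytic k r C f ->
  analytic k r C (fun t => (f (map_tuple (@conjc R) t))^*%C).
Proof.
case=> r0 [c [c1 c2 c3]]; split => //; exists (fun a => (c a)^*%C).
split=> [a /c1 ->|J|t tr]; first by rewrite conjc0.
  by under eq_bigr do rewrite nm_conj.
have : box r (map_tuple (@conjc R) t).
  by move=> i; rewrite tnth_map nm_conj.
move/c3/has_sum_conj; congr has_sum; apply/funext => a.
rewrite rmorphM /=; congr (_ * _); rewrite /monomial rmorph_prod.
by apply: eq_bigr => i _; rewrite tnth_map rmorphXn /= conjcK.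
Qed.

Definition zero_at n (i : 'I_n) (t : n.-tuple K) : n.-tuple K :=
  [tuple if j == i then 0 else tnth t j | j < n].

Lemma box_zero_at n (i : 'I_n) r t : 0 <= r -> box r t -> box r (zero_at i t).
Proof.
by move=> r0 tr j; rewrite tnth_mktuple; case: ifP => // _; rewrite nm0.
Qed.

Lemma monomial_zero_at n (i : 'I_n) (t : n.-tuple K) (a : mindex n) :
  monomial (zero_at i t) a = if a i == 0%N then monomial t a else 0.
Proof.
case: eqP => [ai|/eqP ai]; last first.
  rewrite /monomial (bigD1 i) //= tnth_mktuple eqxx expr0n (negbTE ai) mul0r //.
rewrite /monomial; apply: eq_bigr => j _; rewrite tnth_mktuple.
by case: eqP => // ->; rewrite ai !expr0.
Qed.

(** Division with remainder by the variable of index i: the quotient collects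
    the terms that contain this variable.  It converges on the same polydisc. *)
Lemma analytic_split n k r C (f : n.-tuple K -> K) i :
  analytic k r C f ->
  exists g, [/\ analytic k.-1 r (C / r) g,
    analytic k r C (fun t => f (zero_at i t)) &
    forall t, box r t -> f t = f (zero_at i t) + tnth t i * g t].
Proof.
case=> r0 [c [c1 c2 c3]].
have cC (J : {fset mindex n}) : \sum_(a <- J) nm (c (incr i a)) * r ^+ mdegree a <= C / r.
  rewrite ler_pdivlMr // mulr_suml; apply: le_trans (c2 (incr i @` J)%fset).
  rewrite big_imfset /=; last by move=> ? ? _ _; apply: incr_inj.
  by apply: ler_sum => a _; rewrite mdegree_incr exprSr mulrA.
have gE t : exists s, box r t -> has_sum (fun a => c (incr i a) * monomial t a) s.
  have [tr|] := pselect (box r t); last by exists 0.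
  by have [s hs] := has_sum_exists (coef_abs_bounded cC tr); exists s.
have [g hg] := choice gE.
have c0 t : box r t ->
    has_sum (fun a : mindex n => (if a i == 0%N then c a else 0) * monomial t a)
      (f (zero_at i t)).
  move=> tr; have := c3 _ (box_zero_at i (ltW r0) tr).
  congr has_sum; apply/funext => a; rewrite monomial_zero_at.
  by case: ifP => _; rewrite ?mulr0 ?mul0r.
exists g; split.
- split=> //; exists (fun a => c (incr i a)); split=> // a ak.
  by rewrite c1 // mdegree_incr; case: k ak {c1}.
- split=> //; exists (fun a : mindex n => if a i == 0%N then c a else 0).
  split=> // [a /c1 ->|J]; first by case: ifP.
  apply: le_trans (c2 J); apply: ler_sum => a _; case: ifP => // _.
  by rewrite nm0 mul0r mulr_ge0 ?nm_ge0 // exprn_ge0 ?ltW.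
- move=> t tr; apply: has_sum_unique (c3 _ tr) _.
  have h1 : has_sum (fun a : mindex n => (if a i == 0%N then 0 else c a) * monomial t a)
     (tnth t i * g t).
    apply: (has_sum_inj (@incr_inj n i)).
      move=> a h; apply: incr_surj; apply: contraNneq h => ->.
      by rewrite eqxx mul0r.
    have := has_sumZ (tnth t i) (hg _ tr); congr has_sum; apply/funext => a /=.
    by rewrite ffunE eqxx addn1 /= monomial_incr mulrCA.
  have := has_sumD (c0 _ tr) h1; congr has_sum; apply/funext => a.
  by case: ifP => _; rewrite mul0r ?add0r ?addr0.
Qed.

Definition tzero n : n.-tuple K := [tuple 0 | i < n].

Lemma box_tzero n r : 0 <= r -> box r (tzero n).
Proof. by move=> r0 i; rewrite tnth_mktuple nm0. Qed.

(** Only the constant coefficient obstructs vanishing at the origin. *)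
Lemma analytic_order1 n r C (f : n.-tuple K -> K) :
  analytic 0 r C f -> f (tzero n) = 0 -> analytic 1 r C f.
Proof.
case=> r0 [c [c1 c2 c3]] f0; split => //; exists c; split => // a.
rewrite ltnS leqn0 => /eqP /mdegree_eq0 ->.
have h := c3 _ (box_tzero (ltW r0)); rewrite f0 in h.
apply: has_sum_unique h.
have := @has_sum_fin R _ (fun a => c a * monomial (tzero n) a) [fset mzero n]%fset.
rewrite big_seq_fset1 monomial0 mulr1; apply.
elim/mindex_ind => [|i b _ _]; first by rewrite !inE eqxx.
by rewrite monomial_incr tnth_mktuple mul0r mulr0.
Qed.

End AnalyticCalculus.

(** * Germs at the origin *)

Section Germs.
Variable R : realType.
Local Notation K := R[i].

Definition germ n k (f : n.-tuple K -> K) : Prop := exists r C, analytic k r C f.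

Lemma common_radius n (P : 'I_n -> R -> Prop) :
  (forall i, exists2 r, 0 < r & forall r', 0 < r' -> r' <= r -> P i r') ->
  exists2 r, 0 < r & forall r', 0 < r' -> r' <= r -> forall i, P i r'.
Proof.
move=> h; have [rr hr] := choice (fun i => let: ex_intro2 r p q := h i in
   ex_intro (fun r => 0 < r /\ (forall r', 0 < r' -> r' <= r -> P i r')) r (conj p q)).
(* S^-1 is below every rr i, and positive even for n = 0. *)
pose S := 1 + \sum_i (rr i)^-1.
have Si i : (rr i)^-1 <= S.
  rewrite /S (bigD1 i) //= addrCA lerDl addr_ge0 // sumr_ge0 // => j _.
  by rewrite invr_ge0 ltW // (hr j).1.
have S0 : 0 < S.
  by rewrite ltr_wpDr // sumr_ge0 // => j _; rewrite invr_ge0 ltW // (hr j).1.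
exists S^-1; first by rewrite invr_gt0.
move=> r' r'0 r'S i; apply: (hr i).2 => //; apply: le_trans r'S _.
by rewrite -[leRHS]invrK lef_pV2 // ?posrE ?invr_gt0 ?(hr i).1.
Qed.

Lemma germ_ext n k (f g : n.-tuple K -> K) r :
  0 < r -> (forall t, box r t -> f t = g t) -> germ k f -> germ k g.
Proof.
move=> r0 fg [r' [C h]]; have r'0 := analytic_gt0 h.
exists (Num.min r r'), C; apply: analytic_ext (analytic_ler _ _ h).
- by move=> t tr; apply: fg => i; apply: le_trans (tr i) _; rewrite ge_min lexx.
- by rewrite lt_min r0.
- by rewrite ge_min lexx orbT.
Qed.

Lemma germ_eq n k (f g : n.-tuple K -> K) : f =1 g -> germ k f -> germ k g.
Proof. by move=> fg; apply: (germ_ext ltr01) => t _; apply: fg. Qed.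

Lemma germ_lek n k k' (f : n.-tuple K -> K) : (k' <= k)%N -> germ k f -> germ k' f.
Proof. by move=> kk [r [C h]]; exists r, C; apply: analytic_lek h. Qed.

Lemma germ2_common n k k' (f g : n.-tuple K -> K) : germ k f -> germ k' g ->
  exists r C C', analytic k r C f /\ analytic k' r C' g.
Proof.
move=> [r [C h]] [r' [C' h']]; have r0 := analytic_gt0 h; have r'0 := analytic_gt0 h'.
exists (Num.min r r'), C, C'; split; [apply: analytic_ler h|apply: analytic_ler h'];
  by rewrite ?lt_min ?r0 // ge_min lexx ?orbT.
Qed.

Lemma germD n k (f g : n.-tuple K -> K) :
  germ k f -> germ k g -> germ k (fun t => f t + g t).
Proof.
move=> /germ2_common h /h[r [C [C' [p q]]]].
by exists r, (C + C'); apply: analyticD.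
Qed.

Lemma germZ n k (f : n.-tuple K -> K) x : germ k f -> germ k (fun t => x * f t).
Proof. by move=> [r [C h]]; exists r, (nm x * C); apply: analyticZ. Qed.

Lemma germN n k (f : n.-tuple K -> K) : germ k f -> germ k (fun t => - f t).
Proof. by move/(germZ (- 1)); apply: germ_eq => t; rewrite mulN1r. Qed.

Lemma germB n k (f g : n.-tuple K -> K) :
  germ k f -> germ k g -> germ k (fun t => f t - g t).
Proof. by move=> hf hg; apply: germD => //; apply: germN. Qed.

Lemma germM n k k' (f g : n.-tuple K -> K) :
  germ k f -> germ k' g -> germ (k + k') (fun t => f t * g t).
Proof.
move=> /germ2_common h /h[r [C [C' [p q]]]].
by exists r, (C * C'); apply: analyticM.
Qed.

Lemma germ_cst n x : germ 0 (fun _ : n.-tuple K => x).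
Proof. by exists 1, (nm x); apply: analytic_cst. Qed.

Lemma germ0 n k : germ k (fun _ : n.-tuple K => 0).
Proof. by exists 1, 0; apply: analytic0. Qed.

Lemma germ_X n (i : 'I_n) : germ 1 (fun t : n.-tuple K => tnth t i).
Proof. by exists 1, 1; apply: analytic_X. Qed.

Lemma germ_sum n k (I : Type) (s : seq I) (F : I -> n.-tuple K -> K) :
  (forall i, germ k (F i)) -> germ k (fun t => \sum_(i <- s) F i t).
Proof.
move=> h; elim: s => [|i s IH].
  by apply: germ_eq (germ0 n k) => t; rewrite big_nil.
by apply: germ_eq (germD (h i) IH) => t; rewrite big_cons.
Qed.

Lemma germ_conj n k (f : n.-tuple K -> K) :
  germ k f -> germ k (fun t => (f (map_tuple (@conjc R) t))^*%C).
Proof. by move=> [r [C h]]; exists r, C; apply: analytic_conj. Qed.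

(** Shrinking the radius by a factor shrinks the norm by the same factor when
    the constant term vanishes. *)
Lemma germ_small n (f : n.-tuple K -> K) e : germ 1 f -> 0 < e ->
  exists2 r, 0 < r & forall r', 0 < r' -> r' <= r -> analytic 1 r' e f.
Proof.
move=> [r [C h]] e0; have r0 := analytic_gt0 h; have C0 := analytic_ge0 h.
have C1 : 0 < C + 1 by rewrite ltr_wpDl.
have q0 : 0 < e / (C + 1) * r by rewrite mulr_gt0 // divr_gt0.
exists (Num.min r (e / (C + 1) * r)); first by rewrite lt_min r0.
move=> r' r'0; rewrite le_min => /andP[r'r r'e].
apply: analytic_le (analytic_shrink r'0 r'r h); rewrite expr1.
apply: (@le_trans _ _ (C * (e / (C + 1)))).
  by rewrite ler_wpM2l // ler_pdivrMr.
by rewrite mulrCA ler_piMr ?(ltW e0) // ler_pdivrMr // mul1r lerDl ler01.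
Qed.

Lemma germ_at0 n (f : n.-tuple K -> K) : germ 1 f -> f (tzero R n) = 0.
Proof.
move=> hf; rewrite -[LHS]subr0; apply/eqP; rewrite subr_eq0; apply/eqP.
apply: nm_small_eq => e e0; rewrite subr0.
have [r r0 /(_ r r0 (lexx r)) h] := germ_small hf e0.
exact: (analytic_bound h (box_tzero (ltW r0))).
Qed.

Lemma germ_order1 n (f : n.-tuple K -> K) :
  germ 0 f -> f (tzero R n) = 0 -> germ 1 f.
Proof. by move=> [r [C h]] f0; exists r, C; apply: analytic_order1. Qed.

Lemma germ_comp n m k (f : n.-tuple K -> K) (x : 'I_n -> m.-tuple K -> K) :
  germ k f -> (forall i, germ 1 (x i)) -> germ k (fun t => f (mktuple (x^~ t))).
Proof.
move=> [r [C h]] hx; have r0 := analytic_gt0 h.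
have [r1 r10 H] := common_radius (fun i => germ_small (hx i) r0).
exists r1, C; rewrite -(muln1 k).
by apply: analytic_comp h (H r1 r10 (lexx _)).
Qed.

(** The values at the origin may be any point of the open disc of convergence, as
    in a re-expansion at that point. *)
Lemma germ_comp_at n m k (f : n.-tuple K -> K) (x : 'I_n -> m.-tuple K -> K) r C :
  analytic k r C f -> (forall i, germ 0 (x i)) ->
  (forall i, nm (x i (tzero R m)) < r) -> germ 0 (fun t => f (mktuple (x^~ t))).
Proof.
move=> h hx xr; have r0 := analytic_gt0 h.
have H i : exists2 r1, 0 < r1 & forall r', 0 < r' -> r' <= r1 -> analytic 0 r' r (x i).
  have e0 : 0 < r - nm (x i (tzero R m)) by rewrite subr_gt0.
  have h1 : germ 1 (fun t => x i t - x i (tzero R m)).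
    by apply: germ_order1; [apply: germB => //; apply: germ_cst|rewrite subrr].
  have [r1 r10 h2] := germ_small h1 e0; exists r1 => // r' r'0 r'r.
  have := analyticD (analytic_lek (leq0n 1) (h2 r' r'0 r'r))
                    (analytic_cst _ (x i (tzero R m)) r'0).
  by rewrite subrK; apply: analytic_ext => t _; rewrite subrK.
have [r1 r10 H1] := common_radius H.
exists r1, C; rewrite -(muln0 k).
by apply: analytic_comp h (H1 r1 r10 (lexx _)).
Qed.

Lemma mktuple_tnth n (T : Type) (t : n.-tuple T) : mktuple (tnth t) = t.
Proof. by apply: eq_from_tnth => i; rewrite tnth_mktuple. Qed.

Lemma analytic_point (x : K) : analytic 0 1 (nm x) (fun _ : 0.-tuple K => x).
Proof. exact: analytic_cst. Qed.

(** A complex number is an analytic function of no variables, so the estimate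
    for substitution contains the pointwise one. *)
Lemma germ_lip n k (f : n.-tuple K -> K) : (0 < k)%N -> germ k f ->
  exists r C, [/\ 0 < r, 0 <= C & forall x y m d, m <= r -> 0 <= m -> 0 <= d ->
    box m x -> box m y -> (forall i, nm (tnth x i - tnth y i) <= d) ->
    nm (f x - f y) <= C * m ^+ k.-1 * d].
Proof.
move=> k0 [r [C h]]; have r0 := analytic_gt0 h; have C0 := analytic_ge0 h.
exists (r / 2), (C * (2 / r) ^+ k); split; first by rewrite divr_gt0.
  by rewrite mulr_ge0 // exprn_ge0 // divr_ge0 // ltW.
move=> x y m d mr m0 d0 hx hy hd.
have cst (u : K) e : nm u <= e -> analytic 0 1 e (fun _ : 0.-tuple K => u).
  by move=> ue; apply: analytic_le ue (analytic_point u).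
have := @analytic_lip R n 0 f (fun i _ => tnth x i) (fun i _ => tnth y i) k r C 1 m d
  ltr01 m0 d0 k0 mr h (fun i => cst _ _ (hx i)) (fun i => cst _ _ (hy i))
  (fun i => cst _ _ (hd i)).
move/analytic_bound => /(_ (tzero R 0) (box_tzero ler01)).
by rewrite !mktuple_tnth !mulrA.
Qed.

Lemma germ_bound n k (f : n.-tuple K -> K) : germ k f ->
  exists r C, [/\ 0 < r, 0 <= C &
    forall t m, 0 < m -> m <= r -> box m t -> nm (f t) <= C * m ^+ k].
Proof.
move=> [r [C h]]; have r0 := analytic_gt0 h; have C0 := analytic_ge0 h.
exists r, (C / r ^+ k); split => //; first by rewrite divr_ge0 // exprn_ge0 // ltW.
move=> t m m0 mr tm; have := analytic_bound (analytic_shrink m0 mr h) tm.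
by rewrite expr_div_n mulrA mulrAC.
Qed.

Definition tcons n (y : K) (t : n.-tuple K) : n.+1.-tuple K := [tuple of y :: t].

Lemma tcons0 n y (t : n.-tuple K) : tnth (tcons y t) ord0 = y.
Proof. exact: tnth0. Qed.

Lemma tconsS n y (t : n.-tuple K) i : tnth (tcons y t) (lift ord0 i) = tnth t i.
Proof. exact: tnthS. Qed.

Lemma tcons_mktuple n m (y : m.-tuple K -> K) (x : 'I_n -> m.-tuple K -> K) t :
  tcons (y t) (mktuple (x^~ t)) =
  mktuple (fun i => (if unlift ord0 i is Some j then x j else y) t).
Proof.
apply: eq_from_tnth => i; rewrite tnth_mktuple.
by case: (unliftP ord0 i) => [j|] ->; rewrite ?tcons0 // tconsS tnth_mktuple.
Qed.

Lemma in_iota_fset N i : (i \in [fset j in iota 0 N]%fset) = (i < N)%N.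
Proof. by rewrite !inE mem_iota. Qed.

Lemma sum_iota_fset (V : zmodType) (F : nat -> V) N :
  \sum_(0 <= i < N) F i = \sum_(i <- [fset j in iota 0 N]%fset) F i.
Proof.
rewrite /index_iota subn0; apply: perm_big; apply: uniq_perm.
- exact: iota_uniq.
- exact: fset_uniq.
- by move=> i; rewrite in_iota_fset mem_iota.
Qed.

Lemma fset_nat_sub (A : {fset nat}) : exists N0, forall N, (N0 <= N)%N ->
  (A `<=` [fset j in iota 0 N])%fset.
Proof.
exists (\sum_(i <- A) i).+1 => N AN; apply/fsubsetP => i iA; rewrite in_iota_fset.
by apply: leq_trans AN; rewrite ltnS (big_fsetD1 i) //= leq_addr.
Qed.

Lemma fset_nat_sum (F : nat -> R) (A : {fset nat}) : (forall i, 0 <= F i) ->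
  exists N, \sum_(i <- A) F i <= \sum_(0 <= i < N) F i.
Proof.
move=> F0; have [N /(_ N (leqnn N)) AN] := fset_nat_sub A; exists N.
by rewrite sum_iota_fset (big_fset_sub _ AN) lerDl sumr_ge0.
Qed.

Lemma has_sum_nat (F : nat -> K) s e : has_sum F s -> 0 < e ->
  exists N0, forall N, (N0 <= N)%N -> nm (\sum_(0 <= i < N) F i - s) <= e.
Proof.
move=> hs e0; have [J hJ] := hs e e0; have [N0 hN] := fset_nat_sub J.
by exists N0 => N /hN; rewrite sum_iota_fset; apply: hJ.
Qed.

Lemma half_geometric N : \sum_(0 <= i < N) 2^-1 * 2^-1 ^+ i = 1 - 2^-1 ^+ N :> R.
Proof.
elim: N => [|N IH]; first by rewrite big_nil expr0 subrr.
by rewrite big_nat_recr //= IH exprS; field.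
Qed.

End Germs.

(** * The implicit function theorem *)

Section ImplicitFunction.
Variable R : realType.
Local Notation K := R[i].

(** Picard iteration for y = H t y, where f = lam * y + linear + E and E has
    order 2.  On a polydisc of radius s the map H is a contraction of ratio 1/2
    in weighted norm, and a radius r much smaller than s keeps the iterates in
    the ball of radius s.  The pointwise contraction gives uniqueness. *)
Lemma implicit_function n (f : n.+1.-tuple K -> K) (lam : K) (l : 'I_n -> K) :
  lam != 0 ->
  germ 2 (fun t => f t - (lam * tnth t ord0 + \sum_i l i * tnth t (lift ord0 i))) ->
  exists Y r s, [/\ 0 < s, analytic 1 r s Y,
    germ 2 (fun t => Y t + lam^-1 * \sum_i l i * tnth t i) &
    forall t y, box r t -> nm y <= s -> (f (tcons y t) = 0 <-> y = Y t)].
Proof.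
move=> lam0; set E := fun t => _ => hE; have [R0 [C aE]] := hE.
have R00 := analytic_gt0 aE; have C0 := analytic_ge0 aE.
pose A := nm lam^-1 * (C * (2 / R0) ^+ 2) + 1.
pose B0 := nm lam^-1 * \sum_i nm (l i).
have A0 : 0 < A.
  have q0 : 0 <= 2 / R0 by rewrite divr_ge0 // ltW.
  by rewrite ltr_wpDl // mulr_ge0 ?nm_ge0 // mulr_ge0 // exprn_ge0.
have B00 : 0 <= B0 by rewrite mulr_ge0 ?nm_ge0 // sumr_ge0 // => i _; apply: nm_ge0.
pose s := Num.min (R0 / 2) ((2 * A)^-1); pose r := s / (2 * B0 + 1).
have s0 : 0 < s by rewrite /s lt_min divr_gt0 //= invr_gt0 mulr_gt0.
have sR : s <= R0 / 2 by rewrite /s ge_min lexx.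
have As : A * s <= 2^-1.
  apply: (@le_trans _ _ (A * (2 * A)^-1)); last by rewrite invfM mulrCA divff ?mulr1 ?gt_eqF.
  by rewrite ler_wpM2l ?(ltW A0) // /s ge_min lexx orbT.
have D0 : 0 < 2 * B0 + 1 by rewrite ltr_wpDl // mulr_ge0.
have r0 : 0 < r by rewrite divr_gt0.
have rs : r <= s by rewrite ler_pdivrMr // ler_peMr ?(ltW s0) // lerDr mulr_ge0.
(* Stated for any number m of variables: m = n serves the iterates, m = 0 the
   values at a point. *)
have contraction m rho (T : 'I_n -> m.-tuple K -> K) y y' d :
    0 < rho -> 0 <= d -> (forall i, analytic 0 rho s (T i)) ->
    analytic 0 rho s y -> analytic 0 rho s y' ->
    analytic 0 rho d (fun t => y t - y' t) ->
    analytic 0 rho (d / 2) (fun t => - lam^-1 * (E (tcons (y t) (mktuple (T^~ t)))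
       - E (tcons (y' t) (mktuple (T^~ t))))).
  move=> rho0 d0 hT hy hy' hd.
  pose x i := if unlift ord0 i is Some j then T j else y.
  pose x' i := if unlift ord0 i is Some j then T j else y'.
  have hx i : analytic 0 rho s (x i) by rewrite /x; case: unlift.
  have hx' i : analytic 0 rho s (x' i) by rewrite /x'; case: unlift.
  have hdx i : analytic 0 rho d (fun t => x i t - x' i t).
    rewrite /x /x'; case: unlift => // j.
    apply: analytic_le d0 _; apply: analytic_ext (analytic0 _ _ rho0) => t _.
    by rewrite subrr.
  have := analyticZ (- lam^-1) (analytic_lip rho0 (ltW s0) d0 (isT : (0 < 2)%N) sR aE hx hx' hdx).
  move/(analytic_ext (g := fun t => - lam^-1 * (E (tcons (y t) (mktuple (T^~ t)))
       - E (tcons (y' t) (mktuple (T^~ t)))))).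
  move=> /(_ (fun t _ => _)) H; apply: analytic_le (H _); last first.
    by move=> t; rewrite !tcons_mktuple.
  rewrite nmN /= expr1 -/(_ ^+ 2) !mulrA [leRHS]mulrC ler_wpM2r //.
  apply: le_trans As; rewrite ler_wpM2r ?(ltW s0) //.
  by rewrite /A expr2 !mulrA lerDl ler01.
pose H (t : n.-tuple K) y := - lam^-1 * (\sum_i l i * tnth t i + E (tcons y t)).
have fH t y : f (tcons y t) = 0 <-> y = H t y.
  have -> : f (tcons y t) = E (tcons y t) + (lam * y + \sum_i l i * tnth t i).
    rewrite /E tcons0; under [X in _ - (_ + X)]eq_bigr do rewrite tconsS.
    by rewrite subrK.
  rewrite /H; set S := \sum_i _; set e := E _; split => [h|h].
    have -> : S + e = - (lam * y) by rewrite -[RHS]add0r -h; ring.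
    by rewrite mulrNN mulKf.
  rewrite {1}h; field; exact: lam0.
have Hlip m rho (T : 'I_n -> m.-tuple K -> K) y y' d :
    0 < rho -> 0 <= d -> (forall i, analytic 0 rho s (T i)) ->
    analytic 0 rho s y -> analytic 0 rho s y' ->
    analytic 0 rho d (fun t => y t - y' t) ->
    analytic 0 rho (d / 2) (fun t => H (mktuple (T^~ t)) (y t) - H (mktuple (T^~ t)) (y' t)).
  move=> p1 p2 p3 p4 p5 p6; apply: analytic_ext (contraction _ _ _ _ _ _ p1 p2 p3 p4 p5 p6).
  by move=> t _; rewrite /H; ring.
have H0 : analytic 0 r (s / 2) (fun t => H t 0).
  have h1 : analytic 0 r (B0 * r) (fun t => lam^-1 * \sum_i l i * tnth t i).
    rewrite /B0 -mulrA; apply: analyticZ; rewrite mulr_suml.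
    elim: (index_enum _) => [|i q IH].
      rewrite big_nil; apply: analytic_ext (analytic0 _ _ r0) => t _.
      by rewrite big_nil.
    rewrite big_cons; apply: analytic_ext (analyticD (analyticZ (l i)
       (analytic_lek (leq0n 1) (analytic_X i r0))) IH) => t _.
    by rewrite big_cons.
  have h2 : analytic 0 r (r / 2) (fun t => lam^-1 * E (tcons 0 t)).
    have rR : r <= R0.
      by apply: le_trans rs _; apply: le_trans sR _; move: R00; lra.
    have hx i : analytic 1 r r (fun t : n.-tuple K => if unlift ord0 i is Some j then tnth t j else 0).
      case: unlift => [j|]; first exact: analytic_X.
      by apply: analytic_le (ltW r0) _; apply: analytic0.
    have := analyticZ lam^-1 (analytic_comp r0 (lexx r) (analytic_shrink r0 rR aE) hx).
    move/(analytic_lek (leq0n _)) => h.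
    apply: analytic_le; last apply: analytic_ext h => t _.
      apply: (@le_trans _ _ (A * r * r)); last first.
        rewrite [leRHS]mulrC ler_wpM2r ?(ltW r0) //; apply: le_trans As.
        by rewrite ler_wpM2l // ltW.
      rewrite -[leRHS]mulrA -expr2.
      have -> : nm lam^-1 * (C * (r / R0) ^+ 2) = nm lam^-1 * (C * (1 / R0) ^+ 2) * r ^+ 2.
        by rewrite !expr_div_n expr1n mul1r; ring.
      rewrite ler_wpM2r ?exprn_ge0 ?(ltW r0) // /A.
      rewrite -[leLHS]addr0; apply: lerD => //.
      rewrite ler_wpM2l ?nm_ge0 // ler_wpM2l // lerXn2r ?nnegrE ?divr_ge0 ?(ltW R00) //.
      by rewrite ler_wpM2r ?invr_ge0 ?(ltW R00) // (ler_nat R 1 2).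
    congr (_ * E _); apply: eq_from_tnth => i; rewrite tnth_mktuple.
    by case: (unliftP ord0 i) => [j|] ->; rewrite ?tcons0 // tconsS.
  have := analyticZ (- 1) (analyticD h1 h2); rewrite nmN nm1 mul1r => h.
  apply: analytic_le; last apply: analytic_ext h => t _; last by rewrite /H; ring.
  by rewrite /r; rewrite le_eqVlt; apply/orP; left; apply/eqP; field; rewrite gt_eqF.
pose Y_ k t := iter k (H t) 0.
have hT (i : 'I_n) : analytic 0 r s (fun t : n.-tuple K => tnth t i).
  by apply: analytic_le rs _; apply: analytic_lek (analytic_X i r0).
have HY k : analytic 0 r (s * (1 - 2^-1 ^+ k)) (Y_ k) /\
            analytic 0 r (s * (2^-1 * 2^-1 ^+ k)) (fun t => Y_ k.+1 t - Y_ k t).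
  have leS j : s * (1 - 2^-1 ^+ j) <= s.
    by rewrite ler_piMr ?(ltW s0) // gerBl exprn_ge0 // invr_ge0.
  elim: k => [|k [IH1 IH2]].
    rewrite expr0 subrr !mulr0 mulr1; split; first exact: analytic0.
    by apply: analytic_ext H0 => t _; rewrite /Y_ /= subr0.
  have h1 : analytic 0 r (s * (1 - 2^-1 ^+ k.+1)) (Y_ k.+1).
    have := analyticD IH1 IH2; rewrite -mulrDr.
    have -> : 1 - 2^-1 ^+ k + 2^-1 * 2^-1 ^+ k = 1 - 2^-1 ^+ k.+1 :> R.
      by rewrite exprS; field.
    by apply: analytic_ext => t _; rewrite addrC subrK.
  split => //.
  have d0 : 0 <= s * (2^-1 * 2^-1 ^+ k).
    by rewrite mulr_ge0 ?(ltW s0) // mulr_ge0 ?invr_ge0 // exprn_ge0 // invr_ge0.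
  have := Hlip _ _ _ _ _ _ r0 d0 hT (analytic_le (leS _) h1) (analytic_le (leS _) IH1) IH2.
  have -> : s * (2^-1 * 2^-1 ^+ k) / 2 = s * (2^-1 * 2^-1 ^+ k.+1) by rewrite exprS; ring.
  by apply: analytic_ext => t _; rewrite mktuple_tnth.
have geom (B : {fset nat}) : \sum_(k <- B) s * (2^-1 * 2^-1 ^+ k) <= s.
  rewrite -mulr_sumr ler_piMr ?(ltW s0) //.
  have [k|N] := @fset_nat_sum R (fun k => 2^-1 * 2^-1 ^+ k) B.
    by rewrite mulr_ge0 ?invr_ge0 // exprn_ge0 // invr_ge0.
  move/le_trans; apply; rewrite half_geometric gerBl exprn_ge0 // invr_ge0 //.
have Yex t : exists y, box r t -> has_sum (fun k => Y_ k.+1 t - Y_ k t) y.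
  have [tr|] := pselect (box r t); last by exists 0.
  have [|y hy] := @has_sum_exists R _ (fun k => Y_ k.+1 t - Y_ k t) s; last by exists y.
  move=> B; apply: le_trans (geom B); apply: ler_sum => k _.
  exact: (analytic_bound (HY k).2 tr).
have [Y hY] := choice Yex.
have aY : analytic 0 r s Y.
  by apply: analytic_sum r0 (fun k => (HY k).2) geom hY.
have Hlip_pt t y y' : box r t -> nm y <= s -> nm y' <= s ->
    nm (H t y - H t y') <= nm (y - y') / 2.
  move=> tr ys y's.
  have cst (u : K) e : nm u <= e -> analytic 0 1 e (fun _ : 0.-tuple K => u).
    by move=> ue; apply: analytic_le ue (analytic_point u).
  have := Hlip 0%N 1 (fun i _ => tnth t i) _ _ _ ltr01 (nm_ge0 (y - y'))
     (fun i => cst _ _ (le_trans (tr i) rs)) (cst _ _ ys) (cst _ _ y's) (cst _ _ (lexx _)).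
  by move/analytic_bound => /(_ (tzero R 0) (box_tzero ler01)); rewrite mktuple_tnth.
have fixY t : box r t -> Y t = H t (Y t).
  move=> tr; apply: nm_small_eq => e e0.
  have e2 : 0 < e / 2 by rewrite divr_gt0.
  have [N hN] := has_sum_nat (hY t tr) e2.
  have part k : \sum_(0 <= j < k) (Y_ j.+1 t - Y_ j t) = Y_ k t.
    by rewrite telescope_sumr // subr0.
  have h1 := hN N (leqnn N); have h2 := hN N.+1 (leqnSn N).
  rewrite !part in h1 h2.
  have ysN : nm (Y_ N t) <= s.
    apply: le_trans (analytic_bound (HY N).1 tr) _.
    by rewrite ler_piMr ?(ltW s0) // gerBl exprn_ge0 // invr_ge0.
  have h3 := Hlip_pt t _ _ tr ysN (analytic_bound aY tr).
  have -> : Y t - H t (Y t) = (H t (Y_ N t) - H t (Y t)) - (Y_ N.+1 t - Y t).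
    by rewrite /Y_ iterS; ring.
  apply: le_trans (nmB _ _) _; move: h1 h2 h3; lra.
have uniqY t y : box r t -> nm y <= s -> (f (tcons y t) = 0 <-> y = Y t).
  move=> tr ys; rewrite fH; split => [yH|->]; last exact: fixY.
  apply/eqP; rewrite -subr_eq0 -nm_eq0 eq_le nm_ge0 andbT.
  have := Hlip_pt t _ _ tr ys (analytic_bound aY tr); rewrite -yH -fixY //; lra.
have E0 : E (tzero R n.+1) = 0 by apply: germ_at0; apply: germ_lek hE.
have Y0 : Y (tzero R n) = 0.
  apply/esym; apply/uniqY; first exact: box_tzero (ltW r0).
    by rewrite nm0 ltW.
  apply/fH; rewrite /H big1 => [|i _]; last by rewrite tnth_mktuple mulr0.
  rewrite (_ : tcons 0 _ = tzero R n.+1) ?E0 ?addr0 ?mulr0 //.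
  apply: eq_from_tnth => i; rewrite tnth_mktuple.
  by case: (unliftP ord0 i) => [j|] ->; rewrite ?tcons0 // tconsS tnth_mktuple.
have aY1 : analytic 1 r s Y by apply: analytic_order1.
exists Y, r, s; split => //.
have hx i : germ 1 (fun t : n.-tuple K => (if unlift ord0 i is Some j then (fun t => tnth t j) else Y) t).
  by case: unlift => [j|]; [exact: germ_X|exists r, s].
apply: (germ_ext r0) (germZ (- lam^-1) (germ_comp hE hx)) => t tr.
rewrite [in RHS]fixY // -(tcons_mktuple _ (fun i t => tnth t i)) mktuple_tnth /H; ring.
Qed.

End ImplicitFunction.

(** * Germs in curried variables *)

Section CurriedGerms.
Variable R : realType.
Local Notation K := R[i].

Definition small (P : R -> Prop) :=
  exists2 r, 0 < r & forall e, 0 < e -> e <= r -> P e.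

Lemma small_and P Q : small P -> small Q -> small (fun e => P e /\ Q e).
Proof.
move=> [r r0 hP] [r' r'0 hQ]; exists (Num.min r r'); first by rewrite lt_min r0.
by move=> e e0; rewrite le_min => /andP[er er']; split; [apply: hP|apply: hQ].
Qed.

Lemma small_ex P : small P -> exists2 e, 0 < e & P e.
Proof. by move=> [r r0 h]; exists r => //; apply: h. Qed.

Lemma small_imp (P Q : R -> Prop) :
  (forall e, 0 < e -> P e -> Q e) -> small P -> small Q.
Proof. by move=> PQ [r r0 h]; exists r => // e e0 er; apply: PQ => //; apply: h. Qed.

Lemma small_le r : 0 < r -> small (fun e => e <= r).
Proof. by move=> r0; exists r. Qed.

Lemma germ_smallP n (f : n.-tuple K -> K) e : germ 1 f -> 0 < e ->
  small (fun r => forall t, box r t -> nm (f t) <= e).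
Proof.
move=> hf e0; have [r r0 h] := germ_small hf e0; exists r => // r' r'0 r'r t tr.
exact: analytic_bound (h r' r'0 r'r) tr.
Qed.

(** Serves to apply a property that holds at radius e to the values of germs,
    which are at most e once the arguments are at most some smaller r. *)
Lemma small_trans P (Q : R -> R -> Prop) : small P ->
  (forall e, 0 < e -> small (Q e)) ->
  small (fun r => exists2 e, 0 < e & [/\ P e, r <= e & Q e r]).
Proof.
move=> /small_ex[e e0 Pe] h; have [r r0 hr] := small_and (h e e0) (small_le e0).
by exists r => // r' r'0 r'r; exists e => //; have [] := hr r' r'0 r'r.
Qed.

Lemma germ_nth n (i : nat) : (i < n)%N -> germ 1 (fun t : n.-tuple K => t`_i).
Proof.
move=> i_n; apply: germ_eq (germ_X R (Ordinal i_n)) => t.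
by rewrite (tnth_nth 0).
Qed.

Lemma nth_tzero n i : (tzero R n)`_i = 0.
Proof.
have [h|h] := ltnP i n; last by rewrite nth_default // size_tuple.
by rewrite -(tnth_nth 0 (tzero R n) (Ordinal h)) tnth_mktuple.
Qed.

Definition germ_1 k (F : K -> K) := germ k (fun t : 1.-tuple K => F t`_0).
Definition germ_2 k (F : K -> K -> K) := germ k (fun t : 2.-tuple K => F t`_0 t`_1).
Definition germ_3 k (F : K -> K -> K -> K) :=
  germ k (fun t : 3.-tuple K => F t`_0 t`_1 t`_2).
Definition germ_4 k (F : K -> K -> K -> K -> K) :=
  germ k (fun t : 4.-tuple K => F t`_0 t`_1 t`_2 t`_3).

Lemma germ_comp_seq n m k (f : n.-tuple K -> K) (G : n.-tuple (m.-tuple K -> K)) :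
  germ k f -> (forall i, germ 1 (tnth G i)) ->
  germ k (fun t => f [tuple of [seq g t | g <- G]]).
Proof.
move=> hf hG; apply: germ_eq (germ_comp hf hG) => t; congr f.
by apply: eq_from_tnth => i; rewrite tnth_mktuple tnth_map.
Qed.

Lemma germ_comp1 m k F (g0 : m.-tuple K -> K) : germ_1 k F -> germ 1 g0 ->
  germ k (fun t => F (g0 t)).
Proof.
move=> hF h0; apply: (@germ_comp_seq _ _ _ _ [tuple g0] hF).
by case=> [[|i]] //= hi; rewrite (tnth_nth g0).
Qed.

Lemma germ_comp2 m k F (g0 g1 : m.-tuple K -> K) : germ_2 k F ->
  germ 1 g0 -> germ 1 g1 -> germ k (fun t => F (g0 t) (g1 t)).
Proof.
move=> hF h0 h1; apply: (@germ_comp_seq _ _ _ _ [tuple g0; g1] hF).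
by case=> [[|[|i]]] //= hi; rewrite (tnth_nth g0).
Qed.

Lemma germ_comp3 m k F (g0 g1 g2 : m.-tuple K -> K) : germ_3 k F ->
  germ 1 g0 -> germ 1 g1 -> germ 1 g2 ->
  germ k (fun t => F (g0 t) (g1 t) (g2 t)).
Proof.
move=> hF h0 h1 h2; apply: (@germ_comp_seq _ _ _ _ [tuple g0; g1; g2] hF).
by case=> [[|[|[|i]]]] //= hi; rewrite (tnth_nth g0).
Qed.

Lemma germ_comp4 m k F (g0 g1 g2 g3 : m.-tuple K -> K) : germ_4 k F ->
  germ 1 g0 -> germ 1 g1 -> germ 1 g2 -> germ 1 g3 ->
  germ k (fun t => F (g0 t) (g1 t) (g2 t) (g3 t)).
Proof.
move=> hF h0 h1 h2 h3; apply: (@germ_comp_seq _ _ _ _ [tuple g0; g1; g2; g3] hF).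
by case=> [[|[|[|[|i]]]]] //= hi; rewrite (tnth_nth g0).
Qed.

Lemma germ_conj2 k F : germ_2 k F -> germ_2 k (fun x y => (F x^*%C y^*%C)^*%C).
Proof.
move/germ_conj; apply: germ_eq => t; congr (F _ _)^*%C;
  by rewrite -(nth_map 0 0) // size_tuple.
Qed.

Lemma box_le n r r' (t : n.-tuple K) : r <= r' -> box r t -> box r' t.
Proof. by move=> rr tr i; apply: le_trans rr. Qed.

Lemma box1 r x : nm x <= r -> box r ([tuple x] : 1.-tuple K).
Proof. by move=> h; case=> [[|i]] //= hi; rewrite (tnth_nth 0). Qed.

Lemma box2 r x y : nm x <= r -> nm y <= r -> box r ([tuple x; y] : 2.-tuple K).
Proof. by move=> h h'; case=> [[|[|i]]] //= hi; rewrite (tnth_nth 0). Qed.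

Lemma box3 r x y z : nm x <= r -> nm y <= r -> nm z <= r ->
  box r ([tuple x; y; z] : 3.-tuple K).
Proof. by move=> h h' h''; case=> [[|[|[|i]]]] //= hi; rewrite (tnth_nth 0). Qed.

Lemma box4 r x y z u : nm x <= r -> nm y <= r -> nm z <= r -> nm u <= r ->
  box r ([tuple x; y; z; u] : 4.-tuple K).
Proof.
by move=> h0 h1 h2 h3; case=> [[|[|[|[|i]]]]] //= hi; rewrite (tnth_nth 0).
Qed.

Lemma germ_1_small (F : K -> K) e : germ_1 1 F -> 0 < e ->
  small (fun r => forall x, nm x <= r -> nm (F x) <= e).
Proof.
move=> hF /(germ_smallP hF); apply: small_imp => r r0 H x hx.
exact: (H [tuple x] (box1 hx)).
Qed.

Lemma germ_2_small (F : K -> K -> K) e : germ_2 1 F -> 0 < e ->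
  small (fun r => forall x y, nm x <= r -> nm y <= r -> nm (F x y) <= e).
Proof.
move=> hF /(germ_smallP hF); apply: small_imp => r r0 H x y hx hy.
exact: (H [tuple x; y] (box2 hx hy)).
Qed.

Lemma germ_3_small (F : K -> K -> K -> K) e : germ_3 1 F -> 0 < e ->
  small (fun r => forall x y z, nm x <= r -> nm y <= r -> nm z <= r ->
    nm (F x y z) <= e).
Proof.
move=> hF /(germ_smallP hF); apply: small_imp => r r0 H x y z hx hy hz.
exact: (H [tuple x; y; z] (box3 hx hy hz)).
Qed.

Lemma germ_4_lip k (F : K -> K -> K -> K -> K) : germ_4 k.+1 F -> exists r C, [/\ 0 < r, 0 <= C &
  forall m d x0 x1 x2 x3 y0 y1 y2 y3, 0 <= m -> m <= r -> 0 <= d ->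
  [/\ nm x0 <= m, nm x1 <= m, nm x2 <= m & nm x3 <= m] ->
  [/\ nm y0 <= m, nm y1 <= m, nm y2 <= m & nm y3 <= m] ->
  [/\ nm (x0 - y0) <= d, nm (x1 - y1) <= d, nm (x2 - y2) <= d & nm (x3 - y3) <= d] ->
  nm (F x0 x1 x2 x3 - F y0 y1 y2 y3) <= C * m ^+ k * d].
Proof.
move=> /(germ_lip (ltn0Sn k))[r [C [r0 C0 H]]]; exists r, C; split => //.
move=> m d x0 x1 x2 x3 y0 y1 y2 y3 m0 mr d0 [a0 a1 a2 a3] [b0 b1 b2 b3] [d0' d1 d2 d3].
apply: (H [tuple x0; x1; x2; x3] [tuple y0; y1; y2; y3] m d mr m0 d0).
- exact: box4.
- exact: box4.
- by case=> [[|[|[|[|i]]]]] //= hi; rewrite !(tnth_nth 0).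
Qed.

Lemma germ_2_bound k (F : K -> K -> K) : germ_2 k F -> exists r C, [/\ 0 < r, 0 <= C &
  forall m x y, 0 < m -> m <= r -> nm x <= m -> nm y <= m -> nm (F x y) <= C * m ^+ k].
Proof.
move=> /germ_bound[r [C [r0 C0 H]]]; exists r, C; split => // m x y m0 mr xm ym.
exact: (H [tuple x; y] m m0 mr (box2 xm ym)).
Qed.

Lemma germ_3_bound k (F : K -> K -> K -> K) : germ_3 k F -> exists r C, [/\ 0 < r, 0 <= C &
  forall m x y z, 0 < m -> m <= r -> nm x <= m -> nm y <= m -> nm z <= m ->
  nm (F x y z) <= C * m ^+ k].
Proof.
move=> /germ_bound[r [C [r0 C0 H]]]; exists r, C; split => // m x y z m0 mr xm ym zm.
exact: (H [tuple x; y; z] m m0 mr (box3 xm ym zm)).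
Qed.

Lemma implicit_small n (f : n.+1.-tuple K -> K) (lam : K) (l : 'I_n -> K) :
  lam != 0 ->
  germ 2 (fun t => f t - (lam * tnth t ord0 + \sum_i l i * tnth t (lift ord0 i))) ->
  exists Y, [/\ germ 1 Y,
    germ 2 (fun t => Y t + lam^-1 * \sum_i l i * tnth t i),
    small (fun e => forall t, box e t -> f (tcons (Y t) t) = 0) &
    small (fun e => forall t y, box e t -> nm y <= e -> f (tcons y t) = 0 -> y = Y t)].
Proof.
move=> lam0 hE; have [Y [r [s [s0 aY qY uY]]]] := implicit_function lam0 hE.
have r0 := analytic_gt0 aY; exists Y; split => //; first by exists r, s.
  exists r => // e e0 er t te; apply/uY => //; first exact: box_le te.
  by apply: analytic_bound aY _; apply: box_le te.
exists (Num.min r s); first by rewrite lt_min r0.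
move=> e e0; rewrite le_min => /andP[er es] t y te ye.
by apply: (uY t y _ _).1; [apply: box_le te|apply: le_trans es].
Qed.

Lemma implicit1 (f : K -> K -> K) lam l :
  lam != 0 -> germ_2 2 (fun y s => f y s - (lam * y + l * s)) ->
  exists Y, [/\ germ_1 1 Y, germ_1 2 (fun s => Y s + lam^-1 * (l * s)),
    small (fun e => forall s, nm s <= e -> f (Y s) s = 0) &
    small (fun e => forall y s, nm y <= e -> nm s <= e -> f y s = 0 -> y = Y s)].
Proof.
move=> lam0 h.
have [|Y [h1 h2 h3 h4]] := @implicit_small 1 (fun t => f t`_0 t`_1) lam (fun=> l) lam0.
  apply: germ_eq h => t.
  by rewrite !big_ord_recl big_ord0 !(tnth_nth 0) /= addr0.
have tE (t : 1.-tuple K) : t = [tuple t`_0].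
  by apply: eq_from_tnth => -[[|i]] //= hi; rewrite !(tnth_nth 0).
exists (fun s => Y [tuple s]); split.
- by apply: germ_eq h1 => t; rewrite -tE.
- apply: germ_eq h2 => t; rewrite !big_ord_recl big_ord0 !(tnth_nth 0) /= addr0.
  by rewrite -tE.
- by apply: small_imp h3 => e e0 H s hs; apply: (H [tuple s] (box1 hs)).
- by apply: small_imp h4 => e e0 H y s hy hs; apply: (H [tuple s] y (box1 hs)).
Qed.

Lemma implicit2 (f : K -> K -> K -> K) lam l1 l2 :
  lam != 0 -> germ_3 2 (fun y s t => f y s t - (lam * y + (l1 * s + l2 * t))) ->
  exists Y, [/\ germ_2 1 Y, germ_2 2 (fun s t => Y s t + lam^-1 * (l1 * s + l2 * t)),
    small (fun e => forall s t, nm s <= e -> nm t <= e -> f (Y s t) s t = 0) &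
    small (fun e => forall y s t, nm y <= e -> nm s <= e -> nm t <= e ->
             f y s t = 0 -> y = Y s t)].
Proof.
move=> lam0 h.
have [|Y [h1 h2 h3 h4]] := @implicit_small 2 (fun t => f t`_0 t`_1 t`_2) lam
    (fun i => [:: l1; l2]`_i) lam0.
  apply: germ_eq h => t.
  by rewrite !big_ord_recl big_ord0 !(tnth_nth 0) /= addr0.
have tE (t : 2.-tuple K) : t = [tuple t`_0; t`_1].
  by apply: eq_from_tnth => -[[|[|i]]] //= hi; rewrite !(tnth_nth 0).
exists (fun s t => Y [tuple s; t]); split.
- by apply: germ_eq h1 => t; rewrite -tE.
- apply: germ_eq h2 => t; rewrite !big_ord_recl big_ord0 !(tnth_nth 0) /= addr0.
  by rewrite -tE.
- by apply: small_imp h3 => e e0 H s t hs ht; apply: (H [tuple s; t] (box2 hs ht)).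
- by apply: small_imp h4 => e e0 H y s t hy hs ht;
     apply: (H [tuple s; t] y (box2 hs ht)).
Qed.

Lemma implicit3 (f : K -> K -> K -> K -> K) lam :
  lam != 0 -> germ_4 2 (fun y s t u => f y s t u - lam * y) ->
  exists Y, [/\ germ_3 2 Y,
    small (fun e => forall s t u, nm s <= e -> nm t <= e -> nm u <= e ->
             f (Y s t u) s t u = 0) &
    small (fun e => forall y s t u, nm y <= e -> nm s <= e -> nm t <= e ->
             nm u <= e -> f y s t u = 0 -> y = Y s t u)].
Proof.
move=> lam0 h.
have [|Y [h1 h2 h3 h4]] := @implicit_small 3 (fun t => f t`_0 t`_1 t`_2 t`_3) lam
    (fun=> 0) lam0.
  apply: germ_eq h => t.
  by rewrite big1 ?addr0 => [|i _]; rewrite ?mul0r // (tnth_nth 0).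
have tE (t : 3.-tuple K) : t = [tuple t`_0; t`_1; t`_2].
  by apply: eq_from_tnth => -[[|[|[|i]]]] //= hi; rewrite !(tnth_nth 0).
exists (fun s t u => Y [tuple s; t; u]); split.
- apply: germ_eq h2 => t; rewrite big1 => [|i _]; last by rewrite mul0r.
  by rewrite mulr0 addr0 -tE.
- by apply: small_imp h3 => e e0 H s t u hs ht hu;
     apply: (H [tuple s; t; u] (box3 hs ht hu)).
- by apply: small_imp h4 => e e0 H y s t u hy hs ht hu;
     apply: (H [tuple s; t; u] y (box3 hs ht hu)).
Qed.

End CurriedGerms.

(** * Normal coordinates *)

Section NormalForm.
Variable R : realType.
Local Notation K := R[i].

Lemma conj_i : ('i%C : K)^*%C = - 'i%C.
Proof. by apply/eqP; rewrite eq_complex /= oppr0 !eqxx. Qed.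

Lemma conjD (x y : K) : (x + y)^*%C = x^*%C + y^*%C.
Proof. exact: rmorphD. Qed.

Lemma conjN (x : K) : (- x)^*%C = - x^*%C.
Proof. exact: rmorphN. Qed.

Lemma conjM (x y : K) : (x * y)^*%C = x^*%C * y^*%C.
Proof. exact: rmorphM. Qed.

Lemma ii_neq0 : 2 * 'i%C != 0 :> K.
Proof.
rewrite mulf_neq0 ?pnatr_eq0 //; apply/negP => /eqP h.
by have := nm_i R; rewrite h nm0 => /eqP; rewrite eq_sym oner_eq0.
Qed.

Lemma i_neq0 : 'i%C != 0 :> K.
Proof. by have := ii_neq0; rewrite mulf_eq0 negb_or => /andP[]. Qed.

Lemma mulii : 'i%C * 'i%C = -1 :> K.
Proof. by rewrite -expr2 sqr_i. Qed.

Lemma germD2 n k (f g h : n.-tuple K -> K) :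
  germ k f -> germ k g -> (forall t, h t = f t + g t) -> germ k h.
Proof. by move=> hf hg e; apply: germ_eq (germD hf hg) => t; rewrite e. Qed.

Variables (P : K -> K -> K -> K -> K) (a b : K).
Hypothesis symP : forall z y w o, (P z y w o)^*%C = P y^*%C z^*%C o^*%C w^*%C.
Hypothesis linP : germ_4 2 (fun z y w o => P z y w o - (w - o) / (2 * 'i%C)).
Hypothesis quadP : germ_2 3 (fun z y => P z y 0 0 + z * y - a * z ^+ 2 - b * y ^+ 2).

(** The curve of M in z = 0 is g s = s + i v s for real s, with v real there.
    For complex s the two conjugate branches g and gc become independent of
    conjugation, and gc is the conjugate series of g. *)
Lemma transverse_curve : exists g gc : K -> K,
  [/\ germ_1 2 (fun s => g s - s), germ_1 2 (fun s => gc s - s),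
      small (fun e => forall s, nm s <= e -> P 0 0 (g s) (gc s) = 0) &
      small (fun e => forall s, nm s <= e -> (g s)^*%C = gc s^*%C)].
Proof.
have h0 : germ 1 (fun t : 2.-tuple K => t`_0) by apply: germ_nth.
have h1 : germ 1 (fun t : 2.-tuple K => t`_1) by apply: germ_nth.
have [|v [_ v2 v3 v4]] := @implicit1 R (fun v s => P 0 0 (s + 'i%C * v) (s - 'i%C * v)) 1 0 (oner_neq0 _).
  apply: germ_eq (germ_comp4 linP (germ0 R _ _) (germ0 R _ _) (germD h1 (germZ 'i%C h0))
    (germB h1 (germZ 'i%C h0))) => t /=.
  by field; exact: i_neq0.
have v2' : germ_1 2 v by apply: germ_eq v2 => t; rewrite mul0r mulr0 addr0.
have vsmall e : 0 < e -> small (fun r => forall s, nm s <= r -> nm (v s) <= e).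
  move=> e0; have := germ_smallP (germ_lek (leqnSn 1) v2') e0.
  by apply: small_imp => r r0 H s hs; apply: (H [tuple s] (box1 hs)).
exists (fun s => s + 'i%C * v s), (fun s => s - 'i%C * v s); split.
- by apply: germ_eq (germZ 'i%C v2') => t; ring.
- by apply: germ_eq (germZ (- 'i%C) v2') => t; ring.
- exact: v3.
- have := small_trans v4 (fun e e0 => small_and (vsmall e e0) v3).
  apply: small_imp => r r0 [e e0 [H re [ve Z]]] s hs.
  have hv : (v s)^*%C = v s^*%C.
    apply: H; rewrite ?nm_conj ?ve //; first exact: le_trans re.
    have := congr1 (@conjc R) (Z s hs); rewrite symP !conjc0.
    rewrite !(conjD, conjN, conjM) conj_i => Z'.
    by apply: etrans Z'; congr P; ring.
  by rewrite conjD conjM conj_i hv; ring.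
Qed.

(** The Segre varieties over the points of the curve foliate a neighbourhood of
    the origin: the leaf through (z, w) has parameter W, and each of w and W is
    a holomorphic function of z and the other one. *)
Lemma segre_foliation (gc : K -> K) : germ_1 2 (fun s => gc s - s) ->
  exists W G : K -> K -> K,
  [/\ germ_2 1 W, germ_2 2 (fun z s => G z s - s),
      small (fun e => forall z w s, nm z <= e -> nm w <= e -> nm s <= e ->
         (s = W z w <-> w = G z s)),
      small (fun e => forall z s, nm z <= e -> nm s <= e -> P z 0 (G z s) (gc s) = 0) &
      small (fun e => forall z w s, nm z <= e -> nm w <= e -> nm s <= e ->
         P z 0 w (gc s) = 0 -> w = G z s)].
Proof.
move=> hgc.
have h0 : germ 1 (fun t : 3.-tuple K => t`_0) by apply: germ_nth.
have h1 : germ 1 (fun t : 3.-tuple K => t`_1) by apply: germ_nth.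
have h2 : germ 1 (fun t : 3.-tuple K => t`_2) by apply: germ_nth.
have gc1 n (x : n.-tuple K -> K) : germ 1 x -> germ 1 (fun t => gc (x t)).
  move=> hx; apply: germD2 (germ_lek (leqnSn 1) (germ_comp1 hgc hx)) hx _ => t.
  by rewrite subrK.
have c0 : (2 * 'i%C)^-1 != 0 :> K by rewrite invr_neq0 ?ii_neq0.
have [||W [W1 _ W3 W4]] := @implicit2 R (fun s z w => P z 0 w (gc s)) (- (2 * 'i%C)^-1) 0 (2 * 'i%C)^-1.
- by rewrite oppr_eq0.
- apply: germD2 (germ_comp4 linP h1 (germ0 R _ _) h2 (gc1 _ _ h0))
    (germZ (- (2 * 'i%C)^-1) (germ_comp1 hgc h0)) _ => t /=; ring.
have [|G [G1 G2 G3 G4]] := @implicit2 R (fun w z s => P z 0 w (gc s)) ((2 * 'i%C)^-1) 0 (- (2 * 'i%C)^-1) c0.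
  apply: germD2 (germ_comp4 linP h1 (germ0 R _ _) h0 (gc1 _ _ h2))
    (germZ (- (2 * 'i%C)^-1) (germ_comp1 hgc h2)) _ => t /=; ring.
exists W, G; split => //.
- by apply: germ_eq G2 => t; field; exact: i_neq0.
- have := small_and (small_and W3 W4) (small_and G3 G4).
  apply: small_imp => e e0 [[w3 w4] [g3 g4]] z w s hz hw hs; split => h.
    by apply: g4 => //; rewrite h; apply: w3.
  by apply: w4 => //; rewrite h; apply: g3.
- by apply: small_imp G4 => e e0 H z w s hz hw hs; apply: H.
Qed.

(** The holomorphic function with conjugate coefficients. *)
Definition conj2 (G : K -> K -> K) z s := (G z^*%C s^*%C)^*%C.
(** The complexified equation in the coordinates (z, W), where w = G z W. *)
Definition straightened (G : K -> K -> K) z y w o := P z y (G z w) (conj2 G y o).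

Lemma straightened_sym G z y w o :
  (straightened G z y w o)^*%C = straightened G y^*%C z^*%C o^*%C w^*%C.
Proof. by rewrite /straightened symP /conj2 !conjcK. Qed.

Lemma germ_2_order1 (G : K -> K -> K) : germ_2 2 (fun z s => G z s - s) -> germ_2 1 G.
Proof.
move=> hG; have h1 : germ 1 (fun t : 2.-tuple K => t`_1) by apply: germ_nth.
by apply: germD2 (germ_lek (leqnSn 1) hG) h1 _ => t; rewrite subrK.
Qed.

Lemma conj2_germ (G : K -> K -> K) : germ_2 2 (fun z s => G z s - s) ->
  germ_2 2 (fun z s => conj2 G z s - s).
Proof.
move/germ_conj2; apply: germ_eq => t.
by rewrite conjD conjN conjcK.
Qed.

Lemma straightened_lin G : germ_2 2 (fun z s => G z s - s) ->
  germ_4 2 (fun z y w o => straightened G z y w o - (w - o) / (2 * 'i%C)).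
Proof.
move=> hG; have hGc := conj2_germ hG.
have h0 : germ 1 (fun t : 4.-tuple K => t`_0) by apply: germ_nth.
have h1 : germ 1 (fun t : 4.-tuple K => t`_1) by apply: germ_nth.
have h2 : germ 1 (fun t : 4.-tuple K => t`_2) by apply: germ_nth.
have h3 : germ 1 (fun t : 4.-tuple K => t`_3) by apply: germ_nth.
have G1 := germ_comp2 (germ_2_order1 hG) h0 h2.
have G2 := germ_comp2 (germ_2_order1 hGc) h1 h3.
apply: germD2 (germ_comp4 linP h0 h1 G1 G2) (germZ (2 * 'i%C)^-1
  (germB (germ_comp2 hG h0 h2) (germ_comp2 hGc h1 h3))) _ => t /=.
by rewrite /straightened; ring.
Qed.

Section Graph.
Variables (g gc : K -> K) (G : K -> K -> K).
Hypothesis g_lin : germ_1 2 (fun s => g s - s).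
Hypothesis g_curve : small (fun e => forall s, nm s <= e -> P 0 0 (g s) (gc s) = 0).
Hypothesis g_conj : small (fun e => forall s, nm s <= e -> (g s)^*%C = gc s^*%C).
Hypothesis G_lin : germ_2 2 (fun z s => G z s - s).
Hypothesis G_leaf :
  small (fun e => forall z s, nm z <= e -> nm s <= e -> P z 0 (G z s) (gc s) = 0).
Hypothesis G_uniq :
  small (fun e => forall z w s, nm z <= e -> nm w <= e -> nm s <= e ->
    P z 0 w (gc s) = 0 -> w = G z s).

(** For z = 0 the leaf of parameter s meets the curve, so G 0 s = g s and
    conj2 G 0 s = gc s; the equation becomes the one of the leaf of parameter s. *)
Lemma straightened_z0 : small (fun e => forall z s, nm z <= e -> nm s <= e ->
  straightened G z 0 s s = 0).
Proof.
have g1 : germ_1 1 g.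
  apply: germD2 (germ_lek (leqnSn 1) g_lin) (germ_nth R (isT : (0 < 1)%N)) _ => t.
  by rewrite subrK.
have Gg : small (fun e => forall s, nm s <= e -> G 0 s = g s).
  have := small_trans G_uniq (fun e e0 => small_and (germ_1_small g1 e0) g_curve).
  apply: small_imp => r r0 [e e0 [H re [gs Z]]] s hs; apply/esym/H.
  - by rewrite nm0 ltW.
  - exact: gs.
  - exact: le_trans re.
  - exact: Z.
apply: small_imp (small_and (small_and Gg g_conj) G_leaf) => e e0 [[H1 H2] H3] z s hz hs.
rewrite /straightened /conj2 conjc0 H1 ?nm_conj // H2 ?nm_conj // conjcK.
exact: H3.
Qed.

Lemma straightened_0y : small (fun e => forall y s, nm y <= e -> nm s <= e ->
  straightened G 0 y s s = 0).
Proof.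
apply: small_imp straightened_z0 => e e0 H y s hy hs.
rewrite -[LHS]conjcK straightened_sym conjc0 H ?nm_conj // conjc0 //.
Qed.

(** The pure terms and the failure of symmetry vanish by uniqueness: 0, and the
    conjugate of phi, are solutions of the same equation. *)
Lemma normal_graph : exists phi : K -> K -> K -> K,
  [/\ germ_3 2 phi,
      small (fun e => forall z s, nm z <= e -> nm s <= e -> phi z 0 s = 0),
      small (fun e => forall y s, nm y <= e -> nm s <= e -> phi 0 y s = 0),
      small (fun e => forall z y s, nm z <= e -> nm y <= e -> nm s <= e ->
        (phi z y s)^*%C = phi y^*%C z^*%C s^*%C) &
      small (fun e => forall v z y s, nm v <= e -> nm z <= e -> nm y <= e ->
        nm s <= e ->
        (straightened G z y (s + 'i%C * v) (s - 'i%C * v) = 0 <-> v = phi z y s))].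
Proof.
have h0 : germ 1 (fun t : 4.-tuple K => t`_0) by apply: germ_nth.
have h1 : germ 1 (fun t : 4.-tuple K => t`_1) by apply: germ_nth.
have h2 : germ 1 (fun t : 4.-tuple K => t`_2) by apply: germ_nth.
have h3 : germ 1 (fun t : 4.-tuple K => t`_3) by apply: germ_nth.
have [|phi [phi2 Z U]] := @implicit3 R (fun v z y s =>
    straightened G z y (s + 'i%C * v) (s - 'i%C * v)) 1 (oner_neq0 _).
  apply: germ_eq (germ_comp4 (straightened_lin G_lin) h1 h2 (germD h3 (germZ 'i%C h0))
    (germB h3 (germZ 'i%C h0))) => t /=.
  by field; exact: i_neq0.
have hsmall e : 0 < e -> small (fun r => forall z y s, nm z <= r -> nm y <= r ->
    nm s <= r -> nm (phi z y s) <= e).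
  by move=> e0; apply: germ_3_small => //; apply: germ_lek phi2.
exists phi; split => //.
- apply: small_imp (small_and U straightened_z0) => e e0 [H1 H2] z s hz hs; apply/esym/H1;
    rewrite ?nm0 ?(ltW e0) //.
  by rewrite mulr0 addr0 subr0; apply: H2.
- apply: small_imp (small_and U straightened_0y) => e e0 [H1 H2] y s hy hs; apply/esym/H1;
    rewrite ?nm0 ?(ltW e0) //.
  by rewrite mulr0 addr0 subr0; apply: H2.
- have := small_trans U (fun e e0 => small_and (hsmall e e0) Z).
  apply: small_imp => r r0 [e e0 [H re [ve Z']]] z y s hz hy hs.
  apply: H; rewrite ?nm_conj; [exact: ve|exact: le_trans re|exact: le_trans re|
    exact: le_trans re|].
  have := congr1 (@conjc R) (Z' z y s hz hy hs); rewrite straightened_sym conjc0.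
  rewrite !(conjD, conjN, conjM) conj_i => Z''.
  by apply: etrans Z''; congr straightened; ring.
- have := small_trans U (fun e e0 => small_and (hsmall e e0) Z).
  apply: small_imp => r r0 [e e0 [H re [ve Z']]] v z y s hv hz hy hs; split => [h|->].
    by apply: H => //; exact: le_trans re.
  exact: Z'.
Qed.

End Graph.

End NormalForm.

Section LeadingTerm.
Variable R : realType.
Local Notation K := R[i].

(** The remainders of the divisions by z and by y are values of phi at z = 0
    and at y = 0. *)
Lemma graph_divisible (phi : K -> K -> K -> K) : germ_3 2 phi ->
  small (fun e => forall z s, nm z <= e -> nm s <= e -> phi z 0 s = 0) ->
  small (fun e => forall y s, nm y <= e -> nm s <= e -> phi 0 y s = 0) ->
  exists2 g : 3.-tuple K -> K, germ 0 g &
    small (fun e => forall z y s, nm z <= e -> nm y <= e -> nm s <= e ->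
      phi z y s = z * y * g [tuple z; y; s]).
Proof.
move=> [r [C aphi]] hz hy; have r0 := analytic_gt0 aphi.
pose i0 : 'I_3 := Ordinal (isT : (0 < 3)%N).
pose i1 : 'I_3 := Ordinal (isT : (1 < 3)%N).
have [g1 [ag1 _ e1]] := analytic_split i0 aphi.
have [g2 [ag2 _ e2]] := analytic_split i1 ag1.
exists g2; first by exists r, (C / r / r).
apply: small_imp (small_and (small_le r0) (small_and hz hy)) => e e0 [er [Hz Hy]] z y s ze ye se.
have zat0 u v : zero_at i0 [tuple u; v; s] = [tuple 0; v; s] :> 3.-tuple K.
  by apply: eq_from_tnth; case=> [[|[|[|k]]]] //= hk; rewrite tnth_mktuple !(tnth_nth 0).
have zat1 u v : zero_at i1 [tuple u; v; s] = [tuple u; 0; s] :> 3.-tuple K.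
  by apply: eq_from_tnth; case=> [[|[|[|k]]]] //= hk; rewrite tnth_mktuple !(tnth_nth 0).
have E v : nm v <= e -> phi z v s = z * g1 [tuple z; v; s].
  move=> ve; have := e1 [tuple z; v; s] (box3 (le_trans ze er) (le_trans ve er) (le_trans se er)).
  by rewrite zat0 /= (tnth_nth 0) /= Hy // add0r.
rewrite (E y ye) (e2 _ (box3 (le_trans ze er) (le_trans ye er) (le_trans se er))).
rewrite zat1 (tnth_nth 0) /= mulrDr -(E 0) ?nm0 ?(ltW e0) // Hz // add0r.
by rewrite mulrA.
Qed.

Variables (P : K -> K -> K -> K -> K) (a b : K).
Hypothesis symP : forall z y w o, (P z y w o)^*%C = P y^*%C z^*%C o^*%C w^*%C.
Hypothesis linP : germ_4 2 (fun z y w o => P z y w o - (w - o) / (2 * 'i%C)).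
Hypothesis quadP : germ_2 3 (fun z y => P z y 0 0 + z * y - a * z ^+ 2 - b * y ^+ 2).
Variable G : K -> K -> K.
Hypothesis G_lin : germ_2 2 (fun z s => G z s - s).
Hypothesis flat_z : small (fun e => forall z s, nm z <= e -> nm s <= e ->
  straightened P G z 0 s s = 0).
Hypothesis flat_y : small (fun e => forall y s, nm y <= e -> nm s <= e ->
  straightened P G 0 y s s = 0).

(** The equation vanishes for y = 0 and for z = 0 on w = o = 0.  Subtracting
    these two values removes the linear terms and the pure quadratic ones; the
    substitution w = G z 0, of order 2, only contributes terms of order 3 to the
    remaining ones. *)
Lemma straightened_leading : exists r C, [/\ 0 < r, 0 <= C & forall x, nm x <= r ->
  x != 0 -> nm (straightened P G x x 0 0 + x ^+ 2) <= C * nm x ^+ 3].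
Proof.
have [r1 [C1 [r10 C10 lip]]] := germ_4_lip linP.
have [r2 [C2 [r20 C20 bdG]]] := germ_2_bound G_lin.
have [r3 [C3 [r30 C30 bdGc]]] := germ_2_bound (conj2_germ G_lin).
have [r4 [C4 [r40 C40 bdq]]] := germ_2_bound quadP.
have [r5 r50 [[fz fy] [sG sGc]]] := small_ex (small_and (small_and flat_z flat_y)
  (small_and (germ_2_small (germ_2_order1 G_lin) r10)
     (germ_2_small (germ_2_order1 (conj2_germ G_lin)) r10))).
pose D := C2 + C3.
have D0 : 0 <= D by rewrite addr_ge0.
exists (Num.min (Num.min r1 r2) (Num.min (Num.min r3 r4) (Num.min r5 (D + 1)^-1))).
exists (3 * (C1 * D) + 3 * C4); split.
- by rewrite !lt_min r10 r20 r30 r40 r50 invr_gt0 ltr_wpDl.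
- by rewrite addr_ge0 ?mulr_ge0.
move=> x; rewrite !le_min => /and3P[/andP[x1 x2] /andP[x3 x4] /andP[x5 xD]] x0.
set m := nm x in x1 x2 x3 x4 x5 xD *.
have m0 : 0 < m by rewrite nm_gt0.
have z_m : nm (0 : K) <= m by rewrite nm0 ltW.
have x_m : nm x <= m by [].
have G00 : G 0 0 = 0.
  by have := germ_at0 (germ_2_order1 G_lin); rewrite !nth_tzero.
have Gc00 : conj2 G 0 0 = 0 by rewrite /conj2 conjc0 G00 conjc0.
have hG : nm (G x 0) <= D * m ^+ 2.
  have := bdG m x 0 m0 x2 x_m z_m; rewrite subr0 => /le_trans; apply.
  by rewrite ler_wpM2r ?exprn_ge0 ?(ltW m0) // lerDl.
have hGc : nm (conj2 G x 0) <= D * m ^+ 2.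
  have := bdGc m x 0 m0 x3 x_m z_m; rewrite subr0 => /le_trans; apply.
  by rewrite ler_wpM2r ?exprn_ge0 ?(ltW m0) // lerDr.
have Dm : D * m ^+ 2 <= m.
  rewrite expr2 mulrA ler_piMl ?(ltW m0) //.
  apply: (@le_trans _ _ (D * (D + 1)^-1)); first by rewrite ler_wpM2l.
  by rewrite ler_pdivrMr ?ltr_wpDl // mul1r lerDl ler01.
pose E z y w o := P z y w o - (w - o) / (2 * 'i%C).
have d0 : 0 <= D * m ^+ 2 by rewrite mulr_ge0 // exprn_ge0 // ltW.
have step z y w o : (z = x \/ z = 0) -> (y = x \/ y = 0) ->
    nm w <= D * m ^+ 2 -> nm o <= D * m ^+ 2 ->
    nm (E z y w o - E z y 0 0) <= C1 * D * m ^+ 3.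
  move=> hz hy hw ho.
  have zm : nm z <= m by case: hz => ->.
  have ym : nm y <= m by case: hy => ->.
  have := lip m (D * m ^+ 2) z y w o z y 0 0 (ltW m0) x1 d0.
  rewrite !subrr !subr0 nm0 => H.
  rewrite (_ : C1 * D * m ^+ 3 = C1 * m ^+ 1 * (D * m ^+ 2)); last by ring.
  rewrite /E !subr0; apply: H; split => //; [exact: le_trans Dm|exact: le_trans Dm|exact: ltW|exact: ltW].
have s1 := step x x (G x 0) (conj2 G x 0) (or_introl erefl) (or_introl erefl) hG hGc.
have s2 := step x 0 (G x 0) 0 (or_introl erefl) (or_intror erefl) hG _.
have s3 := step 0 x 0 (conj2 G x 0) (or_intror erefl) (or_introl erefl) _ hGc.
rewrite nm0 in s2 s3; have {}s2 := s2 d0; have {}s3 := s3 d0.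
have f2 : P x 0 (G x 0) 0 = 0.
  by have := fz x 0 x5; rewrite nm0 /straightened Gc00; apply; apply: ltW.
have f3 : P 0 x 0 (conj2 G x 0) = 0.
  by have := fy x 0 x5; rewrite nm0 /straightened G00; apply; apply: ltW.
have q1 := bdq m x x m0 x4 x_m x_m.
have q2 := bdq m x 0 m0 x4 x_m z_m.
have q3 := bdq m 0 x m0 x4 z_m x_m.
set Q1 := P x x 0 0 + _ - _ - _ in q1; set Q2 := P x 0 0 0 + _ - _ - _ in q2.
set Q3 := P 0 x 0 0 + _ - _ - _ in q3.
set S1 := E x x _ _ - _ in s1; set S2 := E x 0 _ _ - _ in s2.
set S3 := E 0 x _ _ - _ in s3.
have -> : straightened P G x x 0 0 + x ^+ 2 = (S1 - S2 - S3) + (Q1 - Q2 - Q3).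
  by rewrite /straightened /S1 /S2 /S3 /Q1 /Q2 /Q3 /E f2 f3; ring.
apply: le_trans (nmD _ _) _.
have t1 := nmB (S1 - S2) S3; have t2 := nmB S1 S2.
have t3 := nmB (Q1 - Q2) Q3; have t4 := nmB Q1 Q2.
have -> : (3 * (C1 * D) + 3 * C4) * m ^+ 3 = 3 * (C1 * D * m ^+ 3) + 3 * (C4 * m ^+ 3) by ring.
move: (C1 * D * m ^+ 3) (C4 * m ^+ 3) s1 s2 s3 q1 q2 q3 => u v; lra.
Qed.

Variable phi : K -> K -> K -> K.
Hypothesis phi2 : germ_3 2 phi.
Hypothesis phi_eq : small (fun e => forall v z y s, nm v <= e -> nm z <= e ->
  nm y <= e -> nm s <= e ->
  (straightened P G z y (s + 'i%C * v) (s - 'i%C * v) = 0 <-> v = phi z y s)).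

(** Moving w and o from i phi and - i phi to 0 costs a term of order 3, since
    phi has order 2; up to such terms phi is therefore the opposite of the
    straightened equation at w = o = 0. *)
Lemma graph_leading : exists r C, [/\ 0 < r, 0 <= C & forall x, nm x <= r ->
  x != 0 -> nm (phi x x 0 - x ^+ 2) <= C * nm x ^+ 3].
Proof.
have [r1 [C1 [r10 C10 lip]]] := germ_4_lip (straightened_lin linP G_lin).
have [r2 [C2 [r20 C20 bd]]] := germ_3_bound phi2.
have [r3 [C3 [r30 C30 lead]]] := straightened_leading.
have [r4 r40 [r5 r50 [pe r45 ps]]] := small_ex (small_trans phi_eq
  (fun e e0 => germ_3_small (germ_lek (leqnSn 1) phi2) e0)).
exists (Num.min (Num.min r1 r2) (Num.min (Num.min r3 r4) (C2 + 1)^-1)).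
exists (C1 * C2 + C3); split.
- by rewrite !lt_min r10 r20 r30 r40 invr_gt0 ltr_wpDl.
- by rewrite addr_ge0 ?mulr_ge0.
move=> x; rewrite !le_min => /and3P[/andP[x1 x2] /andP[x3 x4] xC] x0.
have l := lead x x3 x0; set m := nm x in x1 x2 x3 x4 xC l *.
have m0 : 0 < m by rewrite nm_gt0.
have z_m : nm (0 : K) <= m by rewrite nm0 ltW.
have x_m : nm x <= m by [].
set f := phi x x 0.
have hf : nm f <= C2 * m ^+ 2 by apply: bd.
have fm : nm f <= m.
  apply: le_trans hf _; rewrite expr2 mulrA ler_piMl ?(ltW m0) //.
  apply: (@le_trans _ _ (C2 * (C2 + 1)^-1)); first by rewrite ler_wpM2l.
  by rewrite ler_pdivrMr ?ltr_wpDl // mul1r lerDl ler01.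
have eq0 : straightened P G x x ('i%C * f) (- ('i%C * f)) = 0.
  have := pe f x x 0; rewrite add0r sub0r nm0 => H; apply/H => //.
  - by apply: ps; rewrite ?nm0 ?(ltW r40).
  - exact: le_trans r45.
  - exact: le_trans r45.
  - exact: ltW.
have d0 : 0 <= C2 * m ^+ 2 by rewrite mulr_ge0 // exprn_ge0 // ltW.
have nif : nm ('i%C * f) = nm f by rewrite nmM nm_i mul1r.
have := lip m (C2 * m ^+ 2) x x ('i%C * f) (- ('i%C * f)) x x 0 0 (ltW m0) x1 d0.
rewrite !subrr !subr0 nmN nif nm0 eq0 => h.
have {}h : nm (0 - ('i%C * f - - ('i%C * f)) / (2 * 'i%C) -
     (straightened P G x x 0 0 - 0 / (2 * 'i%C))) <= C1 * m ^+ 1 * (C2 * m ^+ 2).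
  by apply: h; split => //; apply: ltW.
have -> : f - x ^+ 2 = - (0 - ('i%C * f - - ('i%C * f)) / (2 * 'i%C) -
     (straightened P G x x 0 0 - 0 / (2 * 'i%C))) - (straightened P G x x 0 0 + x ^+ 2).
  by field; exact: i_neq0.
apply: le_trans (nmB _ _) _; rewrite nmN; apply: le_trans (lerD h l) _.
by rewrite le_eqVlt; apply/orP; left; apply/eqP; ring.
Qed.

End LeadingTerm.

Section NormalFormTheorem.
Variable R : realType.
Local Notation K := R[i].

Lemma germ_analytic n k (f : n.-tuple K -> K) : germ k f ->
  small (fun e => exists C, analytic k e C f).
Proof.
move=> [r [C h]]; exists r; first exact: analytic_gt0 h.
by move=> e e0 er; exists C; apply: analytic_ler h.
Qed.

Lemma germ_split_last (g : 3.-tuple K -> K) : germ 0 g -> g (tzero R 3) = 1 ->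
  exists A B, [/\ germ 1 A, germ 0 B & small (fun e => forall z y s : K, nm z <= e ->
    nm y <= e -> nm s <= e ->
    g [tuple z; y; s] = 1 + A [tuple z; y] + s * B [tuple z; y; s])].
Proof.
move=> hg g01; have [r [C ag]] := hg; have r0 := analytic_gt0 ag.
pose i2 : 'I_3 := Ordinal (isT : (2 < 3)%N).
have [B [aB _ e2]] := analytic_split i2 ag.
exists (fun t : 2.-tuple K => g [tuple t`_0; t`_1; 0] - 1), B; split.
- apply: germ_order1; last first.
    rewrite !nth_tzero -[X in _ - X]g01; apply/eqP; rewrite subr_eq0; apply/eqP.
    congr g; apply: eq_from_tnth; case=> [[|[|[|k]]]] //= hk;
      by rewrite tnth_mktuple (tnth_nth 0).
  apply: germB; last exact: germ_cst.
  apply: (@germ_comp3 R 2 0 (fun x y z => g [tuple x; y; z]) (fun t => t`_0) (fun t => t`_1) (fun=> 0)).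
  + apply: germ_eq hg => t; congr g.
    by apply: eq_from_tnth; case=> [[|[|[|k]]]] //= hk; rewrite !(tnth_nth 0).
  + exact: germ_nth.
  + exact: germ_nth.
  + exact: germ0.
- by exists r, (C / r).
- exists r => // e e0 er z y s ze ye se.
  rewrite (e2 _ (box3 (le_trans ze er) (le_trans ye er) (le_trans se er))) (tnth_nth 0) /=.
  rewrite [1 + _]addrC subrK; congr (g _ + _).
  by apply: eq_from_tnth; case=> [[|[|[|k]]]] //= hk; rewrite tnth_mktuple !(tnth_nth 0).
Qed.

(** Vanishing of the pluriharmonic part makes the graph divisible by z y, and
    the quotient is 1 at the origin. *)
Lemma graph_factor (phi : K -> K -> K -> K) : germ_3 2 phi ->
  small (fun e => forall z s, nm z <= e -> nm s <= e -> phi z 0 s = 0) ->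
  small (fun e => forall y s, nm y <= e -> nm s <= e -> phi 0 y s = 0) ->
  (exists r C, [/\ 0 < r, 0 <= C & forall x, nm x <= r ->
    x != 0 -> nm (phi x x 0 - x ^+ 2) <= C * nm x ^+ 3]) ->
  exists A B, [/\ germ 1 A, germ 0 B & small (fun e => forall z y s : K, nm z <= e ->
    nm y <= e -> nm s <= e ->
    phi z y s = z * y + z * y * A [tuple z; y] + z * y * (s * B [tuple z; y; s]))].
Proof.
move=> phi2 hz hy [r [C [r0 C0 lead]]].
have [g hg fac] := graph_divisible phi2 hz hy.
have g01 : g (tzero R 3) = 1.
  apply: nm_small_eq => e e0.
  have e2 : 0 < e / 2 by rewrite divr_gt0.
  have h1 : germ 1 (fun t => g t - g (tzero R 3)).
    by apply: germ_order1; [apply: germB => //; apply: germ_cst|rewrite subrr].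
  have s1 : small (fun m => C * m <= e / 2).
    exists (e / 2 / (C + 1)); first by rewrite divr_gt0 // ltr_wpDl.
    move=> m m0; rewrite ler_pdivlMr ?ltr_wpDl // => /(le_trans _); apply.
    by rewrite mulrC ler_wpM2l ?(ltW m0) // lerDl.
  have [m m0 [[F S] [mr Cm]]] := small_ex (small_and
    (small_and fac (germ_smallP h1 e2)) (small_and (small_le r0) s1)).
  pose x : K := m%:C.
  have nx : nm x = m by rewrite nm_real ger0_norm // ltW.
  have xm : nm x <= m by rewrite nx.
  have x0 : x != 0 by rewrite -nm_eq0 nx gt_eqF.
  have z0 : nm (0 : K) <= m by rewrite nm0 ltW.
  have := lead x (le_trans xm mr) x0; rewrite (F x x 0) // nx.
  set gx := g _; have -> : x * x * gx - x ^+ 2 = x ^+ 2 * (gx - 1) by ring.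
  have -> : C * m ^+ 3 = m ^+ 2 * (C * m) by ring.
  rewrite nmM nmX nx ler_pM2l ?exprn_gt0 //.
  move=> h; have := S [tuple x; x; 0] (box3 xm xm z0); rewrite -/gx => h'.
  have -> : g (tzero R 3) - 1 = (gx - 1) - (gx - g (tzero R 3)) by ring.
  apply: le_trans (nmB _ _) _; move: h h' Cm; lra.
have [A [B [hA hB hAB]]] := germ_split_last hg g01.
exists A, B; split => //.
apply: small_imp (small_and fac hAB) => e e0 [H1 H2] z y s ze ye se.
by rewrite H1 // H2 //; ring.
Qed.

(** P is a complexified equation: y and o replace the conjugates of z and w.
    The coordinate W and its inverse G straighten the Segre varieties, and phi is
    the graphing function with y in place of the conjugate of z. *)
Theorem normal_form (P : K -> K -> K -> K -> K) (a b : K) :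
  (forall z y w o, (P z y w o)^*%C = P y^*%C z^*%C o^*%C w^*%C) ->
  germ_4 2 (fun z y w o => P z y w o - (w - o) / (2 * 'i%C)) ->
  germ_2 3 (fun z y => P z y 0 0 + z * y - a * z ^+ 2 - b * y ^+ 2) ->
  exists (W G : K -> K -> K) (phi : K -> K -> K -> K) (A : 2.-tuple K -> K)
    (B : 3.-tuple K -> K) (e : R),
  [/\ 0 < e,
      exists C, analytic 1 e C (fun t : 2.-tuple K => W t`_0 t`_1),
      exists C, analytic 1 e C (fun t : 2.-tuple K => G t`_0 t`_1),
      exists C, analytic 1 e C A & exists C, analytic 0 e C B] /\
  [/\ forall z w s, nm z <= e -> nm w <= e -> nm s <= e ->
        (s = W z w <-> w = G z s),
      forall z s, nm z <= e -> nm s <= e ->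
        (P z z^*%C (G z s) (G z s)^*%C = 0 <->
         (complex.Im s)%:C = phi z z^*%C (complex.Re s)%:C),
      forall z (u : R), nm z <= e -> `|u| <= e ->
        (phi z z^*%C u%:C)^*%C = phi z z^*%C u%:C &
      forall z (u : R), nm z <= e -> `|u| <= e ->
        phi z z^*%C u%:C = z * z^*%C + z * z^*%C * A [tuple z; z^*%C]
                       + z * z^*%C * (u%:C * B [tuple z; z^*%C; u%:C])].
Proof.
move=> symP linP quadP.
have [g [gc [g_lin gc_lin g_curve g_conj]]] := transverse_curve symP linP.
have [W [G [W1 G_lin WG G_leaf G_uniq]]] := segre_foliation linP gc_lin.
have fz := straightened_z0 g_lin g_curve g_conj G_leaf G_uniq.
have fy := straightened_0y symP g_lin g_curve g_conj G_leaf G_uniq.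
have [phi [phi2 phz phy ph_sym ph_eq]] :=
  normal_graph symP linP g_lin g_curve g_conj G_lin G_leaf G_uniq.
have lead := graph_leading linP quadP G_lin fz fy phi2 ph_eq.
have [A [B [hA hB hAB]]] := graph_factor phi2 phz phy lead.
have G1 : germ_2 1 G := germ_2_order1 G_lin.
have [e e0 [[[aW aG] [aA aB]] [[WGe sym_e] [eq_e fac_e]]]] := small_ex (small_and
  (small_and (small_and (germ_analytic W1) (germ_analytic G1))
             (small_and (germ_analytic hA) (germ_analytic hB)))
  (small_and (small_and WG ph_sym) (small_and ph_eq hAB))).
exists W, G, phi, A, B, e; split; split => //.
- move=> z s ze se.
  have := eq_e (complex.Im s)%:C z z^*%C (complex.Re s)%:C; rewrite !nm_real nm_conj.
  move=> /(_ (le_trans (Im_le_nm s) se) ze ze (le_trans (Re_le_nm s) se)) <-.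
  rewrite -complexE.
  have -> : (complex.Re s)%:C - 'i%C * (complex.Im s)%:C = s^*%C.
    by rewrite {3}[s]complexE conjD conjM conj_i !conjc_real; ring.
  by rewrite /straightened /conj2 !conjcK.
- move=> z u ze ue; rewrite sym_e ?nm_conj ?nm_real // conjcK conjc_real //.
- by move=> z u ze ue; apply: fac_e; rewrite ?nm_conj ?nm_real.
Qed.

End NormalFormTheorem.

(** * Limits of partial sums and unordered sums *)

Section PowerSeriesSums.
Variable R : realType.
Local Notation K := R[i].

Lemma converges_onP n (c : mindex n -> K) r : converges_on c r <->
  0 < r /\ exists C, forall J : {fset mindex n},
    \sum_(a <- J) nm (c a) * r ^+ mdegree a <= C.
Proof.
split=> -[r0 h]; split => //.
  have fin : (\esum_(a in [set: mindex n])
      (complex.Re `|c a| * r ^+ mdegree a)%:E)%E \is a fin_num.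
    rewrite ge0_fin_numE // esum_ge0 // => a _.
    by rewrite lee_fin mulr_ge0 ?nm_ge0 // exprn_ge0 // ltW.
  exists (fine (\esum_(a in [set: mindex n])
    (complex.Re `|c a| * r ^+ mdegree a)%:E)%E) => J.
  rewrite -lee_fin fineK // -sumEFin; apply: esum_ge.
  exists [set` J] => //=.
  by rewrite -fsbig_seq.
case: h => C hC; apply: (@le_lt_trans _ _ C%:E); last by rewrite ltry.
apply: ge_ereal_sup => _ [A [finA _] <-].
by rewrite fsbig_finite // sumEFin lee_fin.
Qed.

Lemma homogeneous_part_fset n (c : mindex n -> K) d (t : n.-tuple K) :
  exists J : {fset mindex n}, (forall a, (a \in J) = (mdegree a == d)) /\
    homogeneous_part c d t = \sum_(a <- J) c a * monomial t a.
Proof.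
pose emb (b : {ffun 'I_n -> 'I_d.+1}) : mindex n := [ffun i => b i : nat].
have embI : injective emb.
  move=> b b' h; apply/ffunP => i; apply/val_inj.
  by have := congr1 (fun a : mindex n => a i) h; rewrite !ffunE.
pose S := [seq emb b | b <- enum [pred b : {ffun 'I_n -> 'I_d.+1} | (\sum_i b i)%N == d]].
have memS a : (a \in S) = (mdegree a == d).
  apply/mapP/eqP => [[b]|ad].
    rewrite mem_enum inE => /eqP bd ->; rewrite /mdegree -bd.
    by apply: eq_bigr => i _; rewrite ffunE.
  have le_d i : (a i < d.+1)%N.
    by rewrite ltnS -ad /mdegree (bigD1 i) //= leq_addr.
  exists [ffun i => inord (a i)]; last first.
    by apply/ffunP => i; rewrite !ffunE inordK ?le_d.
  rewrite mem_enum inE; apply/eqP; rewrite -[RHS]ad /mdegree.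
  by apply: eq_bigr => i _; rewrite ffunE inordK ?le_d.
exists [fset a in S]%fset; split=> [a|]; first by rewrite inE memS.
transitivity (\sum_(a <- S) c a * monomial t a).
  by rewrite /S big_map big_enum_cond /homogeneous_part; apply: eq_bigl => b; rewrite ?andbT.
apply: perm_big; apply: uniq_perm.
- by rewrite map_inj_uniq // enum_uniq.
- exact: fset_uniq.
- by move=> a; rewrite [in RHS]inE.
Qed.

Lemma partial_sum_fset n (c : mindex n -> K) N (t : n.-tuple K) :
  exists J : {fset mindex n}, (forall a, (a \in J) = (mdegree a < N)%N) /\
    \sum_(d < N) homogeneous_part c d t = \sum_(a <- J) c a * monomial t a.
Proof.
elim: N => [|N [J [memJ IH]]].
  by exists fset0; split => [a|]; rewrite ?inE // big_ord0 big_seq_fset0.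
have [J' [memJ' E]] := homogeneous_part_fset c N t.
exists (J `|` J')%fset; split=> [a|].
  by rewrite in_fsetU memJ memJ' orbC [in RHS]ltnS [in RHS]leq_eqVlt.
rewrite big_ord_recr /= IH E [RHS](big_fset_sub _ (fsubsetUl J J')); congr (_ + _).
apply: eq_fbigl => a; rewrite in_fsetD in_fsetU memJ memJ'.
by case: ltngtP.
Qed.

(** Every finite set of indices is bounded in degree, so unordered convergence
    implies convergence along increasing degree. *)
Lemma psum_has_sum n (c : mindex n -> K) (t : n.-tuple K) s :
  has_sum (fun a => c a * monomial t a) s -> psum c t = s.
Proof.
move=> hs; rewrite /psum; apply: (@cvg_lim (R[i])^o); first exact: norm_hausdorff.
apply/cvgrPdist_le => e; rewrite ltcE /= => /andP[/eqP e1 e2].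
have {e1}-> : e = (complex.Re e)%:C by case: e e1 {e2} => x y /= ->.
have [J hJ] := hs _ e2.
exists (\sum_(a <- J) mdegree a).+1 => // N /= hN.
have [J' [memJ' ->]] := partial_sum_fset c N t.
rewrite distrC nmE lecR; apply: hJ; apply/fsubsetP => a aJ; rewrite memJ'.
by apply: leq_trans hN; rewrite ltnS (big_fsetD1 a) //= leq_addr.
Qed.

Lemma analytic_psum n k r C (f : n.-tuple K -> K) : analytic k r C f ->
  exists c, [/\ converges_on c r, bigO_order k c & forall t, box r t -> f t = psum c t].
Proof.
case=> r0 [c [c1 c2 c3]]; exists c; split => //.
  by apply/converges_onP; split => //; exists C.
by move=> t /c3/psum_has_sum.
Qed.

Lemma psum_analytic n (c : mindex n -> K) r : converges_on c r ->
  exists C, analytic 0 r C (psum c).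
Proof.
move=> /converges_onP[r0 [C hC]]; exists C; split => //; exists c; split => // t tr.
have [s hs] := has_sum_exists (coef_abs_bounded hC tr).
by rewrite (psum_has_sum hs).
Qed.

Lemma nm_pair_lt (h : C2 R) r : (`|h| < r%:C) = (nm h.1 < r) && (nm h.2 < r).
Proof.
rewrite prod_normE /= !nmE /Order.max ltcR; case: ltP => h12; rewrite ltcR.
  by rewrite andb_idl // => /(lt_trans h12).
by rewrite andb_idr // => /(le_lt_trans h12).
Qed.

Lemma C2_openP (A : set (C2 R)) : open A <-> forall p, A p ->
  exists2 e : R, 0 < e & forall q, nm (q.1 - p.1) < e -> nm (q.2 - p.2) < e -> A q.
Proof.
rewrite openE; split=> h p /h.
  rewrite /interior => /nbhs_normP[e /=]; rewrite ltcE /= => /andP[/eqP e1 e2].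
  have -> : e = (complex.Re e)%:C by case: e e1 {e2} => x y /= ->.
  move=> H; exists (complex.Re e) => // q q1 q2; apply: H => /=.
  by rewrite nm_pair_lt /= (nm_distC p.1) (nm_distC p.2) q1 q2.
move=> [e e0 H]; suff : \forall q \near p, A q by [].
apply/nbhs_normP; exists e%:C => /=; first by rewrite ltcR.
move=> q; rewrite /ball_ /= nm_pair_lt /= (nm_distC p.1) (nm_distC p.2) => /andP[q1 q2].
exact: H.
Qed.

Lemma germ_holomorphic (f : C2 R -> K) (p : C2 R) :
  germ 0 (fun t : 2.-tuple K => f (p + (t`_0 : K^o, t`_1 : K^o))) -> holomorphic_at f p.
Proof.
move=> [r [C /analytic_psum[c [c1 _ c2]]]]; exists c, r; split => // h.
rewrite nm_pair_lt => /andP[h1 h2]; rewrite -c2; first by case: h {h1 h2}.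
exact: box2 (ltW h1) (ltW h2).
Qed.

Lemma germ_real_analytic (f : C2 R -> K) (p : C2 R) (g : 4.-tuple K -> K) r :
  0 < r -> germ 0 g ->
  (forall h, (forall k, `|tnth h k| <= r) ->
     f (real_translate p h) = g (map_tuple (real_complex R) h)) ->
  real_analytic_at f p.
Proof.
move=> r0 [r' [C ag]] fg; have r'0 := analytic_gt0 ag.
have m0 : 0 < Num.min r r' by rewrite lt_min r0.
have mr : Num.min r r' <= r' by rewrite ge_min lexx orbT.
have [c [c1 _ c2]] := analytic_psum (analytic_ler m0 mr ag).
exists c, (Num.min r r'); split => // h hh; rewrite fg; last first.
  by move=> k; have := ltW (hh k); rewrite le_min => /andP[].
by rewrite c2 // => k; rewrite tnth_map nm_real ltW.
Qed.

Lemma real_analytic_germ (f : C2 R -> K) (p : C2 R) : real_analytic_at f p ->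
  exists r C g, analytic 0 r C g /\ forall h, (forall k, `|tnth h k| <= r) ->
     f (real_translate p h) = g (map_tuple (real_complex R) h).
Proof.
move=> [c [r [hc fc]]]; have [C ac] := psum_analytic hc; have r0 := analytic_gt0 ac.
have r2 : 0 < r / 2 by rewrite divr_gt0.
exists (r / 2), C, (psum c); split.
  by apply: analytic_ler ac => //; rewrite ler_pdivrMr // ler_peMr ?ltW // ltr1n.
move=> h hh; apply: fc => k; apply: le_lt_trans (hh k) _.
by rewrite ltr_pdivrMr // ltr_pMr // ltr1n.
Qed.

End PowerSeriesSums.

(** * Jets of real analytic functions *)

Section Taylor.
Variable R : realType.
Local Notation K := R[i].

Definition zero_on n (s : seq 'I_n) (t : n.-tuple K) : n.-tuple K :=
  [tuple if j \in s then 0 else tnth t j | j < n].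

(** Hadamard's lemma, by dividing by the variables one after the other; the last
    remainder is the value at the origin. *)
Lemma germ_hadamard n k (f : n.-tuple K -> K) : germ k.+1 f ->
  exists g : 'I_n -> n.-tuple K -> K, (forall i, germ k (g i)) /\
    exists2 r, 0 < r & forall t, box r t -> f t = \sum_i tnth t i * g i t.
Proof.
move=> hf; have [r [C af]] := hf; have r0 := analytic_gt0 af.
have H (s : seq 'I_n) : uniq s -> exists g : 'I_n -> n.-tuple K -> K,
    [/\ forall i, germ k (g i), analytic k.+1 r C (fun t => f (zero_on s t)) &
     forall t, box r t -> f t = f (zero_on s t) + \sum_(i <- s) tnth t i * g i t].
  elim: s => [_|i s IH /= /andP[ins us]].
    have z0 t : zero_on [::] t = t.
      by apply: eq_from_tnth => j; rewrite tnth_mktuple.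
    exists (fun _ _ => 0); split => [i||t tr]; first exact: germ0.
      by apply: analytic_ext af => t _; rewrite z0.
    by rewrite z0 big_nil addr0.
  have [g [hg az e]] := IH us; have [q [aq azq eq]] := analytic_split i az.
  have zi t : zero_on s (zero_at i t) = zero_on (i :: s) t.
    apply: eq_from_tnth => j; rewrite !tnth_mktuple inE.
    by case: (j \in s); case: (j == i).
  exists (fun j => if j == i then q else g j); split.
  - by move=> j; case: eqP => // _; exists r, (C / r).
  - by apply: analytic_ext azq => t _; rewrite zi.
  - move=> t tr; rewrite (e t tr) (eq t tr) zi big_cons eqxx -addrA.
    congr (_ + (_ + _)); rewrite big_seq [RHS]big_seq; apply: eq_bigr => j js.
    by case: eqP => // ji; move: ins; rewrite -ji js.
have [g [hg _ e]] := H (enum 'I_n) (enum_uniq _).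
exists g; split=> //; exists r => // t tr.
rewrite (e t tr) (_ : zero_on _ t = tzero R n); last first.
  by apply: eq_from_tnth => j; rewrite !tnth_mktuple mem_enum.
by rewrite (germ_at0 (germ_lek _ hf)) // add0r big_enum.
Qed.

Lemma germ_jet0 n (f : n.-tuple K -> K) : germ 0 f -> germ 1 (fun t => f t - f (tzero R n)).
Proof.
by move=> hf; apply: germ_order1; [apply: germB => //; apply: germ_cst|rewrite subrr].
Qed.

Lemma germ_jet1 n (f : n.-tuple K -> K) : germ 1 f ->
  exists l : 'I_n -> K, germ 2 (fun t => f t - \sum_i l i * tnth t i).
Proof.
move=> /germ_hadamard[g [hg [r r0 e]]]; exists (fun i => g i (tzero R n)).
have h (i : 'I_n) : germ 2 (fun t => tnth t i * (g i t - g i (tzero R n))).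
  exact: germM (germ_X _ _) (germ_jet0 (hg i)).
apply: germ_ext r0 _ (germ_sum (index_enum 'I_n) h) => t tr.
rewrite (e t tr) -sumrB; apply: eq_bigr => i _; ring.
Qed.

Lemma germ_jet2 n (f : n.-tuple K -> K) : germ 1 f ->
  exists (l : 'I_n -> K) (b : 'I_n -> 'I_n -> K),
    germ 3 (fun t => f t - (\sum_i l i * tnth t i +
      \sum_i \sum_j b i j * (tnth t i * tnth t j))).
Proof.
move=> /germ_jet1[l /germ_hadamard[g [hg [r r0 e]]]].
have hb i : exists b : 'I_n -> K, germ 2 (fun t => g i t - \sum_j b j * tnth t j).
  exact: germ_jet1.
have [b {}hb] := choice hb; exists l, b.
have h (i : 'I_n) : germ 3 (fun t => tnth t i * (g i t - \sum_j b i j * tnth t j)).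
  exact: germM (germ_X _ _) (hb i).
apply: germ_ext r0 _ (germ_sum (index_enum 'I_n) h) => t tr.
rewrite opprD addrA (e t tr) -sumrB; apply: eq_bigr => i _.
rewrite mulrBr mulr_sumr; congr (_ - _); apply: eq_bigr => j _; ring.
Qed.

Definition shift n (k : 'I_n) (s : K) (t : n.-tuple K) : n.-tuple K :=
  [tuple tnth t j + (if j == k then s else 0) | j < n].

(** Partial derivatives lower the order of vanishing by one: they are the
    constant terms in s of the divided differences. *)
Lemma germ_partial n k (f : n.-tuple K -> K) i : germ k f ->
  exists D r C, [/\ germ k.-1 D, 0 < r, 0 <= C & forall t s, box r t -> nm s <= r ->
    nm (f (shift i s t) - f t - s * D t) <= C * nm s ^+ 2].
Proof.
move=> hf.
have hx j : germ 1 (fun t : n.+1.-tuple K =>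
    tnth t (lift ord0 j) + (if j == i then tnth t ord0 else 0)).
  by apply: germD; [exact: germ_X|case: eqP => _; [exact: germ_X|exact: germ0]].
have [r [C aF]] := germ_comp hf hx; have r0 := analytic_gt0 aF.
have [q [aq _ e]] := analytic_split ord0 aF.
have FE s t : mktuple ((fun j (t : n.+1.-tuple K) =>
    tnth t (lift ord0 j) + (if j == i then tnth t ord0 else 0))^~ (tcons s t)) =
    shift i s t.
  by apply: eq_from_tnth => j; rewrite !tnth_mktuple tcons0 tconsS.
have z0 s (t : n.-tuple K) : zero_at ord0 (tcons s t) = tcons 0 t.
  apply: eq_from_tnth => j; rewrite tnth_mktuple.
  by case: (unliftP ord0 j) => [j'|] ->; rewrite ?eqxx ?tcons0 // !tconsS.
have shift0 t : shift i 0 t = t.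
  by apply: eq_from_tnth => j; rewrite tnth_mktuple; case: eqP; rewrite addr0.
have hq : germ k.-1 q by exists r, (C / r).
have [r1 [C1 [r10 C10 lip]]] := germ_lip (ltn0Sn 0) (germ_jet0 (germ_lek (leq0n _) hq)).
have hD : germ k.-1 (fun t => q (tcons 0 t)).
  have hz j : germ 1 ((fun j => if unlift ord0 j is Some j' then (fun t : n.-tuple K => tnth t j')
      else fun=> 0) j).
    by case: unlift => [j'|]; [exact: germ_X|exact: germ0].
  apply: germ_eq (germ_comp hq hz) => t; rewrite -[in RHS](mktuple_tnth t).
  by rewrite (tcons_mktuple (fun=> 0) (fun j t => tnth t j)).
exists (fun t => q (tcons 0 t)), (Num.min r r1), C1; split => //.
  by rewrite lt_min r0.
move=> t s tr; rewrite le_min => /andP[sr sr1].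
have box_tcons (u : R) y : box u t -> nm y <= u -> box u (tcons y t).
  move=> tu yu j; case: (unliftP ord0 j) => [j'|] ->; first by rewrite tconsS.
  by rewrite tcons0.
have tr' : box r t by apply: box_le tr; rewrite ge_min lexx.
have tr1 : box r1 t by apply: box_le tr; rewrite ge_min lexx orbT.
have := e (tcons s t) (box_tcons _ _ tr' sr); rewrite z0 !FE shift0 tcons0 => ->.
have -> : f t + s * q (tcons s t) - f t - s * q (tcons 0 t) =
  s * ((q (tcons s t) - q (tzero R n.+1)) - (q (tcons 0 t) - q (tzero R n.+1))) by ring.
rewrite nmM expr2 mulrCA; apply: ler_wpM2l; first exact: nm_ge0.
have n0 : nm (0 : K) <= r1 by rewrite nm0 ltW.
have := lip (tcons s t) (tcons 0 t) r1 (nm s) (lexx _) (ltW r10) (nm_ge0 s)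
  (box_tcons _ _ tr1 sr1) (box_tcons _ _ tr1 n0).
rewrite expr0 mulr1; apply=> j.
case: (unliftP ord0 j) => [j'|] ->; first by rewrite !tconsS subrr nm0 nm_ge0.
by rewrite !tcons0 subr0.
Qed.

(** A quantitative form of differentiability at p in the direction of index k,
    stable under linear combinations. *)
Definition has_partial k (F : C2 R -> R) p d := exists r C, 0 < r /\
  forall t : R, `|t| <= r ->
    `|F (p + t%:C *: real_basis R k) - F p - t * d| <= C * t ^+ 2.

Lemma has_partialP k F p d : has_partial k F p d -> partial k F p = d.
Proof.
move=> [r [C [r0 H]]]; rewrite /partial /derive1.
apply: (@cvg_lim R); first exact: norm_hausdorff.
apply/cvgrPdist_le => e e0.
have C0 : 0 <= C.
  have := H r; rewrite ger0_norm ?(ltW r0) // lexx => /(_ isT).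
  by move=> /(le_trans (normr_ge0 _)); rewrite pmulr_lge0 // exprn_gt0.
have C1 : 0 < C + 1 by rewrite ltr_wpDl.
near=> t.
have t0 : t != 0 by near: t; exact: nbhs_dnbhs_neq.
have tr : `|t| <= r by near: t; apply: dnbhs0_le.
have te : `|t| <= e / (C + 1) by near: t; apply: dnbhs0_le; rewrite divr_gt0.
have := H t tr; rewrite addr0 scale0r addr0.
set X := F _; set Y := F p => h.
have -> : d - t^-1 *: (X - Y) = - (t^-1 * (X - Y - t * d)).
  by rewrite /GRing.scale /=; field.
rewrite normrN normrM normfV ler_pdivrMl ?normr_gt0 //; apply: le_trans h _.
rewrite -normr_id -[t ^+ 2]ger0_norm ?sqr_ge0 // normrX normr_id expr2 mulrCA.
rewrite ler_wpM2l //; apply: le_trans (ler_wpM2l C0 te) _.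
rewrite mulrCA ler_piMr ?(ltW e0) // ler_pdivrMr // mul1r lerDl ler01 //.
Unshelve. all: by end_near. Qed.

Lemma has_partial_ext k F G p d : F =1 G -> has_partial k F p d -> has_partial k G p d.
Proof.
move=> FG [r [C [r0 H]]]; exists r, C; split => // t tr.
by rewrite -!FG; apply: H.
Qed.

Lemma has_partialZ k F p d c :
  has_partial k F p d -> has_partial k (fun q => c * F q) p (c * d).
Proof.
move=> [r [C [r0 H]]]; exists r, (`|c| * C); split => // t tr.
rewrite mulrCA -!mulrBr normrM -mulrA; apply: ler_wpM2l => //; exact: H.
Qed.

Lemma has_partialD k F G p d e : has_partial k F p d -> has_partial k G p e ->
  has_partial k (fun q => F q + G q) p (d + e).
Proof.
move=> [r [C [r0 H]]] [r' [C' [r'0 H']]].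
exists (Num.min r r'), (C + C'); split; first by rewrite lt_min r0.
move=> t; rewrite le_min => /andP[tr tr'].
rewrite mulrDl; apply: le_trans (lerD (H t tr) (H' t tr')).
by apply: le_trans (ler_normD _ _); rewrite le_eqVlt; apply/orP; left; apply/eqP;
   congr `|_|; ring.
Qed.

Lemma has_partial_sum (I : Type) (s : seq I) k (F : I -> C2 R -> R) p (d : I -> R) :
  (forall i, has_partial k (F i) p (d i)) ->
  has_partial k (fun q => \sum_(i <- s) F i q) p (\sum_(i <- s) d i).
Proof.
move=> h; elim: s => [|i s IH].
  rewrite big_nil; exists 1, 0; split => // t _.
  by rewrite !big_nil mulr0 !subr0 normr0 mul0r.
by rewrite big_cons; apply: has_partial_ext (has_partialD (h i) IH) => q; rewrite big_cons.
Qed.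

Lemma cpartial_sum k (n : nat) (c : 'I_n -> K) (F : 'I_n -> C2 R -> R) p (d : 'I_n -> R) :
  (forall i, has_partial k (F i) p (d i)) ->
  cpartial k (fun q => \sum_i c i * (F i q)%:C) p = \sum_i c i * (d i)%:C.
Proof.
move=> h.
have ReE (x : 'I_n -> R) : complex.Re (\sum_i c i * (x i)%:C) = \sum_i complex.Re (c i) * x i.
  rewrite (raddf_sum (@complex.Re R : Rcomplex R -> R)); apply: eq_bigr => i _.
  by case: (c i) => u v /=; simpc.
have ImE (x : 'I_n -> R) : complex.Im (\sum_i c i * (x i)%:C) = \sum_i complex.Im (c i) * x i.
  rewrite (raddf_sum (@complex.Im R : Rcomplex R -> R)); apply: eq_bigr => i _.
  by case: (c i) => u v /=; simpc.
rewrite /cpartial.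
rewrite (@has_partialP _ _ _ (\sum_i complex.Re (c i) * d i)); last first.
  apply: has_partial_ext (has_partial_sum _ (fun i => has_partialZ (complex.Re (c i)) (h i))).
  by move=> q; rewrite ReE.
rewrite (@has_partialP _ _ _ (\sum_i complex.Im (c i) * d i)); last first.
  apply: has_partial_ext (has_partial_sum _ (fun i => has_partialZ (complex.Im (c i)) (h i))).
  by move=> q; rewrite ImE.
by rewrite -ReE -ImE; case: (\sum_i _).
Qed.

Definition rshift (k : 'I_4) (s : R) (h : 4.-tuple R) : 4.-tuple R :=
  [tuple tnth h j + (if j == k then s else 0) | j < 4].

Lemma real_translate_shift p h k (s : R) :
  real_translate p h + s%:C *: real_basis R k = real_translate p (rshift k s h).
Proof.
rewrite /real_translate -addrA; congr (_ + _).
under [RHS]eq_bigr do rewrite tnth_mktuple rmorphD scalerDl.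
rewrite big_split /=; congr (_ + _); rewrite (bigD1 k) //= eqxx big1 ?addr0 //.
by move=> j /negbTE ->; rewrite scale0r.
Qed.

Lemma map_rshift k (s : R) h :
  map_tuple (real_complex R) (rshift k s h) = shift k s%:C (map_tuple (real_complex R) h).
Proof.
apply: eq_from_tnth => j; rewrite tnth_map !tnth_mktuple rmorphD tnth_map.
by case: eqP.
Qed.

Lemma real_translate0 (p : C2 R) : real_translate p [tuple 0 | i < 4] = p.
Proof.
rewrite /real_translate big1 ?addr0 // => k _.
by rewrite tnth_mktuple scale0r.
Qed.

(** At real points the real part of a series is half its sum with the conjugate
    series, so it is analytic again. *)
Lemma real_analytic_partial (rho : C2 R -> R) p k :
  real_analytic_at (fun q => (rho q)%:C) p ->
  real_analytic_at (fun q => (partial k rho q)%:C) p.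
Proof.
move=> /real_analytic_germ[r [C [f [af ff]]]]; have r0 := analytic_gt0 af.
have [D [r1 [C1 [hD r10 C10 H]]]] := germ_partial k (ex_intro _ r (ex_intro _ C af) : germ 0 f).
pose r2 := Num.min (r / 2) r1.
have r20 : 0 < r2 by rewrite lt_min r10 divr_gt0.
have r2r : r2 <= r / 2 by rewrite /r2 ge_min lexx.
have r2r1 : r2 <= r1 by rewrite /r2 ge_min lexx orbT.
have hR : germ 0 (fun t => 2^-1 * (D t + (D (map_tuple (@conjc R) t))^*%C)).
  by apply: germZ; apply: germD => //; apply: germ_conj.
apply: (germ_real_analytic r20 hR) => h hh.
have conjh : map_tuple (@conjc R) (map_tuple (real_complex R) h) = map_tuple (real_complex R) h.
  by apply: eq_from_tnth => j; rewrite !tnth_map conjc_real.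
rewrite conjh addcJ mulrA mulVf ?pnatr_eq0 // mul1r; congr _%:C.
apply: has_partialP; exists r2, C1; split => // t tr.
have bh : box r1 (map_tuple (real_complex R) h).
  by move=> j; rewrite tnth_map nm_real; apply: le_trans (hh j) r2r1.
have bt : nm (t%:C : K) <= r1 by rewrite nm_real; apply: le_trans r2r1.
have := H _ _ bh bt; rewrite -map_rshift -!ff => [||j]; last first.
- rewrite tnth_mktuple; apply: le_trans (ler_normD _ _) _.
  have := le_trans (hh j) r2r; case: eqP => _; have := le_trans tr r2r; rewrite ?normr0; lra.
- move=> j; apply: le_trans (hh j) _; apply: le_trans r2r _.
  by rewrite ler_pdivrMr // ler_peMr ?(ltW r0) // ler1n.
rewrite -real_translate_shift nm_real real_normK ?num_real //.
apply: le_trans; apply: le_trans (Re_le_nm _).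
by case: (D _) => u v /=; simpc; rewrite /= ?mul0r ?subr0.
Qed.

End Taylor.

Section RealJet.
Variable R : realType.
Local Notation K := R[i].

(** Averaging a series with the conjugate series makes its coefficients real
    without changing the real values. *)
Lemma real_jet (rho : C2 R -> R) :
  real_analytic_at (fun q => (rho q)%:C) 0 -> rho 0 = 0 ->
  exists (f : 4.-tuple K -> K) (l : 'I_4 -> R) (b : 'I_4 -> 'I_4 -> R) (r : R),
  [/\ 0 < r, forall t, (f (map_tuple (@conjc R) t))^*%C = f t,
    forall h, (forall k, `|tnth h k| <= r) ->
      (rho (real_translate 0 h))%:C = f (map_tuple (real_complex R) h) &
    germ 3 (fun t => f t - (\sum_i (l i)%:C * tnth t i +
      \sum_i \sum_j (b i j)%:C * (tnth t i * tnth t j)))].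
Proof.
move=> /real_analytic_germ[r [C [g [ag gg]]]] rho0; have r0 := analytic_gt0 ag.
have mapR0 : map_tuple (real_complex R) [tuple 0 | i < 4] = tzero R 4.
  by apply: eq_from_tnth => i; rewrite tnth_map !tnth_mktuple.
have g1 : germ 1 g.
  apply: germ_order1; first by exists r, C.
  rewrite -mapR0 -gg ?real_translate0 ?rho0 // => k.
  by rewrite tnth_mktuple normr0 ltW.
have [l [b hlb]] := germ_jet2 g1.
have halfRe (x : K) : 2^-1 * (x + x^*%C) = (complex.Re x)%:C.
  by rewrite addcJ mulrA mulVf ?mul1r // pnatr_eq0.
exists (fun t => 2^-1 * (g t + (g (map_tuple (@conjc R) t))^*%C)),
  (fun i => complex.Re (l i)), (fun i j => complex.Re (b i j)), r; split => //.
- move=> t; have -> : map_tuple (@conjc R) (map_tuple (@conjc R) t) = t.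
    by apply: eq_from_tnth => i; rewrite !tnth_map conjcK.
  by rewrite conjM conjD conjcK conjc_inv conjc_nat addrC.
- move=> h hh.
  have -> : map_tuple (@conjc R) (map_tuple (real_complex R) h) = map_tuple (real_complex R) h.
    by apply: eq_from_tnth => j; rewrite !tnth_map conjc_real.
  by rewrite halfRe -gg.
- apply: germ_eq (germZ 2^-1 (germD hlb (germ_conj hlb))) => t.
  rewrite conjD conjN conjD !rmorph_sum /=.
  have E1 : \sum_i (complex.Re (l i))%:C * tnth t i =
      2^-1 * (\sum_i l i * tnth t i + \sum_i (l i * tnth (map_tuple (@conjc R) t) i)^*%C).
    rewrite -big_split /= mulr_sumr; apply: eq_bigr => i _.
    by rewrite tnth_map conjM conjcK -halfRe; ring.
  have E2 : \sum_i \sum_j (complex.Re (b i j))%:C * (tnth t i * tnth t j) =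
      2^-1 * (\sum_i \sum_j b i j * (tnth t i * tnth t j) +
      \sum_i (\sum_j b i j * (tnth (map_tuple (@conjc R) t) i *
         tnth (map_tuple (@conjc R) t) j))^*%C).
    rewrite -big_split /= mulr_sumr; apply: eq_bigr => i _.
    rewrite rmorph_sum -big_split /= mulr_sumr; apply: eq_bigr => j _.
    by rewrite !tnth_map !conjM !conjcK -halfRe; ring.
  by rewrite E1 E2; ring.
Qed.

Lemma sum_delta n (k : 'I_n) (F : 'I_n -> K) s :
  \sum_i F i * (if i == k then s else 0) = F k * s.
Proof.
rewrite (bigD1 k) //= eqxx big1 ?addr0 // => i /negbTE ->.
by rewrite mulr0.
Qed.

Section Partials.
Variables (rho : C2 R -> R) (f : 4.-tuple K -> K) (l : 'I_4 -> R)
  (b : 'I_4 -> 'I_4 -> R) (r : R).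
Hypothesis r0 : 0 < r.
Hypothesis rho_f : forall h, (forall k, `|tnth h k| <= r) ->
      (rho (real_translate 0 h))%:C = f (map_tuple (real_complex R) h).
Hypothesis f_jet : germ 3 (fun t => f t - (\sum_i (l i)%:C * tnth t i +
      \sum_i \sum_j (b i j)%:C * (tnth t i * tnth t j))).

(** The remainder of order 3 has partial derivatives of order 2, which leaves
    the jet of the partial derivatives of rho. *)
Lemma partial_near k : exists D r1, [/\ germ 2 D, 0 < r1 &
  forall h, (forall j, `|tnth h j| <= r1) ->
  has_partial k rho (real_translate 0 h)
    (complex.Re ((l k)%:C + \sum_j ((b k j)%:C + (b j k)%:C) * (tnth h j)%:C +
        D (map_tuple (real_complex R) h)))].
Proof.
have [D [r1 [C [hD r10 C0 H]]]] := germ_partial k f_jet.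
pose r2 := Num.min (r / 2) r1.
have r20 : 0 < r2 by rewrite /r2 lt_min r10 divr_gt0.
have r2r : r2 <= r / 2 by rewrite /r2 ge_min lexx.
have r2r1 : r2 <= r1 by rewrite /r2 ge_min lexx orbT.
exists D, r2; split => // h hh; exists r2, (C + `|b k k|); split => // t tr.
set hC := map_tuple _ h.
have bh : box r1 hC.
  by move=> j; rewrite tnth_map nm_real; apply: le_trans (hh j) r2r1.
have bt : nm (t%:C : K) <= r1 by rewrite nm_real; apply: le_trans r2r1.
have := H _ _ bh bt; set E := (X in X - _ - _) => hE.
set X := _ + D hC; set hs := rshift k t h.
have e1 : (rho (real_translate 0 hs))%:C = f (shift k t%:C hC).
  rewrite rho_f ?map_rshift // => j.
  rewrite tnth_mktuple; apply: le_trans (ler_normD _ _) _.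
  have := le_trans (hh j) r2r; case: eqP => _; have := le_trans tr r2r; rewrite ?normr0; lra.
have e2 : (rho (real_translate 0 h))%:C = f hC.
  rewrite rho_f // => j; apply: le_trans (hh j) _; apply: le_trans r2r _.
  by rewrite ler_pdivrMr // ler_peMr ?(ltW r0) // ler1n.
rewrite real_translate_shift -/hs.
have -> : rho (real_translate 0 hs) - rho (real_translate 0 h) - t * complex.Re X =
    complex.Re (f (shift k t%:C hC) - f hC - t%:C * X).
  by rewrite -e1 -e2; case: X => u v /=; simpc; rewrite /= ?mul0r ?subr0.
apply: le_trans (Re_le_nm _) _.
have S1 : \sum_i (l i)%:C * tnth (shift k t%:C hC) i =
    \sum_i (l i)%:C * tnth hC i + (l k)%:C * t%:C.
  under eq_bigr do rewrite tnth_mktuple mulrDr.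
  by rewrite big_split /= sum_delta.
have S2 : \sum_i \sum_j (b i j)%:C * (tnth (shift k t%:C hC) i * tnth (shift k t%:C hC) j) =
    \sum_i \sum_j (b i j)%:C * (tnth hC i * tnth hC j) +
    t%:C * \sum_j ((b k j)%:C + (b j k)%:C) * (tnth h j)%:C + (b k k)%:C * t%:C ^+ 2.
  pose d j : K := if j == k then t%:C else 0.
  have -> : \sum_i \sum_j (b i j)%:C * (tnth (shift k t%:C hC) i * tnth (shift k t%:C hC) j) =
    \sum_i (\sum_j (b i j)%:C * (tnth hC i * tnth hC j) + \sum_j ((b i j)%:C * tnth hC i) * d j +
      (\sum_j (b i j)%:C * tnth hC j) * d i + (\sum_j (b i j)%:C * d j) * d i).
    apply: eq_bigr => i _; rewrite !mulr_suml -!big_split /=.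
    by apply: eq_bigr => j _; rewrite !tnth_mktuple -/(d i) -/(d j); ring.
  rewrite !big_split /= !sum_delta -!addrA; congr (_ + _).
  under eq_bigr do rewrite sum_delta.
  under [X in t%:C * X]eq_bigr do rewrite mulrDl.
  have hCE j : (tnth h j)%:C = tnth hC j by rewrite tnth_map.
  rewrite big_split /= (eq_bigr _ (fun j _ => congr1 (fun y => (b k j)%:C * y) (hCE j))).
  rewrite [X in t%:C * (_ + X)](eq_bigr _ (fun j _ => congr1 (fun y => (b j k)%:C * y) (hCE j))).
  rewrite -mulr_suml; ring.
have -> : f (shift k t%:C hC) - f hC - t%:C * X = (E - (f hC - (\sum_i (l i)%:C * tnth hC i +
      \sum_i \sum_j (b i j)%:C * (tnth hC i * tnth hC j))) - t%:C * D hC) + (b k k)%:C * t%:C ^+ 2.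
  by rewrite /E /X S1 S2; ring.
apply: le_trans (nmD _ _) _; rewrite mulrDl; apply: lerD.
  by move: hE; rewrite nm_real real_normK ?num_real.
by rewrite nmM nmX !nm_real real_normK ?num_real.
Qed.

Lemma partial_jet k : has_partial k rho 0 (l k).
Proof.
have [D [r1 [hD r10 H]]] := partial_near k.
have := H [tuple 0 | i < 4]; rewrite real_translate0.
rewrite (_ : map_tuple _ _ = tzero R 4); last first.
  by apply: eq_from_tnth => i; rewrite tnth_map !tnth_mktuple.
rewrite (germ_at0 (germ_lek _ hD)) // big1 => [|j _]; last by rewrite tnth_mktuple mulr0.
by rewrite !addr0; apply => j; rewrite tnth_mktuple normr0 ltW.
Qed.

Lemma hessian_jet j k : has_partial j (partial k rho) 0 (b k j + b j k).
Proof.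
have [D [r1 [hD r10 H]]] := partial_near k.
have [r2 [C [r20 C0 bd]]] := germ_bound hD.
pose h0 : 4.-tuple R := [tuple 0 | i < 4].
have mapR0 : map_tuple (real_complex R) h0 = tzero R 4.
  by apply: eq_from_tnth => i; rewrite tnth_map !tnth_mktuple.
have D0 : D (tzero R 4) = 0 by apply: germ_at0; apply: germ_lek hD.
have part (t : R) : `|t| <= r1 -> partial k rho (0 + t%:C *: real_basis R j) =
    l k + t * (b k j + b j k) + complex.Re (D (shift j t%:C (tzero R 4))).
  move=> tr; rewrite -{1}(real_translate0 0) real_translate_shift.
  have := H (rshift j t h0); rewrite map_rshift mapR0.
  have -> : \sum_i ((b k i)%:C + (b i k)%:C) * (tnth (rshift j t h0) i)%:C =
     ((b k j)%:C + (b j k)%:C) * t%:C :> K.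
    rewrite -(@sum_delta 4 j (fun i => (b k i)%:C + (b i k)%:C)); apply: eq_bigr => i _.
    by rewrite !tnth_mktuple add0r; case: eqP.
  move=> H'; rewrite (has_partialP (H' _)).
    by rewrite -!rmorphD -rmorphM; case: (D _) => u v /=; rewrite [t * _]mulrC.
  by move=> i; rewrite !tnth_mktuple add0r; case: eqP; rewrite ?normr0 // ltW.
have shift0 : shift j 0 (tzero R 4) = tzero R 4.
  by apply: eq_from_tnth => i; rewrite !tnth_mktuple; case: eqP; rewrite addr0.
have p0 : partial k rho 0 = l k.
  have := part 0; rewrite normr0 scale0r addr0 mul0r addr0 shift0 D0 addr0.
  by apply; rewrite ltW.
exists (Num.min r1 r2), C; split; first by rewrite lt_min r10.
move=> t; rewrite le_min => /andP[tr1 tr2]; rewrite part // p0.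
set x := D _; have -> : l k + t * (b k j + b j k) + complex.Re x - l k - t * (b k j + b j k) =
  complex.Re x by ring.
apply: le_trans (Re_le_nm _) _; rewrite /x.
have [->|t0] := eqVneq t 0; first by rewrite shift0 D0 nm0 expr0n mulr0.
rewrite -(real_normK (num_real t)); apply: bd => //; first by rewrite normr_gt0.
move=> i; rewrite !tnth_mktuple add0r; case: eqP => _; first by rewrite nm_real.
by rewrite nm0.
Qed.

End Partials.
End RealJet.

(** * The Levi form *)

Section LeviForm.
Variable R : realType.
Local Notation K := R[i].

Definition vec10 (a b : K) : 'rV[K]_4 := a *: d_z R + b *: d_w R.

Lemma vec10E a b k : vec10 a b 0 k =
  [:: a / 2; - 'i%C * a / 2; b / 2; - 'i%C * b / 2]`_k.
Proof.
by rewrite !mxE !(tnth_nth 0); case: k => [[|[|[|[|k]]]]] //= _; ring.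
Qed.

Lemma mem_T10C2 v : v \in T10C2 R <-> exists a b, v = vec10 a b.
Proof.
rewrite /T10C2 span_cons span_seq1; split.
  by move=> /memv_addP[_ /vlineP[a ->] [_ /vlineP[b ->] ->]]; exists a, b.
by move=> [a [b ->]]; apply: memv_add; apply: memvZ; apply: memv_line.
Qed.

Lemma big4 (V : nmodType) (F : 'I_4 -> V) : \sum_i F i =
  F (Ordinal (isT : 0 < 4)%N) + F (Ordinal (isT : 1 < 4)%N) +
  F (Ordinal (isT : 2 < 4)%N) + F (Ordinal (isT : 3 < 4)%N).
Proof.
rewrite !big_ord_recl big_ord0 addr0 !addrA; congr (_ + _ + _ + _);
  by congr F; apply: val_inj.
Qed.

Lemma mem_tangent (rho : C2 R -> R) p (v : 'rV[R]_4) :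
  (v \in tangent rho p) = (\sum_k v 0 k * gradient rho p 0 k == 0).
Proof.
rewrite memv_ker lfunE /=; apply/eqP/eqP => [/matrixP/(_ 0 0)|h].
  by rewrite !mxE => h; rewrite -[RHS]h; apply: eq_bigr => k _; rewrite !mxE.
apply/matrixP => i j; rewrite !mxE -[RHS]h.
by apply: eq_bigr => k _; rewrite !mxE !ord1.
Qed.

(** The real and imaginary parts of a complex solution of a real linear equation
    are real solutions. *)
Lemma mem_CTM (rho : C2 R -> R) p (v : 'rV[K]_4) :
  v \in CTM rho p <-> \sum_k v 0 k * (gradient rho p 0 k)%:C = 0.
Proof.
pose phi := linfun (mulmxr (map_mx (real_complex R) (gradient rho p))^T :
   'rV[K]_4 -> 'rV[K]_1).
have memphi w : (w \in lker phi) = (\sum_k w 0 k * (gradient rho p 0 k)%:C == 0).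
  rewrite memv_ker lfunE /=; apply/eqP/eqP => [/matrixP/(_ 0 0)|h].
    by rewrite !mxE => h; rewrite -[RHS]h; apply: eq_bigr => k _; rewrite !mxE.
  apply/matrixP => i j; rewrite !mxE -[RHS]h.
  by apply: eq_bigr => k _; rewrite !mxE !ord1.
split=> [|h].
  have : (CTM rho p <= lker phi)%VS.
    apply/span_subvP => w /mapP[X /vbasis_mem]; rewrite mem_tangent => /eqP hX ->.
    rewrite memphi; apply/eqP; rewrite -[RHS](rmorph0 (real_complex R)) -hX rmorph_sum.
    by apply: eq_bigr => k _; rewrite !mxE rmorphM.
  by move/subvP => sub /sub; rewrite memphi => /eqP.
have real_mem (u : 'rV[R]_4) : u \in tangent rho p ->
    map_mx (real_complex R) u \in CTM rho p.
  move/coord_vbasis => ->; rewrite map_mx_sum; apply: memv_suml => i _.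
  rewrite map_mxZ; apply: memvZ; apply: memv_span; apply: map_f.
  by rewrite mem_nth // size_tuple.
have re_im (g : K -> R) : (forall x (y : R), g (x * y%:C) = g x * y) -> {morph g : x y / x + y} ->
    g 0 = 0 -> \row_k g (v 0 k) \in tangent rho p.
  move=> gM gD g0; rewrite mem_tangent; apply/eqP.
  transitivity (g (\sum_k v 0 k * (gradient rho p 0 k)%:C)); last by rewrite h.
  rewrite (big_morph g gD g0); apply: eq_bigr => k _.
  by rewrite gM !mxE.
have -> : v = map_mx (real_complex R) (\row_k complex.Re (v 0 k)) +
    'i%C *: map_mx (real_complex R) (\row_k complex.Im (v 0 k)).
  by apply/rowP => k; rewrite !mxE -complexE.
apply: memvD; last apply: memvZ; apply: real_mem; apply: re_im => //.
- by case=> x1 x2 y; simpc.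
- by case=> x1 x2 [y1 y2].
- by case=> x1 x2 y; simpc.
- by case=> x1 x2 [y1 y2].
Qed.

(** When l is the gradient of rho, half of these numbers are the coefficients of
    the field (d rho / dw) d/dz - (d rho / dz) d/dw, which spans the bundle of
    tangent vectors of type (1, 0). *)
Definition coefA (l : 'I_4 -> K) : K :=
  l (Ordinal (isT : 2 < 4)%N) - 'i%C * l (Ordinal (isT : 3 < 4)%N).
Definition coefB (l : 'I_4 -> K) : K :=
  'i%C * l (Ordinal (isT : 1 < 4)%N) - l (Ordinal (isT : 0 < 4)%N).

Lemma coef_eq0 (l : 'I_4 -> R) : coefA (fun k => (l k)%:C) = 0 ->
  coefB (fun k => (l k)%:C) = 0 -> forall k, l k = 0.
Proof.
rewrite /coefA /coefB => /eqP; rewrite eq_complex /= => /andP[/eqP a1 /eqP a2].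
move=> /eqP; rewrite eq_complex /= => /andP[/eqP b1 /eqP b2].
case=> [[|[|[|[|k]]]]] //= hk; rewrite (bool_irrelevance hk isT).
all: move: a1 a2 b1 b2; lra.
Qed.

Lemma vec10_sum a b (l : 'I_4 -> K) :
  \sum_k vec10 a b 0 k * l k = (b * coefA l - a * coefB l) / 2.
Proof. by rewrite big4 !vec10E /coefA /coefB /=; ring. Qed.

(** The matrix of the linear map from gradients to tangent fields. *)
Definition kappa (j m : 'I_4) : K :=
  nth 0 (nth [::] [:: [:: 0; 0; 2^-1; - 'i%C / 2]; [:: 0; 0; - 'i%C / 2; - 2^-1];
    [:: - 2^-1; 'i%C / 2; 0; 0]; [:: 'i%C / 2; 2^-1; 0; 0]] j) m.

Lemma vec10_coef (l : 'I_4 -> K) j :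
  vec10 (coefA l) (coefB l) 0 j = \sum_m kappa j m * l m.
Proof.
rewrite big4 vec10E /kappa /coefA /coefB; have := mulii R.
case: j => [[|[|[|[|j]]]]] //= _ ii; rewrite ?mul0r ?addr0 ?add0r; ring: ii.
Qed.

Definition tangent_field (rho : C2 R -> R) (p : C2 R) : 'rV[K]_4 :=
  vec10 (coefA (fun k => (partial k rho p)%:C)) (coefB (fun k => (partial k rho p)%:C)).

Lemma tangent_fieldE rho p j :
  tangent_field rho p 0 j = \sum_m kappa j m * (partial m rho p)%:C.
Proof. exact: vec10_coef. Qed.

Lemma gradient_neq0 rho p : gradient rho p != 0 ->
  (coefA (fun k => (partial k rho p)%:C) != 0) ||
  (coefB (fun k => (partial k rho p)%:C) != 0).
Proof.
apply: contraNT; rewrite negb_or !negbK => /andP[/eqP a0 /eqP b0].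
by apply/eqP/rowP => k; rewrite !mxE (coef_eq0 a0 b0).
Qed.

Lemma proportional (A B a b : K) : (A != 0) || (B != 0) -> b * A - a * B = 0 ->
  exists m, a = m * A /\ b = m * B.
Proof.
move=> /orP[n0|n0] /eqP; rewrite subr_eq0 => /eqP e.
  by exists (a / A); split; [rewrite divfK|rewrite mulrAC -e mulfK].
by exists (b / B); split; [rewrite mulrAC e mulfK|rewrite divfK].
Qed.

Lemma T10M_basis rho p : gradient rho p != 0 ->
  basis_of (T10M rho p) [:: tangent_field rho p].
Proof.
move=> /gradient_neq0; set A := coefA _; set B := coefB _ => AB.
have gE (v : 'rV[K]_4) : \sum_k v 0 k * (gradient rho p 0 k)%:C =
    \sum_k v 0 k * (partial k rho p)%:C.
  by apply: eq_bigr => k _; rewrite mxE.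
have L0 : tangent_field rho p != 0.
  apply: contraTneq AB => /rowP h.
  have := h (Ordinal (isT : 0 < 4)%N); have := h (Ordinal (isT : 2 < 4)%N).
  rewrite !vec10E !mxE /= => /eqP; rewrite mulf_eq0 invr_eq0 pnatr_eq0 orbF => /eqP hB.
  move=> /eqP; rewrite mulf_eq0 invr_eq0 pnatr_eq0 orbF => /eqP hA.
  by rewrite /A /B hA hB eqxx.
rewrite basisEfree seq1_free L0 span_seq1 /=.
have inT : (<[tangent_field rho p]> <= T10M rho p)%VS.
  rewrite -memvE memv_cap; apply/andP; split; first by apply/mem_T10C2; exists A, B.
  by apply/mem_CTM; rewrite gE vec10_sum; ring.
have Tin : (T10M rho p <= <[tangent_field rho p]>)%VS.
  apply/subvP => v; rewrite memv_cap => /andP[/mem_T10C2[a [b ->]] /mem_CTM].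
  rewrite gE vec10_sum => /eqP; rewrite mulf_eq0 invr_eq0 pnatr_eq0 orbF => /eqP.
  move=> /(proportional AB)[m [-> ->]]; apply/vlineP; exists m.
  by rewrite /tangent_field /vec10 scalerDr !scalerA.
rewrite inT /=; apply: leq_trans (dimvS Tin) _.
by rewrite dim_vline L0.
Qed.

Lemma real_analytic_sum n (c : 'I_n -> K) (F : 'I_n -> C2 R -> R) p :
  (forall i, real_analytic_at (fun q => (F i q)%:C) p) ->
  real_analytic_at (fun q => \sum_i c i * (F i q)%:C) p.
Proof.
move=> h.
have H i : exists g : 4.-tuple K -> K, germ 0 g /\ exists2 r, 0 < r &
    forall r', 0 < r' -> r' <= r -> forall h, (forall k, `|tnth h k| <= r') ->
    (F i (real_translate p h))%:C = g (map_tuple (real_complex R) h).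
  have [r [C [g [ag gg]]]] := real_analytic_germ (h i).
  exists g; split; first by exists r, C.
  exists r; first exact: analytic_gt0 ag.
  by move=> r' r'0 r'r h' hh'; apply: gg => k; apply: le_trans r'r.
have [g hg] := choice H.
have [r r0 hr] := common_radius (fun i => (hg i).2).
apply: (germ_real_analytic r0 (germ_sum (index_enum 'I_n) (fun i => germZ (c i) (hg i).1))).
by move=> h' hh'; apply: eq_bigr => i _; rewrite (hr r r0 (lexx r)).
Qed.

Lemma tangent_generator M U rho : defining_function M U rho ->
  T10_generator M rho U (tangent_field rho).
Proof.
move=> [_ an _ grad]; split => [p Up j|p Up Mp]; last exact/T10M_basis/grad.
under eq_fun do rewrite tangent_fieldE.
by apply: real_analytic_sum => m; apply/real_analytic_partial/an.
Qed.

(** For L = a d/dz + b d/dw the bracket of L and its conjugate is the conjugate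
    of v minus v, where v is the vector of type (1, 0) built from the derivatives
    of a and b along the conjugate of L.  The Levi form at L is, up to a factor and
    conjugation, the determinant of
    (a, b) and v; if it were zero, v would be a multiple of L and the bracket a
    combination of L and its conjugate, against class I. *)
Lemma levi_neq0 M U rho (H : 'I_4 -> 'I_4 -> R) : U 0 -> M 0 ->
  defining_function M U rho -> general_class_I M U rho ->
  (forall j k, has_partial j (partial k rho) 0 (H j k)) ->
  \sum_j \sum_k (H j k)%:C * (tangent_field rho 0 0 j *
     (tangent_field rho 0 0 k)^*%C) != 0.
Proof.
move=> U0 M0 hM hI hH; set L := tangent_field rho.
apply/negP => /eqP lev0.
have [openU _ _ grad] := hM; have AB := gradient_neq0 (grad 0 U0 M0).
have := hI U L openU (@subset_refl _ U) (tangent_generator hM) 0 U0 M0.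
set br := lie_bracket _ _ _ => /basis_free.
have /perm_free -> : perm_eq [:: L 0; conj_vec (L 0); br] [:: br; L 0; conj_vec (L 0)].
  exact: (permEl (perm_catC [:: L 0; conj_vec (L 0)] [:: br])).
rewrite free_cons => /andP[/negP + _]; apply.
pose S m := \sum_k L 0 0 k * (H k m)%:C.
pose a := coefA (fun m => (S m)^*%C); pose b := coefB (fun m => (S m)^*%C).
have brE : br = conj_vec (vec10 a b) - vec10 a b.
  apply/rowP => j; rewrite [LHS]mxE [RHS]mxE [conj_vec (vec10 a b) 0 j]mxE [(- vec10 a b) 0 j]mxE sumrB.
  congr (_ - _).
    have -> : (fun q => conj_vec (L q) 0 j) =
        fun q => \sum_m (kappa j m)^*%C * (partial m rho q)%:C.
      apply/funext => q; rewrite mxE tangent_fieldE rmorph_sum.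
      by apply: eq_bigr => m _; rewrite /= conjM conjc_real.
    rewrite (eq_bigr (fun k => \sum_m (kappa j m)^*%C * (L 0 0 k * (H k m)%:C))).
      rewrite exchange_big /= vec10_coef rmorph_sum; apply: eq_bigr => m _.
      by rewrite -mulr_sumr /= conjM conjcK.
    move=> k _; rewrite (cpartial_sum _ (fun m => hH k m)) mulr_sumr.
    by apply: eq_bigr => m _; ring.
  have -> : (fun q => L q 0 j) = fun q => \sum_m kappa j m * (partial m rho q)%:C.
    by apply/funext => q; rewrite tangent_fieldE.
  rewrite (eq_bigr (fun k => \sum_m kappa j m * ((L 0 0 k)^*%C * (H k m)%:C))).
    rewrite exchange_big /= vec10_coef; apply: eq_bigr => m _.
    rewrite -mulr_sumr /S rmorph_sum; congr (_ * _); apply: eq_bigr => k _.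
    by rewrite /= conjM conjc_real.
  move=> k _; rewrite (cpartial_sum _ (fun m => hH k m)) mulr_sumr mxE.
  by apply: eq_bigr => m _; ring.
have : (\sum_j \sum_k (H j k)%:C * (L 0 0 j * (L 0 0 k)^*%C))^*%C = 0.
  by rewrite lev0 conjc0.
rewrite exchange_big rmorph_sum /=.
rewrite (eq_bigr (fun k => L 0 0 k * (S k)^*%C)); last first.
  move=> k _; rewrite -[in RHS](conjcK (L 0 0 k)) -conjM; congr _^*%C.
  by rewrite mulr_sumr; apply: eq_bigr => j _; ring.
rewrite vec10_sum => /eqP; rewrite mulf_eq0 invr_eq0 pnatr_eq0 orbF => /eqP h.
have [|m [am bm]] := @proportional _ _ a b AB.
  by apply/eqP; rewrite -oppr_eq0; apply/eqP; rewrite -[RHS]h /a /b; ring.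
have Lm : vec10 a b = m *: L 0 by rewrite /L /tangent_field /vec10 scalerDr !scalerA am bm.
have cL : conj_vec (vec10 a b) = m^*%C *: conj_vec (L 0).
  by rewrite Lm; apply/rowP => k; rewrite !mxE conjM.
rewrite brE cL Lm; apply: memvB; apply: memvZ; apply: memv_span; rewrite !inE eqxx ?orbT //.
Qed.

End LeviForm.

Section LeviCoordinates.
Variable R : realType.
Local Notation K := R[i].

(** For xi = vec10 a b and eta = vec10 n1 n2 these are the real coordinates of the
    point (z a + w n1, z b + w n2), with y and o in place of the conjugates. *)
Definition complexified (xi eta : 'rV[K]_4) (z y w o : K) : 4.-tuple K :=
  [tuple z * xi 0 k + y * (xi 0 k)^*%C + (w * eta 0 k + o * (eta 0 k)^*%C) | k < 4].

Lemma complexified_conj xi eta z y w o :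
  map_tuple (@conjc R) (complexified xi eta z y w o) =
  complexified xi eta y^*%C z^*%C o^*%C w^*%C.
Proof.
apply: eq_from_tnth => k; rewrite tnth_map !tnth_mktuple !conjD !conjM !conjcK.
ring.
Qed.

Lemma complexified_real (a b n1 n2 z w : K) (q := (z * a + w * n1, z * b + w * n2) : C2 R) :
  exists h : 4.-tuple R, [/\ q = real_translate 0 h,
    map_tuple (real_complex R) h = complexified (vec10 a b) (vec10 n1 n2) z z^*%C w w^*%C &
    forall k d, nm q.1 <= d -> nm q.2 <= d -> `|tnth h k| <= d].
Proof.
exists [tuple complex.Re (q.1 : K); complex.Im (q.1 : K);
              complex.Re (q.2 : K); complex.Im (q.2 : K)]; split.
- rewrite /real_translate add0r big4 !(tnth_nth 0) /= /real_basis !(tnth_nth 0) /=.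
  rewrite /q; congr (_, _) => /=; rewrite /GRing.scale /= ?mulr0 ?addr0 ?add0r ?mulr1.
    by rewrite [LHS]complexE [_ * 'i%C]mulrC.
  by rewrite [LHS]complexE [_ * 'i%C]mulrC.
- apply: eq_from_tnth => k; rewrite tnth_map tnth_mktuple !vec10E (tnth_nth 0).
  case: k => [[|[|[|[|k]]]]] //= _.
  + rewrite ReJ_add /q /= conjD !conjM !conjc_inv conjc_nat; ring.
  + rewrite ImJ_sub /q /= conjD !conjM conjN conj_i !conjc_inv conjc_nat; ring.
  + rewrite ReJ_add /q /= conjD !conjM !conjc_inv conjc_nat; ring.
  + rewrite ImJ_sub /q /= conjD !conjM conjN conj_i !conjc_inv conjc_nat; ring.
- move=> k d h1 h2; rewrite (tnth_nth 0); case: k => [[|[|[|[|k]]]]] //= _.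
  + exact: le_trans (Re_le_nm _) h1.
  + exact: le_trans (Im_le_nm _) h1.
  + exact: le_trans (Re_le_nm _) h2.
  + exact: le_trans (Im_le_nm _) h2.
Qed.

Lemma germ_complexified n xi eta (z y w o : n.-tuple K -> K) k (f : 4.-tuple K -> K) :
  germ k f -> germ 1 z -> germ 1 y -> germ 1 w -> germ 1 o ->
  germ k (fun t => f (complexified xi eta (z t) (y t) (w t) (o t))).
Proof.
move=> hf hz hy hw ho.
apply: (@germ_comp R 4 n k f (fun i t => z t * xi 0 i + y t * (xi 0 i)^*%C +
  (w t * eta 0 i + o t * (eta 0 i)^*%C))) => // i.
apply: germD; apply: germD.
- by apply: germ_eq (germZ (xi 0 i) hz) => t; rewrite mulrC.
- by apply: germ_eq (germZ (xi 0 i)^*%C hy) => t; rewrite mulrC.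
- by apply: germ_eq (germZ (eta 0 i) hw) => t; rewrite mulrC.
- by apply: germ_eq (germZ (eta 0 i)^*%C ho) => t; rewrite mulrC.
Qed.

(** The first basis vector (a, b) spans the complex tangent space, the second is
    a multiple of its orthogonal.  Dividing the equation by minus the value lev of
    the Levi form makes the mixed coefficient - 1; lev is real, so the equation
    remains real, and the multiple t is chosen so that the linear part becomes
    (w - o) / 2i. *)
Lemma levi_coordinates (M U : set (C2 R)) (rho : C2 R -> R) : U 0 -> M 0 ->
  defining_function M U rho -> general_class_I M U rho ->
  exists (a b n1 n2 : K) (P : K -> K -> K -> K -> K) (c c' : K) (d : R),
  [/\ a * n2 - b * n1 != 0,
      forall z y w o, (P z y w o)^*%C = P y^*%C z^*%C o^*%C w^*%C,
      germ_4 2 (fun z y w o => P z y w o - (w - o) / (2 * 'i%C)) &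
      germ_2 3 (fun z y => P z y 0 0 + z * y - c * z ^+ 2 - c' * y ^+ 2)] /\
  0 < d /\ forall (z w : K) (q := (z * a + w * n1, z * b + w * n2) : C2 R),
    nm q.1 < d -> nm q.2 < d ->
    U q /\ (rho q = 0 <-> P z z^*%C w w^*%C = 0).
Proof.
move=> U0 M0 hM hI; have [openU an hMrho grad] := hM.
have rho0 : rho 0 = 0 by apply/hMrho.
have [f [l [b0 [r [r0 f_sym rho_f f_jet]]]]] := real_jet (an 0 U0) rho0.
have hl k : partial k rho 0 = l k := has_partialP (partial_jet r0 rho_f f_jet k).
have hH j k := hessian_jet r0 rho_f f_jet j k.
have lev_neq0 := levi_neq0 U0 M0 hM hI hH.
pose l' k : K := (l k)%:C; pose a := coefA l'; pose b := coefB l'.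
have fieldE : tangent_field rho 0 = vec10 a b.
  by rewrite /tangent_field; congr (vec10 (coefA _) (coefB _)); apply/funext => k; rewrite hl.
have ab : (a != 0) || (b != 0).
  have := gradient_neq0 (grad 0 U0 M0); rewrite (_ : (fun k => _) = l') //.
  by apply/funext => k; rewrite hl.
rewrite fieldE in lev_neq0; pose xi := vec10 a b.
move: lev_neq0; set lev := \sum_j _ => lev_neq0.
have lev_conj : lev^*%C = lev.
  rewrite {1}/lev exchange_big rmorph_sum; apply: eq_bigr => j _.
  rewrite rmorph_sum; apply: eq_bigr => k _.
  by rewrite /= !conjM conjcK conjc_real [X in X%:C]addrC [_^*%C * _]mulrC.
have levE : lev = \sum_i \sum_j (b0 i j)%:C * (xi 0 i * (xi 0 j)^*%C + (xi 0 i)^*%C * xi 0 j).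
  under [RHS]eq_bigr do under eq_bigr do rewrite mulrDr.
  under [RHS]eq_bigr do rewrite big_split.
  rewrite big_split /= [X in _ = _ + X]exchange_big -big_split /=.
  apply: eq_bigr => i _; rewrite -big_split /=; apply: eq_bigr => j _.
  by rewrite rmorphD /=; rewrite -/xi; ring.
pose D := a * a^*%C + b * b^*%C.
have D0 : D != 0.
  have n2 x : x * x^*%C = (nm x ^+ 2)%:C :> K by rewrite -sqr_normc nmE rmorphXn.
  rewrite /D !n2 -rmorphD (inj_eq (@complexI R) _ 0) paddr_eq0 ?sqr_ge0 //.
  by rewrite !sqrf_eq0 !nm_eq0 negb_and.
pose t := 'i%C * lev / D; pose n1 := - t * b^*%C; pose n2 := t * a^*%C.
have t0 : t != 0 by rewrite !mulf_neq0 ?invr_neq0 // i_neq0.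
pose eta := vec10 n1 n2.
pose P z y w o := - lev^-1 * f (complexified xi eta z y w o).
have lxi : \sum_k xi 0 k * l' k = 0 by rewrite vec10_sum -/a -/b; ring.
have leta : \sum_k eta 0 k * l' k = 'i%C * lev / 2.
  by rewrite vec10_sum -/a -/b /n1 /n2 /t /D; field; rewrite -/D D0.
have conj_l (v : 'rV[K]_4) : \sum_k (v 0 k)^*%C * l' k = (\sum_k v 0 k * l' k)^*%C.
  by rewrite rmorph_sum; apply: eq_bigr => k _; rewrite /= conjM conjc_real.
have linE z y w o : \sum_k l' k * tnth (complexified xi eta z y w o) k =
    (w - o) * ('i%C * lev / 2).
  under eq_bigr do rewrite tnth_mktuple.
  transitivity (z * (\sum_k xi 0 k * l' k) + y * (\sum_k (xi 0 k)^*%C * l' k) +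
     (w * (\sum_k eta 0 k * l' k) + o * (\sum_k (eta 0 k)^*%C * l' k))).
    rewrite !mulr_sumr -!big_split /=; apply: eq_bigr => k _; ring.
  rewrite !conj_l lxi leta conjc0 !conjM conj_i lev_conj conjc_inv conjc_nat; ring.
pose quad s := \sum_i \sum_j (b0 i j)%:C * (tnth s i * tnth s j) : K.
have quad2 : germ 2 (fun s : 4.-tuple K => quad s).
  apply: germ_sum => i; apply: germ_sum => j; apply: germZ.
  exact: germM (germ_X _ i) (germ_X _ j).
pose rem s := f s - (\sum_i l' i * tnth s i + quad s).
have rem3 : germ 3 rem by [].
have PE z y w o : P z y w o - (w - o) / (2 * 'i%C) =
    - lev^-1 * (rem (complexified xi eta z y w o) + quad (complexified xi eta z y w o)).
  have ii := mulii R.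
  rewrite /P /rem linE; field: ii; rewrite i_neq0 lev_neq0 //.
have [d d0 hd] : exists2 d, 0 < d & forall q : C2 R, nm q.1 < d -> nm q.2 < d -> U q.
  have [d d0 hd] := (C2_openP U).1 openU 0 U0; exists d => // q q1 q2.
  by apply: hd; rewrite /= subr0.
exists a, b, n1, n2, P.
exists (- lev^-1 * \sum_i \sum_j (b0 i j)%:C * (xi 0 i * xi 0 j)).
exists (- lev^-1 * \sum_i \sum_j (b0 i j)%:C * ((xi 0 i)^*%C * (xi 0 j)^*%C)).
exists (Num.min d r); split; first split.
- have -> : a * n2 - b * n1 = t * D by rewrite /n1 /n2 /D; ring.
  by rewrite mulf_neq0.
- move=> z y w o; rewrite /P conjM conjN conjc_inv lev_conj -complexified_conj.
  congr (_ * _); rewrite -[in LHS](f_sym (complexified xi eta z y w o)) conjcK //.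
- have h (i : nat) : (i < 4)%N -> germ 1 (fun t : 4.-tuple K => t`_i) by exact: germ_nth.
  have := germ_complexified xi eta (germD (germ_lek (leqnSn 2) rem3) quad2)
    (h 0%N isT) (h 1%N isT) (h 2%N isT) (h 3%N isT).
  by move/(germZ (- lev^-1)); apply: germ_eq => s; rewrite PE.
- have h (i : nat) : (i < 2)%N -> germ 1 (fun t : 2.-tuple K => t`_i) by exact: germ_nth.
  have := germ_complexified xi eta rem3 (h 0%N isT) (h 1%N isT) (germ0 R 2 1) (germ0 R 2 1).
  move/(germZ (- lev^-1)); apply: germ_eq => s.
  move: (s`_0) (s`_1) => z y.
  have := PE z y 0 0; rewrite subrr mul0r subr0 => ->.
  have -> : quad (complexified xi eta z y 0 0) =
    z ^+ 2 * (\sum_i \sum_j (b0 i j)%:C * (xi 0 i * xi 0 j)) +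
    y ^+ 2 * (\sum_i \sum_j (b0 i j)%:C * ((xi 0 i)^*%C * (xi 0 j)^*%C)) + z * y * lev.
    rewrite levE !mulr_sumr -!big_split /=; apply: eq_bigr => i _.
    rewrite !mulr_sumr -!big_split /=; apply: eq_bigr => j _.
    by rewrite !tnth_mktuple; ring.
  by field; exact: lev_neq0.
split; first by rewrite lt_min d0.
move=> z w q; rewrite !lt_min => /andP[q1d q1r] /andP[q2d q2r]; split; first exact: hd.
have [h [qh hx hr]] := complexified_real a b n1 n2 z w.
have -> : P z z^*%C w w^*%C = - lev^-1 * (rho q)%:C.
  by rewrite /P -hx -rho_f -?qh // => k; apply: hr; apply: ltW.
split => [->|/eqP]; first by rewrite mulr0.
rewrite mulf_eq0 oppr_eq0 invr_eq0 (negbTE lev_neq0) /= => /eqP e.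
exact: complexI e.
Qed.

End LeviCoordinates.

(** * Holomorphic coordinates *)

Section Coordinates.
Variable R : realType.
Local Notation K := R[i].

Definition germ_at (F : C2 R -> K) (p : C2 R) : Prop :=
  germ 0 (fun t : 2.-tuple K => F (p + (t`_0 : K^o, t`_1 : K^o))).

Lemma germ_at_linear (c1 c2 : K) p :
  germ_at (fun q => c1 * (q.1 : K) + c2 * (q.2 : K)) p.
Proof.
have h (i : nat) : (i < 2)%N -> germ 0 (fun t : 2.-tuple K => t`_i).
  by move=> hi; apply: germ_lek (germ_nth R hi).
apply: germ_eq (germD (germ_cst 2 (c1 * (p.1 : K) + c2 * (p.2 : K)))
  (germD (germZ c1 (h 0%N isT)) (germZ c2 (h 1%N isT)))) => t /=; ring.
Qed.

Lemma germ_at_comp (W : K -> K -> K) (u v : C2 R -> K) k e C p :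
  analytic k e C (fun t : 2.-tuple K => W t`_0 t`_1) ->
  germ_at u p -> germ_at v p -> nm (u p) < e -> nm (v p) < e ->
  germ_at (fun q => W (u q) (v q)) p.
Proof.
move=> aW hu hv up vp.
pose x (i : 'I_2) (t : 2.-tuple K) : K :=
  if i == 0 then u (p + (t`_0 : K^o, t`_1 : K^o)) else v (p + (t`_0 : K^o, t`_1 : K^o)).
have p0 : p + ((tzero R 2)`_0 : K^o, (tzero R 2)`_1 : K^o) = p.
  by rewrite !nth_tzero; case: p {hu hv up vp x} => p1 p2; congr (_, _); rewrite /= addr0.
have hx i : germ 0 (x i) by rewrite /x; case: eqP.
have xe i : nm (x i (tzero R 2)) < e by rewrite /x p0; case: eqP.
apply: germ_eq (germ_comp_at aW hx xe) => t; congr W.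
  by rewrite -(tnth_nth 0 _ (Ordinal (isT : (0 < 2)%N))) tnth_mktuple.
by rewrite -(tnth_nth 0 _ (Ordinal (isT : (1 < 2)%N))) tnth_mktuple.
Qed.

(** Analytic functions are continuous. *)
Lemma open_cut (A : set (C2 R)) (F : C2 R -> K) (c : R) : open A ->
  (forall p, A p -> germ_at F p) -> open (A `&` [set p | nm (F p) < c]).
Proof.
move=> openA hF; apply/C2_openP => p [Ap /= Fp].
have [d d0 hd] := (C2_openP A).1 openA p Ap.
have e0 : 0 < (c - nm (F p)) / 2 by rewrite divr_gt0 // subr_gt0.
have [m m0 H] := small_ex (germ_smallP (germ_jet0 (hF p Ap)) e0).
exists (Num.min d m); first by rewrite lt_min d0.
move=> q; rewrite !lt_min => /andP[q1d q1m] /andP[q2d q2m]; split; first exact: hd.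
have := H [tuple (q.1 - p.1 : K); (q.2 - p.2 : K)] (box2 (ltW q1m) (ltW q2m)).
rewrite !nth_tzero /=.
have -> : p + ((q.1 - p.1 : K^o), (q.2 - p.2 : K^o)) = q.
  case: p q {Ap Fp hd e0 H q1d q1m q2d q2m} => p1 p2 [q1 q2].
  by congr (_, _) => /=; rewrite addrC subrK.
have -> : p + (0 : K^o, 0 : K^o) = p.
  by case: p {Ap Fp hd e0 H q1d q1m q2d q2m} => p1 p2; congr (_, _); rewrite /= addr0.
move=> h; rewrite /= -(subrK (F p) (F q)); apply: le_lt_trans (nmD _ _) _.
move: h Fp; lra.
Qed.

Definition polydomain (c1 c2 c3 c4 c5 : R) (F1 F2 F3 F4 F5 : C2 R -> K) : set (C2 R) :=
  (((([set: C2 R] `&` [set p | nm (F1 p) < c1]) `&` [set p | nm (F2 p) < c2])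
    `&` [set p | nm (F3 p) < c3]) `&` [set p | nm (F4 p) < c4])
    `&` [set p | nm (F5 p) < c5].

Lemma polydomainP c1 c2 c3 c4 c5 F1 F2 F3 F4 F5 p :
  polydomain c1 c2 c3 c4 c5 F1 F2 F3 F4 F5 p <->
  [/\ nm (F1 p) < c1, nm (F2 p) < c2, nm (F3 p) < c3, nm (F4 p) < c4 & nm (F5 p) < c5].
Proof.
by split=> [[[[[[_ h1] h2] h3] h4] h5]|[h1 h2 h3 h4 h5]]; split.
Qed.

Lemma polydomain_open c1 c2 c3 c4 c5 F1 F2 F3 F4 F5 :
  (forall p, germ_at F1 p) -> (forall p, germ_at F2 p) ->
  (forall p, nm (F1 p) < c1 -> nm (F2 p) < c2 ->
     [/\ germ_at F3 p, germ_at F4 p & germ_at F5 p]) ->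
  open (polydomain c1 c2 c3 c4 c5 F1 F2 F3 F4 F5).
Proof.
move=> h1 h2 h3; apply: open_cut => [|p [[[[_ p1] p2] _] _]]; last by case: (h3 p p1 p2).
apply: open_cut => [|p [[[_ p1] p2] _]]; last by case: (h3 p p1 p2).
apply: open_cut => [|p [[_ p1] p2]]; last by case: (h3 p p1 p2).
by apply: open_cut => //; apply: open_cut => //; exact: openT.
Qed.

End Coordinates.

Theorem mainTheorem1 (R : realType) (M U : set (C2 R)) (rho : C2 R -> R)
    (U0 : U 0) (M0 : M 0) (hM : defining_function M U rho)
    (hI : general_class_I M U rho) :
  exists (U' : set (C2 R)) (Phi : C2 R -> C2 R) (r : R)
         (A : mindex 2 -> R[i]) (B : mindex 3 -> R[i])
         (F : R[i] -> R -> R),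
    [/\ holomorphic_coordinates U' Phi,
        converges_on A r /\ bigO_order 1 A,
        converges_on B r /\ bigO_order 0 B,
        forall (z : R[i]) (u : R), `|z| < r%:C -> `|u| < r ->
          (F z u)%:C = z * z^*%C
                       + z * z^*%C * psum A [tuple z; z^*%C]
                       + z * z^*%C * (u%:C * psum B [tuple z; z^*%C; u%:C])
      & forall p : C2 R, U' p ->
          `|Phi p| < r%:C /\
          (M p <-> complex.Im (Phi p).2
                   = F (Phi p).1 (complex.Re (Phi p).2))].
Proof.
have [a [b [n1 [n2 [P [c [c' [d [[det0 symP linP quadP] [d0 rhoP]]]]]]]]]] :=
  levi_coordinates U0 M0 hM hI.
have [W [G [phi [A [B [e [[e0 [CW aW] [CG aG] [CA aA] [CB aB]]
  [WG graphP phi_real phi_fac]]]]]]]] := normal_form symP linP quadP.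
set det := a * n2 - b * n1 in det0.
pose K := R[i].
pose z1 (p : C2 R) : K := n2 / det * (p.1 : K) + - n1 / det * (p.2 : K).
pose w1 (p : C2 R) : K := - b / det * (p.1 : K) + a / det * (p.2 : K).
pose q1 (p : C2 R) : K := a * (p.1 : K) + n1 * (p.2 : K).
pose q2 (p : C2 R) : K := b * (p.1 : K) + n2 * (p.2 : K).
have qz (p : C2 R) : (z1 p * a + w1 p * n1 : K^o, z1 p * b + w1 p * n2 : K^o) = p.
  case: p => x y; congr (_, _); rewrite /z1 /w1 /= /det; field; exact: det0.
have zq (z w : K) : z1 (z * a + w * n1, z * b + w * n2) = z.
  by rewrite /z1 /= /det; field; exact: det0.
have wq (z w : K) : w1 (z * a + w * n1, z * b + w * n2) = w.
  by rewrite /w1 /= /det; field; exact: det0.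
pose Phi (p : C2 R) : C2 R := (z1 p, W (z1 p) (w1 p)).
pose Psi (p : C2 R) : C2 R :=
  ((p.1 : K) * a + G p.1 p.2 * n1, (p.1 : K) * b + G p.1 p.2 * n2).
pose id1 (p : C2 R) : K := p.1; pose id2 (p : C2 R) : K := p.2.
pose Wf (p : C2 R) : K := W (z1 p) (w1 p).
pose Gf (p : C2 R) : K := G p.1 p.2.
pose Psi1 (p : C2 R) : K := (Psi p).1; pose Psi2 (p : C2 R) : K := (Psi p).2.
(* The conditions that define U' and V correspond to each other under Phi and
   Psi; this makes the two maps inverse bijections. *)
pose U' := polydomain e e d d e z1 w1 id1 id2 Wf.
pose V := polydomain e e e d d id1 id2 Gf Psi1 Psi2.
have gz1 p : germ_at z1 p by exact: germ_at_linear.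
have gw1 p : germ_at w1 p by exact: germ_at_linear.
have gid1 p : germ_at id1 p.
  by apply: germ_eq (germ_at_linear 1 0 p) => t; rewrite mul1r mul0r addr0.
have gid2 p : germ_at id2 p.
  by apply: germ_eq (germ_at_linear 0 1 p) => t; rewrite mul1r mul0r add0r.
have gW p : nm (z1 p) < e -> nm (w1 p) < e -> germ_at Wf p.
  by move=> h1 h2; apply: germ_at_comp aW _ _ h1 h2.
have gG p : nm (id1 p) < e -> nm (id2 p) < e -> germ_at Gf p.
  by move=> h1 h2; apply: germ_at_comp aG (gid1 p) (gid2 p) h1 h2.
have gPsi (x y : K) p : nm (id1 p) < e -> nm (id2 p) < e ->
    germ_at (fun q => (q.1 : K) * x + Gf q * y) p.
  move=> h1 h2; apply: germ_eq (germD (germZ x (gid1 p)) (germZ y (gG p h1 h2))) => t.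
  by rewrite /id1; ring.
have W00 : W 0 0 = 0.
  have := germ_at0 (ex_intro _ e (ex_intro _ CW aW) : germ 1 (fun t : 2.-tuple K => W t`_0 t`_1)).
  by rewrite !nth_tzero.
have n0e : nm (0 : K) < e by rewrite nm0.
have n0d : nm (0 : K) < d by rewrite nm0.
have z10 : z1 0 = 0 by rewrite /z1 /= !mulr0 addr0.
have w10 : w1 0 = 0 by rewrite /w1 /= !mulr0 addr0.
have toV p : U' p -> V (Phi p) /\ Psi (Phi p) = p.
  move=> /polydomainP[h1 h2 h3 h4 h5].
  have wE : w1 p = G (z1 p) (Wf p).
    by apply/(WG _ _ _ (ltW h1) (ltW h2) (ltW h5)).
  have PP : Psi (Phi p) = p.
    by rewrite /Psi /Phi /= -/(Wf p) -wE qz.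
  split=> //; apply/polydomainP; rewrite /Psi1 /Psi2 PP; split => //.
  by rewrite /Gf /Phi /= -/(Wf p) -wE.
have toU q : V q -> U' (Psi q) /\ Phi (Psi q) = q.
  case: q => z s /polydomainP[h1 h2 h3 h4 h5].
  have sE : s = W z (Gf (z, s)).
    by apply/(WG _ _ _ (ltW h1) (ltW h3) (ltW h2)).
  have zE : z1 (Psi (z, s)) = z by rewrite /Psi zq.
  have wE : w1 (Psi (z, s)) = Gf (z, s) by rewrite /Psi wq.
  have PP : Phi (Psi (z, s)) = (z, s) by rewrite /Phi zE wE -sE.
  split=> //; apply/polydomainP; rewrite /Wf zE wE -sE; split => //.
have [cA [cA1 cA2 cA3]] := analytic_psum aA.
have [cB [cB1 cB2 cB3]] := analytic_psum aB.
have phiE (z : K) (u : R) : nm z <= e -> `|u| <= e ->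
    (complex.Re (phi z z^*%C u%:C))%:C = phi z z^*%C u%:C.
  move=> ze ue; have := phi_real z u ze ue.
  by case: (phi _ _ _) => x y /= [] /eqP; rewrite -subr_eq0 -opprD oppr_eq0 -mulr2n mulrn_eq0 /= => /eqP ->.
exists U', Phi, e, cA, cB, (fun z u => complex.Re (phi z z^*%C u%:C)); split => //.
- exists V, Psi; split; split => //.
  + apply: polydomain_open => // p h1 h2; split => //; exact: gW.
  + by apply/polydomainP; rewrite z10 w10 /Wf z10 w10 W00; split.
  + by rewrite /Phi z10 w10 W00.
  + apply: polydomain_open => // p h1 h2; split; [exact: gG|exact: gPsi|exact: gPsi].
  + move=> p /polydomainP[h1 h2 _ _ _]; split; apply: germ_holomorphic; first exact: gz1.
    exact: gW.
  + by move=> p /polydomainP[h1 h2 _ _ _]; split; apply: germ_holomorphic; apply: gPsi.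
- move=> z u; rewrite nm_ltC => /ltW ze /ltW ue.
  rewrite phiE // phi_fac // cA3 ?cB3 //; last by apply: box2; rewrite ?nm_conj.
  by apply: box3; rewrite ?nm_conj ?nm_real.
- move=> p Up; have [_ PP] := toV p Up.
  have [h1 h2 h3 h4 h5] := (polydomainP _ _ _ _ _ _ _ _ _ _ _).1 Up.
  split; first by rewrite nm_pair_lt h1 h5.
  have wE : w1 p = G (z1 p) (Wf p) by apply/(WG _ _ _ (ltW h1) (ltW h2) (ltW h5)).
  have := rhoP (z1 p) (w1 p); rewrite qz => /(_ h3 h4)[Upp rhoE].
  have [_ _ hMrho _] := hM; rewrite (hMrho p Upp) rhoE wE.
  rewrite (graphP _ _ (ltW h1) (ltW h5)) -phiE; last 2 first.
  - exact: ltW.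
  - exact: le_trans (Re_le_nm _) (ltW h5).
  by split => [/complexI //|->].
Qed.
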